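(* Let $\{\beta_n\}_n$ be a sequence of nonnegative reals and, for a spanning tree $T$ of $K_n$, let $L(T):=\sum_{e\in E(T)}U_e$, where $\{U_e\}_{e\in E(K_n)}$ are the i.i.d. $\mathrm{Unif}[0,1]$ labels used to define $\mathsf{WST}_n^{\beta_n}$. a) If $\beta_n\gg n\log n$, then $\mathbb E\left[L(\mathsf{WST}_n^{\beta_n})\right]\to\zeta(3)$ as $n\to\infty$. b) If $\beta_n=O(n\log n)$, then $\mathbb E\left[L(\mathsf{WST}_n^{\beta_n})\right]=O\left(\frac{n\log n}{\beta_n+\log n}\right)$. c) If $\beta_n\ll\frac{n}{\log n}$, then $$\mathbb E\left[L(\mathsf{WST}_n^{\beta_n})\right]=(1+o(1))\,\frac{n}{\beta_n}\cdot\frac{1-\beta_ne^{-\beta_n}-e^{-\beta_n}}{1-e^{-\beta_n}},$$ where the right-hand side is read as its limit $(1+o(1))\frac n2$ when $\beta_n=0$.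
   Context: $K_n$ is the complete graph on $n$ vertices; $\zeta$ is the Riemann zeta function. $a_n\gg b_n$ (equivalently $b_n\ll a_n$) means $\lim_{n\to\infty}b_n/a_n=0$; $b_n=O(a_n)$ means $\limsup_{n\to\infty} b_n/a_n<\infty$. Given the labels $\mathbf U=\{U_e\}_{e\in E(K_n)}$, $\mathsf{WST}_n^{\beta_n}$ is the random spanning tree of $K_n$ with $$\mathbb P(\mathsf{WST}_n^{\beta_n}=T\mid\mathbf U)=\frac{\exp(-\beta_n\sum_{e\in T}U_e)}{\sum_{T'}\exp(-\beta_n\sum_{e\in T'}U_e)},$$ the sum being over all spanning trees $T'$ of $K_n$. $\mathbb E$ averages over both $\mathbf U$ and the tree. *)

(* Defs.v *)
From mathcomp Require Import all_boot all_order all_algebra.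
From mathcomp Require Import all_classical all_reals all_analysis.
Set Implicit Arguments.
Unset Strict Implicit.
Unset Printing Implicit Defensive.
Import Order.TTheory GRing.Theory Num.Theory.
Import numFieldNormedType.Exports.
Local Open Scope classical_set_scope.
Local Open Scope ring_scope.

Definition edge (n : nat) := {e : {set 'I_n} | #|e| == 2%N}.

Definition adj n (F : {set edge n}) : rel 'I_n :=
  fun x y => [exists e in F, val e == [set x; y]%SET].

(* [ucycle] accepts the back-and-forth walk x, y, x along a single edge, which
   is not a cycle of the graph, hence the bound on the length. *)
Definition acyclic n (F : {set edge n}) : Prop :=
  forall c : seq 'I_n, ucycle (adj F) c -> (size c <= 2)%N.

Definition connected_graph n (F : {set edge n}) : Prop :=
  forall x y : 'I_n, connect (adj F) x y.

Definition is_spanning_tree n (F : {set edge n}) : Prop :=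
  connected_graph F /\ acyclic F.

Definition spanning_tree (n : nat) :=
  {F : {set edge n} | `[< is_spanning_tree F >]}.

Section weights.
Context {R : realType} {n : nat}.
Implicit Types (u : edge n -> R) (T : spanning_tree n).

Definition tree_length u T : R := \sum_(e in val T) u e.

Definition wst_weight (beta : R) u T : R :=
  expR (- beta * tree_length u T) /
  \sum_(T' : spanning_tree n) expR (- beta * tree_length u T').

End weights.

Section probability_notions.
Context {d : measure_display} {Om : measurableType d} {R : realType}.
Variable P : probability Om R.

Definition mutually_independent (I : finType) (X : I -> {RV P >-> R}) : Prop :=
  forall (J : {set I}) (B : I -> set R), (forall i, measurable (B i)) ->
    P (\bigcap_(i in [set` J]) (X i @^-1` B i)) =
    (\prod_(i in J) P (X i @^-1` B i))%E.

Definition generated_sigma (I : Type) (X : I -> {RV P >-> R}) : set (set Om) :=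
  <<s [set A | exists i, exists2 B : set R, measurable B & A = X i @^-1` B] >>.

(* [q] is a version of the conditional probability P(A | G). *)
Definition is_conditional_probability (A : set Om) (G : set (set Om))
    (q : Om -> R) : Prop :=
  (forall B : set R, measurable B -> G (q @^-1` B)) /\
  (forall C, G C -> P (A `&` C) = (\int[P]_(w in C) (q w)%:E)%E).

End probability_notions.

Record is_wst {d : measure_display} {Om : measurableType d} {R : realType}
    (P : probability Om R) (n : nat) (beta : R)
    (U : edge n -> {RV P >-> R}) (W : Om -> spanning_tree n) : Prop := {
  wst_labels_independent : mutually_independent U ;
  wst_labels_uniform : forall (e : edge n) (B : set R), measurable B ->
    distribution P (U e) B = uniform_prob (@ltr01 R) B ;
  wst_measurable : forall T, measurable (W @^-1` [set T]) ;
  wst_conditional_law : forall T,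
    is_conditional_probability P (W @^-1` [set T]) (generated_sigma U)
      (fun w => wst_weight beta (fun e => U e w) T)
}.

Definition expected_length {d : measure_display} {Om : measurableType d}
    {R : realType} (P : probability Om R) (n : nat)
    (U : edge n -> {RV P >-> R}) (W : Om -> spanning_tree n) : \bar R :=
  'E_P[fun w => tree_length (fun e => U e w) (W w)]%E.

Section asymptotics.
Context {R : realType}.

(* The zeta function at a real argument; it is +oo for s <= 1. *)
Definition zeta (s : R) : \bar R :=
  (\sum_(1 <= k <oo) (k%:R `^ (- s))%:E)%E.

(* Since x / 0 = 0, the ratios only make sense where the denominator does not
   vanish, which is therefore required eventually. *)
Definition asymp_gg (a b : R^nat) : Prop :=
  (\forall n \near \oo, a n != 0) /\ (b n / a n @[n --> \oo] --> (0 : R)).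

Definition asymp_O (b : (\bar R)^nat) (a : R^nat) : Prop :=
  (\forall n \near \oo, a n != 0) /\
  (limn_esup (fun n => b n * ((a n)^-1)%:E) < +oo)%E.

(* The first case is the limit of the second as b tends to 0. *)
Definition low_beta_length (n : nat) (b : R) : R :=
  if b == 0 then n%:R / 2
  else n%:R / b * ((1 - b * expR (- b) - expR (- b)) / (1 - expR (- b))).

End asymptotics.

(* Main.v *)
(* Everything is computed with labels uniform on the grid {0, ..., m} / (m+1),
   where probabilities are finite averages, and then m tends to infinity.

   (a), (b): under the Gibbs law the mean length of the tree exceeds the minimal
   one by at most (2 n ln n + 1) / beta. Kruskal's algorithm turns the minimal
   length into the integral over p of the number of components of G(n, p), minus
   one. Components of size k are, up to a negligible part, trees; there are
   C(n, k) k^(k-2) p^(k-1) (1-p)^(k(n-k)) of them on average, and the integral of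
   this over p tends to 1 / k^3. Vertex sets are shown to be connected by
   exploring neighbourhoods, which gives Cayley's k^(k-2) on the way.

   (c): let a be the weight of the trees through an edge e, stripped of the weight
   of e, and b the weight of the trees avoiding e. Neither depends on the label of
   e, and e belongs to the tree with probability w a / (w a + b), where
   w = exp (- beta U_e). If a / (a + b) is small, this is nearly w a / b, so the
   expected length is nearly the expected number n - 1 of edges times the mean of
   U_e under the density proportional to w. Smallness holds with overwhelming
   probability: by Rayleigh monotonicity a / (a + b) only grows when K_n is replaced
   by a subgraph, by symmetry it averages to O ((1 + beta) / g) in a complete
   subgraph on g + 2 vertices, and K_n contains many of these through e that are
   otherwise disjoint, hence independent. *)
Require Import Defs.
From mathcomp Require Import all_boot all_order all_algebra.
From mathcomp Require Import fingroup perm.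
From mathcomp Require Import all_classical all_reals all_analysis.
From mathcomp Require Import measurable_realfun.
From mathcomp Require Import ring lra zify.
Set Implicit Arguments.
Unset Strict Implicit.
Unset Printing Implicit Defensive.
Import Order.TTheory GRing.Theory Num.Theory.
Import numFieldNormedType.Exports.
Import boot.fintype boot.finset.
Local Open Scope ring_scope.

(** The grid replaces integration over labels by counting: independence becomes a rearrangement of
    finite sums, and the integral over p a Riemann sum of a Beta integral. For fixed n nothing is
    lost: raising every label by at most h changes a Gibbs probability by a factor of at most exp
    (beta n h), which tends to 1 with h.

    For (a) the probability that a set of k vertices is a component is only sandwiched, with
    exponents kn and k(n - k) of the closed edges. They differ by k^2, invisible after division by
    n, so both ends integrate to 1 / k^3 in the limit. The same upper bound, taken with the crudest
    truncation, serves (b).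

    For (c) the mean share of an edge is never computed: the estimate for a function of the label is
    compared with the same estimate for the constant 1, where symmetry gives exactly 2 / n. About 3
    ln n groups, of size of order n / ln n, push the exceptional probability down to n^-3, which
    survives a sum over at most n^2 edges; beta << n / ln n is what makes (1 + beta) / g small for
    groups of that size. *)

Section Graph.
Variable n : nat.
Implicit Types (F H T : {set edge n}) (e f g : edge n) (x y z a b c d : 'I_n)
  (S A B J : {set 'I_n}).

Lemma set2_inj a b c d : [set a; b] = [set c; d] ->
  (a = c /\ b = d) \/ (a = d /\ b = c).
Proof.
move=> E.
have := set21 a b; rewrite E => /set2P[] Ea; subst.
  left; split=> //; have := set22 c b; rewrite E => /set2P[] // Eb; subst.
  by have := set22 c d; rewrite -E => /set2P[].
right; split=> //; have := set22 d b; rewrite E => /set2P[] // Eb; subst.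
by have := set21 c d; rewrite -E => /set2P[].
Qed.

Lemma adjP F x y : reflect (exists2 e, e \in F & val e = [set x; y]) (adj F x y).
Proof.
apply: (iffP existsP) => [[e /andP[eF /eqP E]]|[e eF E]]; exists e => //.
by rewrite eF E eqxx.
Qed.

Lemma edge_neq e x y : val e = [set x; y] -> x != y.
Proof.
by move=> E; have := valP e; rewrite E cards2; case: (x != y).
Qed.

Lemma edge_ends e : exists x y, val e = [set x; y].
Proof. by have /cards2P[x [y [_ E]]] := valP e; exists x, y. Qed.

Lemma edge_exists x y : x != y -> exists e : edge n, val e = [set x; y].
Proof.
move=> xy; have E : #|[set x; y]| == 2%N by rewrite cards2 xy.
by exists (Sub [set x; y] E : edge n); rewrite SubK.
Qed.

Lemma adj_sym F : symmetric (adj F).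
Proof. by move=> x y; apply/adjP/adjP => -[e eF E]; exists e => //; rewrite E setUC. Qed.

(** * Connectivity, forests, and trees on a vertex subset *)

Definition conn F := connect (adj F).

Lemma connP F x y :
  reflect (exists2 p, path (adj F) x p & y = last x p) (conn F x y).
Proof. exact: connectP. Qed.

Lemma conn_sym F x y : conn F x y = conn F y x.
Proof. exact/sym_connect_sym/adj_sym. Qed.

Lemma conn0 F x : conn F x x. Proof. exact: connect0. Qed.

Lemma conn_trans F x y z : conn F x y -> conn F y z -> conn F x z.
Proof. exact: connect_trans. Qed.

Lemma edge_conn F e x y : e \in F -> val e = [set x; y] -> conn F x y.
Proof. by move=> eF E; apply/connect1/adjP; exists e. Qed.

Lemma conn_closed F (Q : pred 'I_n) x y :
  (forall a b, adj F a b -> Q a -> Q b) -> conn F x y -> Q x -> Q y.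
Proof.
move=> HQ /connectP[p]; elim: p x => [|z p IH] x /= => [_ -> //|].
by move=> /andP[xz /IH{}IH /IH{}IH] Qx; apply: IH; apply: HQ Qx.
Qed.

Lemma conn_sub F H x y : F \subset H -> conn F x y -> conn H x y.
Proof.
move=> FH; apply: connect_sub => a b /adjP[e eF E].
by apply: edge_conn E; apply: (fintype.subsetP FH).
Qed.

Lemma connU1 F e a b x y : val e = [set a; b] ->
  conn (e |: F) x y =
  [|| conn F x y, conn F x a && conn F b y | conn F x b && conn F a y].
Proof.
move=> E; apply/idP/idP.
  pose Q z := [|| conn F x z, conn F x a && conn F b z | conn F x b && conn F a z].
  move=> /(conn_closed (Q := Q)); apply; last by rewrite /Q conn0.
  move=> u v /adjP[g /setU1P[->|gF] Eg].
    rewrite /Q; move: Eg; rewrite E => /set2_inj[[<- <-]|[<- <-]].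
      case/or3P => [->|/andP[-> _]|/andP[-> _]]; by rewrite ?conn0 ?orbT.
    case/or3P => [->|/andP[-> _]|/andP[-> _]]; by rewrite ?conn0 ?orbT.
  have uv := edge_conn gF Eg.
  rewrite /Q => /or3P[xu|/andP[-> bu]|/andP[-> au]].
  - by rewrite (conn_trans xu uv).
  - by rewrite (conn_trans bu uv) orbT.
  - by rewrite (conn_trans au uv) !orbT.
have sub : F \subset e |: F by apply: subsetUr.
have ab : conn (e |: F) a b by apply: edge_conn E; rewrite setU11.
case/or3P => [/(conn_sub sub)//|/andP[/(conn_sub sub) xa /(conn_sub sub) yb]
  |/andP[/(conn_sub sub) xa /(conn_sub sub) yb]].
  exact: conn_trans (conn_trans xa ab) yb.
by apply: conn_trans yb; apply: conn_trans xa _; rewrite conn_sym.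
Qed.

(** Every edge is a bridge. Being boolean, this form can index finite sums, which the cycle form
    [acyclic] cannot; [acyclicP] identifies the two. *)
Definition forest F :=
  [forall e in F, forall x, forall y, (val e == [set x; y]) ==> ~~ conn (F :\ e) x y].

Lemma forestP F :
  reflect (forall e x y, e \in F -> val e = [set x; y] -> ~~ conn (F :\ e) x y)
          (forest F).
Proof.
apply: (iffP forallP) => [h e x y eF E|h e].
  have := h e; rewrite eF => /forallP/(_ x)/forallP/(_ y).
  by rewrite E eqxx.
apply/implyP=> eF; apply/forallP=> x; apply/forallP=> y; apply/implyP=> /eqP.
exact: h.
Qed.

Lemma forest_sub F H : F \subset H -> forest H -> forest F.
Proof.
move=> FH /forestP fH; apply/forestP => e x y eF E.
apply: contra (fH e x y (fintype.subsetP FH _ eF) E).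
by apply: conn_sub; apply: setSD.
Qed.

Lemma forestU1 F e a b : e \notin F -> val e = [set a; b] ->
  forest (e |: F) = forest F && ~~ conn F a b.
Proof.
move=> eF E; apply/idP/andP => [h|[fF nab]].
  split; first by apply: forest_sub h; apply: subsetUr.
  by have /forestP/(_ e a b) := h; rewrite setU1K // setU11; apply.
apply/forestP => g c d; case: (eqVneq g e) => [->|ge].
  by rewrite setU1K // E => _ /set2_inj[[<- <-]|[<- <-]] //; rewrite conn_sym.
rewrite in_setU1 (negPf ge) /= => gF Eg.
have -> : (e |: F) :\ g = e |: F :\ g.
  apply/setP => u; rewrite !inE; case: (eqVneq u e) => //= ->.
  by rewrite eq_sym ge.
have sub : F :\ g \subset F by apply: subD1set.
have cd : conn F c d by apply: edge_conn Eg.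
rewrite (connU1 _ _ _ E) !negb_or; apply/and3P; split.
- by move/forestP: fF; apply.
- apply: contra nab => /andP[/(conn_sub sub) h1 /(conn_sub sub) h2].
  by rewrite conn_sym (conn_trans h2) // (conn_trans _ h1) // conn_sym.
- apply: contra nab => /andP[/(conn_sub sub) h1 /(conn_sub sub) h2].
  by rewrite (conn_trans h2) // (conn_trans _ h1) // conn_sym.
Qed.

Definition comp F x := [set y | conn F x y].
Definition comps F := [set comp F x | x in 'I_n].
Definition kappa F := #|comps F|.

Lemma eq_comp F x y : (comp F x == comp F y) = conn F x y.
Proof.
apply/eqP/idP => [/setP/(_ y)|xy]; first by rewrite !inE conn0.
apply/setP => z; rewrite !inE; apply/idP/idP; last exact: conn_trans.
by apply: conn_trans; rewrite conn_sym.
Qed.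

Lemma kappaU1 F e a b : val e = [set a; b] -> ~~ conn F a b ->
  kappa F = (kappa (e |: F)).+1.
Proof.
move=> E nab; set G := e |: F.
have FG : F \subset G by apply: subsetUr.
have abG : conn G a b by apply: edge_conn E; rewrite setU11.
have cG z : ~~ conn G a z -> comp G z = comp F z.
  move=> naz; apply/setP => t; rewrite !inE (connU1 _ _ _ E).
  case: (boolP (conn F z t)) => //= _; apply/negbTE.
  rewrite negb_or !negb_and; apply/andP; split; apply/orP; left;
    apply: contra naz => /(conn_sub FG); rewrite conn_sym //.
  by apply: conn_trans.
(* Only the classes of [a] and [b] change: apart from the merged class on one side and these two on
   the other, the classes coincide. *)
suff h : comps G :\ comp G a = (comps F :\ comp F a) :\ comp F b.
  rewrite /kappa (cardsD1 (comp F a)) (cardsD1 (comp F b) (_ :\ _)) -h.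
  rewrite (cardsD1 (comp G a) (comps G)) !inE eq_comp conn_sym nab.
  by rewrite !imset_f.
apply/setP => C; rewrite !inE; apply/andP/and3P => -[].
  move=> Ca /imsetP[z _ EC]; subst C.
  have naz : ~~ conn G a z by rewrite conn_sym -eq_comp.
  rewrite cG // !eq_comp imset_f //; split=> //.
    by apply: contra naz => /(conn_sub FG) zb; rewrite (conn_trans abG) // conn_sym.
  by apply: contra naz => /(conn_sub FG); rewrite conn_sym.
move=> Cb Ca /imsetP[z _ EC]; subst C; move: Ca Cb; rewrite !eq_comp => nza nzb.
have naz : ~~ conn G a z.
  rewrite (connU1 _ _ _ E) conn0 /= (conn_sym _ b) (conn_sym _ a z).
  by rewrite !negb_or nza nzb (negPf nab).
by rewrite -cG // eq_comp conn_sym naz imset_f.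
Qed.

Lemma kappa0 : kappa set0 = n.
Proof.
rewrite /kappa card_imset ?card_ord // => x y /eqP; rewrite eq_comp => xy.
apply/eqP; apply: (conn_closed (Q := fun z => x == z) _ xy) => // a b.
by move=> /adjP[e]; rewrite in_set0.
Qed.

Lemma forest_card F : forest F -> (#|F| + kappa F)%N = n.
Proof.
move kF: #|F| => k; elim: k F kF => [|k IH] F kF.
  by move/eqP: kF; rewrite cards_eq0 => /eqP ->; rewrite kappa0.
move=> fF; have /set0Pn[e eF] : F != set0 by rewrite -cards_eq0 kF.
have [a [b E]] := edge_ends e.
have := cardsD1 e F; rewrite eF kF add1n => -[kF'].
have := IH _ (esym kF') (forest_sub (subD1set _ _) fF).
rewrite (@kappaU1 _ e a b) //; last by move/forestP: fF; apply.
by rewrite setD1K // addnS -addSn.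
Qed.

Lemma kappa_conn F H : (forall x y, conn F x y = conn H x y) -> kappa F = kappa H.
Proof.
move=> h; rewrite /kappa /comps; congr #|pred_of_set _|.
by apply: eq_imset => x; apply/setP => y; rewrite !inE h.
Qed.

Lemma kappa_anti F H : F \subset H -> (kappa H <= kappa F)%N.
Proof.
move=> FH; rewrite /kappa.
have -> : comps H = (fun C : {set 'I_n} => \bigcup_(x in C) comp H x) @: comps F.
  rewrite /comps -imset_comp; apply: eq_imset => x /=; apply/setP => y.
  apply/idP/bigcupP => [yx|[z]]; first by exists x => //; rewrite inE conn0.
  rewrite !inE => /(conn_sub FH); exact: conn_trans.
exact: leq_imset_card.
Qed.

(** Trees on a vertex subset remain edge sets of the whole graph, so that different subsets can be
    compared over the same labels; vertices outside [S] are isolated. *)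
Definition tree S F :=
  [&& [forall e in F, val e \subset S],
      [forall x in S, forall y in S, conn F x y] & forest F].

Lemma treeP S F :
  reflect [/\ forall e, e \in F -> val e \subset S,
             forall x y, x \in S -> y \in S -> conn F x y & forest F]
          (tree S F).
Proof.
apply: (iffP and3P) => -[h1 h2 h3]; split=> //.
- by move=> e eF; move/forall_inP: h1; apply.
- by move=> x y xS yS; move/forall_inP/(_ x xS)/forall_inP: h2; apply.
- exact/forall_inP.
- by apply/forall_inP=> x xS; apply/forall_inP => y; apply: h2.
Qed.

(** [F] is a tree with one edge removed, and [f] reconnects the same two halves as [e]. *)
Lemma tree_swap S F e f x y a b :
  e \notin F -> f \notin F -> val e = [set x; y] -> val f = [set a; b] ->
  val f \subset S -> conn F x a -> conn F b y ->
  tree S (e |: F) -> tree S (f |: F).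
Proof.
move=> eF fF Ee Ef fS xa yb /treeP[h1 h2 h3]; apply/treeP; split.
- by move=> g /setU1P[->//|gF]; apply: h1; rewrite setU1r.
- move=> u v uS vS; have := h2 u v uS vS; rewrite (connU1 _ _ _ Ee).
  have sub : F \subset f |: F by apply: subsetUr.
  have xy : conn (f |: F) x y.
    apply: conn_trans (conn_sub sub xa) _; apply: conn_trans (conn_sub sub yb).
    by apply: edge_conn Ef; rewrite setU11.
  case/or3P => [/(conn_sub sub)//|/andP[/(conn_sub sub) ux /(conn_sub sub) vy]
    |/andP[/(conn_sub sub) ux /(conn_sub sub) vy]].
    exact: conn_trans (conn_trans ux xy) vy.
  by apply: conn_trans vy; apply: conn_trans ux _; rewrite conn_sym.
move: h3; rewrite (forestU1 eF Ee) (forestU1 fF Ef) => /andP[-> nxy] /=.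
by apply: contra nxy => ab; apply: conn_trans (conn_trans xa ab) yb.
Qed.

Lemma tree_swapE S F e f x y a b :
  e \notin F -> f \notin F -> val e = [set x; y] -> val f = [set a; b] ->
  val e \subset S -> val f \subset S -> conn F x a -> conn F b y ->
  tree S (e |: F) = tree S (f |: F).
Proof.
move=> eF fF Ee Ef eS fS xa yb; apply/idP/idP; first exact: tree_swap xa yb.
by apply: (tree_swap fF eF Ef Ee eS); rewrite conn_sym.
Qed.

(** [S] forms one component and each outside vertex another, so [forest_card] fixes the number of
    edges. *)
Lemma tree_card S T : S != set0 -> tree S T -> #|T| = #|S|.-1.
Proof.
move=> /set0Pn[s sS] /treeP[h1 h2 h3].
have out z : z \notin S -> comp T z = [set z].
  move=> zS; apply/setP => t; rewrite !inE; apply/idP/eqP => [|->]; last exact: conn0.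
  move=> zt; apply/eqP; apply: (conn_closed (Q := fun w => w == z) _ zt) => // a b.
  move=> /adjP[e eT E] /eqP ?; subst a.
  by have := fintype.subsetP (h1 e eT) z; rewrite E set21 (negPf zS) => /(_ isT).
have cS z : z \in S -> comp T z = S.
  move=> zS; apply/setP => t; rewrite !inE; apply/idP/idP => [|tS]; last exact: h2.
  move=> zt; apply: (conn_closed (Q := fun w => w \in S) _ zt) => // a b.
  by move=> /adjP[e eT E] _; apply: (fintype.subsetP (h1 e eT)); rewrite E set22.
have K : kappa T = (#|~: S|).+1.
  have -> : kappa T = #|S |: [set [set z] | z in ~: S]|.
    rewrite /kappa; congr #|pred_of_set _|; apply/setP => C; rewrite !inE.
    apply/imsetP/orP => [[z _ ->]|[/eqP->|/imsetP[z zS ->]]].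
    - case: (boolP (z \in S)) => zS; first by rewrite cS // eqxx; left.
      by right; rewrite out //; apply: imset_f; rewrite inE.
    - by exists s; rewrite ?cS.
    - by exists z; rewrite ?out //; rewrite inE in zS.
  rewrite cardsU1 card_imset; last exact: set1_inj.
  case: imsetP => //= -[z zS ES]; move: sS zS; rewrite !inE ES.
  by rewrite set11.
have := forest_card h3; rewrite K -[in RHS](card_ord n) -(cardsC S).
have : (0 < #|S|)%N by apply/card_gt0P; exists s.
by case: #|S| => // k _; rewrite addnS -addSn => /eqP; rewrite eqn_add2r => /eqP[].
Qed.

(** The witness is the star centred at [x]. Its containing all edges at [x] later provides a tree
    through any given edge. *)
Lemma exists_tree S x : x \in S ->
  exists2 T, tree S T & forall e, x \in val e -> val e \subset S -> e \in T.
Proof.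
move=> xS; exists [set f : edge n | (x \in val f) && (val f \subset S)].
  have cx y : y \in S ->
      conn [set f : edge n | (x \in val f) && (val f \subset S)] x y.
    case: (eqVneq x y) => [-> _|xy yS]; first exact: conn0.
    have [e E] := edge_exists xy; apply: edge_conn (E).
    by rewrite inE E set21 subUset !sub1set xS yS.
  apply/treeP; split.
  - by move=> e; rewrite inE => /andP[].
  - by move=> a b aS bS; apply: conn_trans (cx b bS); rewrite conn_sym cx.
  apply/forestP => e a b; rewrite inE => /andP[xe eS] E.
  set G := _ :\ e.
  suff W u v : val e = [set u; v] -> u = x -> ~~ conn G u v.
    move: (xe); rewrite E => /set2P[/esym|/esym]; first exact: W.
    by rewrite conn_sym; apply: W; rewrite E setUC.
  move=> {}E ?; subst u; rewrite conn_sym; apply/negP => vx.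
  have xv := edge_neq E.
  have /eqP Q: x == v; last by rewrite Q eqxx in xv.
  apply: (conn_closed (Q := fun w => w == v) _ vx) => // u t.
  move=> /adjP[g]; rewrite !inE => /and3P[ge xg gS] Eg /eqP ?; subst u.
  move: xg; rewrite Eg => /set2P[Q|Q]; first by rewrite Q eqxx in xv.
  by case/eqP: ge; apply: val_inj; rewrite Eg E -Q setUC.
by move=> e xe eS; rewrite inE xe.
Qed.

End Graph.

(* Keeps unification from unfolding the decision procedures. *)
Opaque conn forest tree.


Lemma if_andb_congr (V : Type) (c1 c2 c3 c4 : bool) (x y : V) :
  (c1 -> c2 -> c3 = c4) ->
  (if c1 && c3 && c2 then x else y) = (if c1 && c4 && c2 then x else y).
Proof. by case: c1 => //; case: c2 => [->//|]; rewrite !andbF. Qed.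

(** * Acyclicity through cycles and through bridges *)

Section SpanningTrees.
Variable n : nat.
Implicit Types (F T : {set edge n}) (e f g : edge n) (x y z a b : 'I_n).

Lemma acyclicP F : acyclic F <-> forest F.
Proof.
split=> [ac|/forestP fF].
  apply/forestP => e x y eF E; apply/negP => /connP[p pth Ey].
  have xy := edge_neq E; move: Ey xy E; case: (shortenP pth) => q qth uq _ -> xy E.
  have qF : path (adj F) x q.
    apply: sub_path qth => a b /adjP[g]; rewrite !inE => /andP[_ gF] Eg.
    by apply/adjP; exists g.
  have : ucycle (adj F) (x :: q).
    rewrite /ucycle uq andbT /= rcons_path qF /=; apply/adjP; exists e => //.
    by rewrite E setUC.
  (* The closed path has at most two vertices: with one, [e] would be a loop; with two, the path
     would consist of [e] itself, which was removed. *)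
  move=> /ac; case: q qth uq xy E {qF} => [|z [|//]] /=; first by rewrite eqxx.
  rewrite andbT => /adjP[g]; rewrite !inE => /andP[/eqP ge _] Eg _ _ E _.
  by apply: ge; apply: val_inj; rewrite Eg; exact: esym E.
case=> [//|x [//|y [//|z p]]] /andP[/= /and3P[/adjP[e eF E]]].
rewrite rcons_path => yz /andP[zp /adjP[g gF Eg]] /and3P[xn yn _].
(* The rest of the cycle joins the ends of its first edge [e] without using it, so [e] is no
   bridge. *)
suff yx : conn (F :\ e) x y by have := fF e x y eF E; rewrite yx.
rewrite conn_sym; apply: (conn_trans (y := last z p)); last first.
  apply: edge_conn (Eg); rewrite !inE gF andbT; apply: contra yn => /eqP ge.
  move: Eg; rewrite ge E => /set2_inj[] [Ex Ey]; last by rewrite Ey mem_last.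
  by move: xn; rewrite Ex in_cons mem_last orbT.
apply/connP; exists (z :: p) => //.
have /sub_in_path : {in (fun u => u != x) &, subrel (adj F) (adj (F :\ e))}.
  move=> u v; rewrite !unfold_in => ux vx /adjP[f fF' Ef]; apply/adjP.
  exists f => //; rewrite !inE fF' andbT; apply/eqP => fe.
  have := set21 x y; rewrite -E -fe Ef => /set2P[] Ex.
    by rewrite Ex eqxx in ux.
  by rewrite Ex eqxx in vx.
apply; last by rewrite /= yz.
by apply/allP => u uy; apply: contraNneq xn => <-.
Qed.

Lemma spanning_treeE F : `[< is_spanning_tree F >] = tree setT F.
Proof.
apply/asboolP/treeP => [[h1 /acyclicP h2]|[_ h1 h2]]; split.
- by move=> e _; apply: subsetT.
- by move=> x y _ _; apply: h1.
- by [].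
- by move=> x y; apply: h1; rewrite inE.
- exact/acyclicP.
Qed.

Lemma big_spanning_tree (V : nmodType) (G : {set edge n} -> V) :
  \sum_(T : spanning_tree n) G (val T) = \sum_(T | tree setT T) G T.
Proof.
rewrite [RHS](reindex_omap (val : spanning_tree n -> _) insub); last first.
  by move=> T tT; rewrite insubT ?spanning_treeE.
by apply: eq_bigl => T; rewrite valK eqxx andbT -spanning_treeE (valP T).
Qed.

End SpanningTrees.

(** * Unit flows in trees *)

Section Flow.
Variables (R : realFieldType) (n : nat).
Implicit Types (F T : {set edge n}) (e f g : edge n) (x y z a b : 'I_n)
  (S : {set 'I_n}) (h : 'I_n -> R).

(** Edges carry no orientation, so quantities attached to their ends are summed over ordered pairs
    with an indicator. Every edge then counts in both directions, the source of the factors 2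
    below. *)
Lemma sum_ends e x y (G : 'I_n -> 'I_n -> R) : val e = [set x; y] ->
  \sum_a \sum_b (val e == [set a; b])%:R * G a b = G x y + G y x.
Proof.
move=> E; have xy := edge_neq E.
have h a b : (val e == [set a; b]) = (a == x) && (b == y) || (a == y) && (b == x).
  apply/eqP/orP; rewrite E.
    by move=> /set2_inj[[-> ->]|[-> ->]]; rewrite !eqxx; [left|right].
  by move=> [] /andP[/eqP -> /eqP ->] //; rewrite setUC.
rewrite pair_big /= (bigD1 (x, y)) //= (bigD1 (y, x)) /=; last first.
  by rewrite xpair_eqE eq_sym (negPf xy).
rewrite !h !eqxx orbT !mul1r big1 ?addr0 // => -[a b] /=.
by rewrite !xpair_eqE h => /andP[/negPf-> /negPf->]; rewrite mul0r.
Qed.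

(* The part of a unit flow from x to y carried by the edge f of a tree F + f,
   paired with the gradient of h. *)
Definition edge_flow F x y h f : R :=
  \sum_a \sum_b (val f == [set a; b])%:R *
    ((conn F x a && conn F b y)%:R * (h a - h b)).

(** Only the edges between [x] and [y] carry flow, and along them the differences of [h] telescope.
    The induction runs over an arbitrary path: prepending an edge alters the contribution of that
    edge alone. *)
Lemma tree_flow T x y h : forest T -> conn T x y ->
  \sum_(f in T) edge_flow (T :\ f) x y h f = h x - h y.
Proof.
move=> /forestP fT /connP[p pth ->{y}].
elim: p x pth => [|z p IH] x /=.
  move=> _; rewrite subrr big1 // => f fT'; have [a [b E]] := edge_ends f.
  rewrite /edge_flow (sum_ends _ E).
  have nab := fT f a b fT' E.
  rewrite [conn _ x a && _]andbC [conn _ x b && _]andbC.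
  have -> : conn (T :\ f) b x && conn (T :\ f) x a = false.
    by apply: contraNF nab => /andP[h1 h2]; rewrite conn_sym (conn_trans h1).
  have -> : conn (T :\ f) a x && conn (T :\ f) x b = false.
    by apply: contraNF nab => /andP[h1 h2]; rewrite (conn_trans h1).
  by rewrite !mul0r addr0.
move=> /andP[/adjP[e eT E] pth]; set y := last z p.
have zy : conn T z y by apply/connP; exists p.
have {IH}IH : \sum_(f in T) edge_flow (T :\ f) z y h f = h z - h y by apply: IH.
have -> : h x - h y = (h z - h y) + (h x - h z) by ring.
rewrite -{}IH.
rewrite (bigD1 e) //= [in RHS](bigD1 e) //=.
have -> : \sum_(f in T | f != e) edge_flow (T :\ f) x y h f =
          \sum_(f in T | f != e) edge_flow (T :\ f) z y h f.
  apply: eq_bigr => f /andP[fT' fe]; apply: eq_bigr => a _; apply: eq_bigr => b _.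
  have xz : conn (T :\ f) x z.
    by apply: edge_conn E; rewrite !inE eT eq_sym fe.
  have -> // : conn (T :\ f) x a = conn (T :\ f) z a.
  apply/idP/idP; last exact: conn_trans.
  by apply: conn_trans; rewrite conn_sym.
rewrite addrAC; congr (_ + _); rewrite /edge_flow !(sum_ends _ E) !conn0 /=.
have nxz : conn (T :\ e) x z = false by apply/negbTE/fT.
rewrite [conn _ z x]conn_sym nxz /= !mul0r addr0 add0r.
move: zy; rewrite -[in conn T z y](setD1K eT) (connU1 _ _ _ E) conn0 [conn _ z x]conn_sym nxz /=.
case: (boolP (conn _ z y)) => /= [zy _|_ ->]; last by rewrite /= mul0r mul1r; ring.
have -> : conn (T :\ e) x y = false.
  by apply: contraFF nxz => xy; apply: conn_trans xy _; rewrite conn_sym.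
by rewrite mul1r mul0r; ring.
Qed.

End Flow.

(** * Kirchhoff potentials and Rayleigh monotonicity *)

Section Rayleigh.
Variables (R : realFieldType) (n : nat) (w : edge n -> R).
Hypothesis w_ge0 : forall e, 0 <= w e.
Implicit Types (F T : {set edge n}) (e f g : edge n) (x y z a b : 'I_n)
  (S : {set 'I_n}) (h : 'I_n -> R).

Definition tree_with S e :=
  \sum_(F : {set edge n} | (e \notin F) && tree S (e |: F)) \prod_(f in F) w f.
Definition tree_without S e :=
  \sum_(T : {set edge n} | (e \notin T) && tree S T) \prod_(f in T) w f.

(** Kirchhoff's formula, unnormalised, for the potential of the network on [S] without [e], with the
    ends of [e] as poles: the forests have two components, which separate these ends, and [z] lies
    on the side of [x]. *)
Definition potential S e x z :=
  \sum_(F : {set edge n} | (e \notin F) && tree S (e |: F)) (\prod_(f in F) w f) * (conn F x z)%:R.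

(** The Dirichlet form of the network on [S] without [e], doubled because each edge is counted in
    both directions. *)
Definition energy S e (g h : 'I_n -> R) :=
  \sum_(f | (f != e) && (val f \subset S)) w f *
    \sum_a \sum_b (val f == [set a; b])%:R * ((g a - g b) * (h a - h b)).

Lemma tree_without_ge0 S e : 0 <= tree_without S e.
Proof. by apply: sumr_ge0 => F _; apply: prodr_ge0. Qed.

Lemma tree_with_ge0 S e : 0 <= tree_with S e.
Proof. by apply: sumr_ge0 => F _; apply: prodr_ge0. Qed.

Lemma two_forest S e x y F z : val e = [set x; y] -> val e \subset S -> e \notin F ->
  tree S (e |: F) -> z \in S -> conn F x z = ~~ conn F z y.
Proof.
move=> E; rewrite E subUset !sub1set => /andP[xS yS] eF /treeP[_ h2].
rewrite (forestU1 eF E) => /andP[_ nxy] zS.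
apply/idP/idP => [xz|nzy].
  by apply: contra nxy => zy; apply: conn_trans zy.
have := h2 x z xS zS; rewrite (connU1 _ _ _ E) conn0 (negPf nxy) /=.
by rewrite [conn F y z]conn_sym (negPf nzy) !orbF.
Qed.

(** Kirchhoff's current law in weak form: [potential] drives a flow of strength [tree_without]
    between the poles, tested against [h]. An edge [f] that reconnects a two-component forest
    produces a tree avoiding [e]; regrouping the pairs by this tree leaves the unit flow of
    [tree_flow]. *)
Lemma energy_potential S e x y h : val e = [set x; y] -> val e \subset S ->
  energy S e (potential S e x) h = 2 * tree_without S e * (h x - h y).
Proof.
move=> E eS.
have flow F f : val f \subset S -> f != e -> (e \notin F) && tree S (e |: F) ->
    (\sum_a \sum_b (val f == [set a; b])%:R *
      (((conn F x a)%:R - (conn F x b)%:R) * (h a - h b))) =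
    2 * (f \notin F)%:R * edge_flow F x y h f.
  move=> fS fe /andP[eF tF]; have [a [b Ef]] := edge_ends f.
  rewrite /edge_flow !(sum_ends _ Ef).
  move: fS; rewrite Ef subUset !sub1set => /andP[aS bS].
  rewrite !(two_forest E eS eF tF) //.
  case: (boolP (f \in F)) => fF /=.
    have ab := edge_conn fF Ef.
    have -> : conn F a y = conn F b y.
      by apply/idP/idP; [rewrite conn_sym in ab|]; apply: conn_trans.
    by rewrite !subrr; ring.
  by case: (conn F a y); case: (conn F b y) => /=; ring.
transitivity (\sum_(f | (f != e) && (val f \subset S))
    \sum_(F : {set edge n} | ((e \notin F) && tree S (e |: F)) && (f \notin F))
      2 * (\prod_(g in (f |: F)) w g) * edge_flow F x y h f).
  apply: eq_bigr => f /andP[fe fS].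
  rewrite [RHS]big_mkcondr /=.
  transitivity (w f * \sum_(F : {set edge n} | (e \notin F) && tree S (e |: F))
    (\prod_(g in F) w g) *
     (2 * (f \notin F)%:R * edge_flow F x y h f)).
    congr (_ * _); have [a [b Ef]] := edge_ends f.
    rewrite (sum_ends _ Ef) /potential -!sumrB !mulr_suml -big_split /=.
    apply: eq_bigr => F HF; rewrite -flow // (sum_ends _ Ef); ring.
  rewrite mulr_sumr; apply: eq_bigr => F HF.
  case: (boolP (f \in F)) => fF /=; first by rewrite mulr0 mul0r !mulr0.
  by rewrite big_setU1 //=; ring.
transitivity (\sum_(f | (f != e) && (val f \subset S))
    \sum_(F : {set edge n} | ((e \notin F) && tree S (f |: F)) && (f \notin F))
      2 * (\prod_(g in (f |: F)) w g) * edge_flow F x y h f).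
  apply: eq_bigr => {flow} f /andP[fe fS]; rewrite [LHS]big_mkcond [RHS]big_mkcond.
  apply: eq_bigr => F _.
  (* If [f] carries flow it joins the two halves of [F], so [e] and [f] complete [F] to a tree
     equally well; otherwise both summands vanish. *)
  have [->|K] : edge_flow F x y h f = 0 \/
      (e \notin F -> f \notin F -> tree S (e |: F) = tree S (f |: F)).
    have [a [b Ef]] := edge_ends f; rewrite /edge_flow !(sum_ends _ Ef).
    case: (boolP (conn F x a && conn F b y)) => [/andP[xa yb]|_].
      by right=> eF fF; apply: (tree_swapE eF fF E Ef eS fS xa yb).
    case: (boolP (conn F x b && conn F a y)) => [/andP[xb ya]|_].
      have Ef' : val f = [set b; a] by rewrite Ef setUC.
      by right=> eF fF; apply: (tree_swapE eF fF E Ef' eS fS xb ya).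
    by left; rewrite !mul0r addr0.
    move: (2 * _) => G; rewrite mulr0.
    exact: etrans (if_same _ _) (esym (if_same _ _)).
  exact: if_andb_congr K.
transitivity (\sum_f \sum_(T : {set edge n} | ((e \notin T) && tree S T) && (f \in T))
    2 * (\prod_(g in T) w g) * edge_flow (T :\ f) x y h f).
  rewrite [LHS]big_mkcond /=; apply: eq_bigr => f _.
  rewrite [RHS](reindex_onto (fun F => f |: F) (fun T => T :\ f)) /=; last first.
    by move=> T /andP[_ fT]; rewrite setD1K.
  case: ifPn => [/andP[fe fS]|].
    apply: eq_big => [F|F /andP[_ fF]]; last by rewrite setU1K.
    rewrite !inE eqxx andbT negb_or eq_sym fe /=; congr (_ && _).
    apply/idP/eqP => [fF|/setP/(_ f)]; first by rewrite setU1K.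
    by rewrite !inE eqxx /= => <-.
  move=> h1; rewrite big_pred0 // => F; apply/negP => /andP[/andP[/andP[]]].
  rewrite !inE negb_or eq_sym => /andP[ef _] /treeP[h2 _ _] _ _.
  by move: h1; rewrite ef h2 // setU11.
rewrite (exchange_big_dep (fun T => (e \notin T) && tree S T)) /=; last first.
  by move=> f T _ /andP[].
rewrite /tree_without mulrAC mulr_sumr; apply: eq_bigr => T /andP[eT tT].
have [h1 h2 h3] := treeP _ _ tT.
move: (eS); rewrite E subUset !sub1set => /andP[xS yS].
rewrite -mulr_sumr.
transitivity (2 * \prod_(g in T) w g * \sum_(f in T) edge_flow (T :\ f) x y h f).
  by congr (_ * _); apply: eq_bigl => f; rewrite eT tT.
by rewrite tree_flow //; [ring|exact: h2].
Qed.

Lemma energy_comb S e s t (g h : 'I_n -> R) :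
  energy S e (fun z => t * g z - s * h z) (fun z => t * g z - s * h z) =
  t ^+ 2 * energy S e g g - 2 * s * t * energy S e g h + s ^+ 2 * energy S e h h.
Proof.
rewrite /energy !mulr_sumr -!sumrB -big_split /=; apply: eq_bigr => f _.
have [a [b Ef]] := edge_ends f; rewrite !(sum_ends _ Ef); ring.
Qed.

Lemma energy_ge0 S e (g : 'I_n -> R) : 0 <= energy S e g g.
Proof.
apply: sumr_ge0 => f _; apply: mulr_ge0 => //.
apply: sumr_ge0 => a _; apply: sumr_ge0 => b _; apply: mulr_ge0 => //.
by rewrite -expr2 sqr_ge0.
Qed.

Lemma energy_le S S' e (g : 'I_n -> R) : S \subset S' -> energy S e g g <= energy S' e g g.
Proof.
move=> SS'; rewrite /energy [leLHS]big_mkcond [leRHS]big_mkcond /=.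
apply: ler_sum => f _; case: ifPn => [/andP[-> /fintype.subset_trans ->//]|_].
case: ifPn => // _; apply: mulr_ge0 => //.
apply: sumr_ge0 => a _; apply: sumr_ge0 => b _; apply: mulr_ge0 => //.
by rewrite -expr2 sqr_ge0.
Qed.

Lemma potentialB S e x y : val e = [set x; y] -> val e \subset S ->
  potential S e x x - potential S e x y = tree_with S e.
Proof.
move=> E eS; rewrite -sumrB; apply: eq_bigr => F /andP[eF tF].
rewrite (two_forest (z := y) E eS eF tF); last by apply: (fintype.subsetP eS); rewrite E set22.
by rewrite !conn0 /= mulr1 mulr0 subr0.
Qed.

(* Rayleigh monotonicity of the effective resistance tree_with / tree_without. *)
Lemma rayleigh S S' e : S \subset S' -> val e \subset S ->
  0 < tree_with S e -> 0 < tree_with S' e ->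
  tree_with S' e * tree_without S e <= tree_with S e * tree_without S' e.
Proof.
move=> SS' eS A0 A0'; have eS' := fintype.subset_trans eS SS'.
have [x [y E]] := edge_ends e.
pose g := potential S e x; pose g' := potential S' e x.
set A := tree_with S e in A0 *; set A' := tree_with S' e in A0' *.
set B := tree_without S e; set B' := tree_without S' e.
have h1 : energy S e g g = 2 * B * A by rewrite (energy_potential _ E eS) potentialB.
have h2 : energy S e g g' = 2 * B * A' by rewrite (energy_potential _ E eS) potentialB.
have h3 : energy S e g' g' <= 2 * B' * A'.
  apply: (le_trans (energy_le _ _ SS')).
  by rewrite (energy_potential _ E eS') potentialB.
(* Dirichlet's principle: both scaled potentials have the same drop [A * A'] across [e], and the
   energy of their difference is nonnegative. *)
have := energy_ge0 S e (fun z => A' * g z - A * g' z).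
rewrite energy_comb h1 h2.
have -> : A' ^+ 2 * (2 * B * A) - 2 * A * A' * (2 * B * A') + A ^+ 2 * energy S e g' g' =
  A ^+ 2 * energy S e g' g' - 2 * A * A' * (A' * B) by ring.
rewrite subr_ge0 => h4.
have : 2 * A * A' * (A' * B) <= 2 * A * A' * (A * B').
  apply: (le_trans h4); apply: (le_trans (ler_wpM2l _ h3)); first exact: sqr_ge0.
  by rewrite le_eqVlt; apply/orP; left; apply/eqP; ring.
have P : 0 < 2 * A * A' by rewrite !mulr_gt0.
by rewrite (ler_pM2l P).
Qed.

End Rayleigh.

(** * Averages over finite product spaces *)

Section FiniteProduct.
Variables (R : realFieldType) (I T : finType) (t0 : T).
Implicit Types (v : {ffun I -> T}) (D : {set I}).

Definition mean (phi : T -> R) : R := (\sum_t phi t) / #|T|%:R.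

Definition avg (F : {ffun I -> T} -> R) : R := (\sum_v F v) / #|{ffun I -> T}|%:R.

Definition depends_on (V : Type) D (F : {ffun I -> T} -> V) :=
  forall v v', {in D, v =1 v'} -> F v = F v'.

Let card_neq0 : #|{ffun I -> T}|%:R != 0 :> R.
Proof. by rewrite pnatr_eq0 -lt0n; apply/card_gt0P; exists [ffun=> t0]. Qed.

Lemma avg_cst c : avg (fun=> c) = c.
Proof. by rewrite /avg sumr_const -[c *+ _]mulr_natr mulfK ?card_neq0. Qed.

Lemma avg_sum (J : Type) (r : seq J) (P : pred J) (F : J -> {ffun I -> T} -> R) :
  avg (fun v => \sum_(j <- r | P j) F j v) = \sum_(j <- r | P j) avg (F j).
Proof. by rewrite /avg exchange_big /= mulr_suml. Qed.

Lemma avgD F G : avg (fun v => F v + G v) = avg F + avg G.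
Proof. by rewrite /avg big_split /= mulrDl. Qed.

Lemma avgZ c F : avg (fun v => c * F v) = c * avg F.
Proof. by rewrite /avg -mulr_sumr mulrA. Qed.

Lemma eq_avg F G : F =1 G -> avg F = avg G.
Proof. by move=> FG; rewrite /avg (eq_bigr G). Qed.

Lemma le_avg F G : (forall v, F v <= G v) -> avg F <= avg G.
Proof. by move=> FG; apply: ler_wpM2r; rewrite ?invr_ge0 ?ler0n // ler_sum. Qed.

Lemma avg_ge0 F : (forall v, 0 <= F v) -> 0 <= avg F.
Proof. by move=> F0; rewrite -(avg_cst 0); apply: le_avg. Qed.

Lemma avg_prod (D : {set I}) (phi : I -> T -> R) :
  avg (fun v => \prod_(i in D) phi i (v i)) = \prod_(i in D) mean (phi i).
Proof.
pose psi i := if i \in D then phi i else fun=> 1.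
have T0 : #|T|%:R != 0 :> R by rewrite pnatr_eq0 -lt0n; apply/card_gt0P; exists t0.
have -> : \prod_(i in D) mean (phi i) = \prod_i mean (psi i).
  rewrite big_mkcond /=; apply: eq_bigr => i _; rewrite /psi; case: ifP => // _.
  by rewrite /mean sumr_const divff.
rewrite /avg card_ffun natrX -prodr_const -prodfV.
have -> : \sum_(v : {ffun I -> T}) \prod_(i in D) phi i (v i) = \prod_i \sum_t psi i t.
  rewrite bigA_distr_bigA /=; apply: eq_bigr => v _.
  by rewrite big_mkcond /=; apply: eq_bigr => i _; rewrite /psi; case: ifP.
by rewrite -big_split.
Qed.

(** The involution [mix] exchanges the coordinates outside [D] between two samples. It turns the
    product of [F] at one sample and [G] at the other into a product at a single sample, the second
    sample then being free. *)
Lemma avg_indep D D' F G : [disjoint D & D'] -> depends_on D F -> depends_on D' G ->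
  avg (fun v => F v * G v) = avg F * avg G.
Proof.
move=> dis dF dG.
pose mix (p : {ffun I -> T} * {ffun I -> T}) :=
  ([ffun i => if i \in D then p.1 i else p.2 i],
   [ffun i => if i \in D then p.2 i else p.1 i]).
have mixK : involutive mix.
  move=> [v v']; rewrite /mix /=; congr (_, _); apply/ffunP => i;
    by rewrite !ffunE /=; case: (i \in D).
have : (\sum_v F v) * (\sum_v G v) = (\sum_v F v * G v) * #|{ffun I -> T}|%:R.
  rewrite mulr_suml; under eq_bigr do rewrite mulr_sumr.
  rewrite pair_big /= (reindex_inj (inv_inj mixK)) /=.
  transitivity (\sum_(p : {ffun I -> T} * {ffun I -> T}) F p.1 * G p.1).
    apply: eq_bigr => -[v v'] _ /=; congr (_ * _).
      by apply: dF => i iD; rewrite ffunE iD.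
    by apply: dG => i iD'; rewrite ffunE (disjointFl dis iD').
  rewrite -(pair_big xpredT xpredT (fun v _ => F v * G v)) /=.
  by rewrite mulr_suml; apply: eq_bigr => v _; rewrite sumr_const mulr_natr.
rewrite /avg mulrACA => ->; rewrite -mulrA; congr (_ * _).
by rewrite mulVKf ?card_neq0.
Qed.

Lemma depends_prod (J : eqType) (r : seq J) (D : J -> {set I}) (E : {set I})
    (F : J -> {ffun I -> T} -> R) :
  (forall j, depends_on (D j) (F j)) -> (forall j, j \in r -> D j \subset E) ->
  depends_on E (fun v => \prod_(j <- r) F j v : R).
Proof.
move=> dF DE v v' vv'; rewrite !big_seq; apply: eq_bigr => j jr.
by apply: dF => i iD; apply: vv'; apply: (fintype.subsetP (DE j jr)).
Qed.

Lemma avg_indep_prod (J : finType) (D : J -> {set I}) (F : J -> {ffun I -> T} -> R) :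
  (forall j k, j != k -> [disjoint D j & D k]) ->
  (forall j, depends_on (D j) (F j)) ->
  avg (fun v => \prod_j F j v) = \prod_j avg (F j).
Proof.
move=> dis dF; elim: (index_enum J) (index_enum_uniq J) => [|j r IH] /=.
  by move=> _; rewrite big_nil -[RHS]avg_cst; apply: eq_avg => v; rewrite big_nil.
move=> /andP[jr /IH{}IH]; rewrite big_cons -IH.
rewrite -(@avg_indep (D j) (\bigcup_(k in [set k in r]) D k)) //.
- by apply: eq_avg => v; rewrite big_cons.
- rewrite disjoint_subset; apply/fintype.subsetP => i ij; rewrite inE.
  apply/negP => /bigcupP[k]; rewrite inE => kr ik.
  have /dis/disjointFr/(_ ij) : j != k by apply: contraNneq jr => ->.
  by rewrite ik.
- apply: (depends_prod dF) => k kr.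
  by apply: (bigcup_sup k) => //; rewrite inE.
Qed.

Lemma avg_reindex (s : I -> I) (F : {ffun I -> T} -> R) : injective s ->
  avg (fun v => F [ffun i => v (s i)]) = avg F.
Proof.
move=> s_inj; rewrite /avg; congr (_ / _).
have inj : injective (fun v : {ffun I -> T} => [ffun i => v (s i)] : {ffun I -> T}).
  move=> v v' /ffunP E; apply/ffunP => i; have [s' _ s's] := injF_bij s_inj.
  by have := E (s' i); rewrite !ffunE s's.
by rewrite [RHS](reindex_inj inj).
Qed.

End FiniteProduct.

(** * Components and neighbourhood exploration *)

Section Exploration.
Variable n : nat.
Implicit Types (F : {set edge n}) (e : edge n) (x y z a b c : 'I_n)
  (S A B J I : {set 'I_n}).

Definition cut A B := [set e : edge n | [exists a in A, exists b in B, val e == [set a; b]]].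

Definition inner S := [set e : edge n | val e \subset S].

Lemma cutP A B e :
  reflect (exists a b, [/\ a \in A, b \in B & val e = [set a; b]]) (e \in cut A B).
Proof.
rewrite inE; apply: (iffP exists_inP) => [[a aA /exists_inP[b bB /eqP E]]|[a [b [aA bB E]]]].
  by exists a, b.
by exists a => //; apply/exists_inP; exists b => //; apply/eqP.
Qed.

Lemma card_cut A B : [disjoint A & B] -> #|cut A B| = (#|A| * #|B|)%N.
Proof.
move=> dis; rewrite -cardsX -(card_imset _ val_inj) /=.
have inj : {in setX A B &, injective (fun p : 'I_n * 'I_n => [set p.1; p.2])}.
  move=> [a b] [c d]; rewrite !inE /= => /andP[aA bB] /andP[cA dB].
  move=> /set2_inj[[-> ->]//|[ad _]]; have := disjointFr dis aA.
  by rewrite ad dB.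
rewrite -(card_in_imset inj); apply: eq_card => s; apply/imsetP/imsetP.
  move=> [e /cutP[a [b [aA bB E]]] ->]; exists (a, b) => //.
  by rewrite !inE aA.
move=> [[a b]]; rewrite !inE /= => /andP[aA bB] ->.
have ab : a != b by apply: contraTneq aA => ->; rewrite (disjointFl dis bB).
have [e E] := edge_exists ab; exists e => //.
by apply/cutP; exists a, b.
Qed.

Definition no_edge A B F := [disjoint cut A B & F].

Lemma no_edgeP A B F :
  reflect (forall a b, a \in A -> b \in B -> ~~ adj F a b) (no_edge A B F).
Proof.
apply: (iffP idP) => [dis a b aA bB|h].
  apply/adjP => -[e eF E]; have : e \in cut A B by apply/cutP; exists a, b.
  by move/(disjointFr dis); rewrite eF.
rewrite /no_edge disjoint_subset; apply/fintype.subsetP => e /cutP[a [b [aA bB E]]].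
by rewrite inE; apply: contra (h a b aA bB) => eF; apply/adjP; exists e.
Qed.

(* Every vertex of A is joined to J by a path inside A and J. *)
Definition reaches A J F := [forall B : {set 'I_n}, (B \subset A) && (B != set0) ==>
  [exists b in B, exists c in (A :|: J) :\: B, adj F b c]].

Lemma reachesP A J F :
  reflect (forall B, B \subset A -> B != set0 ->
             exists b c, [/\ b \in B, c \in A :|: J, c \notin B & adj F b c])
          (reaches A J F).
Proof.
apply: (iffP forallP) => [h B BA B0|h B].
  have := h B; rewrite BA B0 => /exists_inP[b bB /exists_inP[c]].
  by rewrite !inE => /andP[cB cA] bc; exists b, c; rewrite inE.
apply/implyP => /andP[BA B0]; have [b [c [bB cA cB bc]]] := h B BA B0.
apply/exists_inP; exists b => //; apply/exists_inP; exists c => //.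
by rewrite inE cB cA.
Qed.

Definition nbr F z A := [set a in A | adj F z a].

(** One step of the exploration: the neighbours of [z] take its place in [J]. No vertex left in [A]
    is then adjacent to [z], so [z] can be forgotten, and the new condition involves no edge at
    [z]. *)
Lemma reaches_step A J F z : z \in J -> z \notin A ->
  reaches A J F = reaches (A :\: nbr F z A) (J :\ z :|: nbr F z A) F.
Proof.
move=> zJ zA; set I := nbr F z A.
have UE : (A :\: I) :|: (J :\ z :|: I) = (A :|: J) :\ z.
  apply/setP => y; rewrite !inE.
  case: (eqVneq y z) => [->|_]; first by rewrite (negPf zA) ?andbF.
  by case: (y \in A); case: (adj F z y); case: (y \in J).
apply/reachesP/reachesP => h B BA B0.
  have [b [c [bB cA cB bc]]] := h B (fintype.subset_trans BA (subsetDl _ _)) B0.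
  exists b, c; split=> //; rewrite UE in_setD1 cA andbT.
  have := fintype.subsetP BA b bB; rewrite !inE => /andP[+ bA].
  by rewrite bA /=; apply: contraNneq => <-; rewrite adj_sym.
case: (set_0Vmem (B :&: I)) => [BI|[b]].
  have BA' : B \subset A :\: I by rewrite subsetD BA -setI_eq0 BI eqxx.
  have [b [c [bB cA cB bc]]] := h B BA' B0; exists b, c; split=> //.
  by move: cA; rewrite UE in_setD1 => /andP[].
rewrite !inE => /and3P[bB bA zb]; exists b, z; split=> //.
- by rewrite inE zJ orbT.
- by apply: contra zA => /(fintype.subsetP BA).
- by rewrite adj_sym.
Qed.

Lemma reaches_set0 J F : reaches set0 J F.
Proof. by apply/reachesP => B; rewrite subset0 => /eqP ->; rewrite eqxx. Qed.

Lemma reaches_to_set0 A F : A != set0 -> reaches A set0 F = false.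
Proof.
move=> A0; apply/negP => /reachesP/(_ A (subxx _) A0)[b [c [_]]].
by rewrite setU0 => ->.
Qed.

(** The two conditions look at disjoint sets of edges, those leaving [S] and those inside it, and
    will therefore be independent. *)
Lemma eq_compE S F x : x \in S ->
  (comp F x == S) = no_edge S (~: S) F && reaches (S :\ x) [set x] F.
Proof.
move=> xS; have US : S :\ x :|: [set x] = S by rewrite setUC setD1K.
apply/eqP/andP => [ES|[/no_edgeP h1 /reachesP h2]].
  have cl a b : a \in S -> adj F a b -> b \in S.
    rewrite -ES !inE => xa /adjP[e eF E].
    exact: conn_trans xa (edge_conn eF E).
  split; first by apply/no_edgeP => a b aS; rewrite inE; apply: contra; apply: cl.
  apply/reachesP => B BS /set0Pn[b0 b0B]; rewrite US.
  case: (boolP [exists b in B, exists c in S :\: B, adj F b c]).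
    move=> /exists_inP[b bB /exists_inP[c]]; rewrite !inE => /andP[cB cS] bc.
    by exists b, c.
  move=> /exists_inPn h; exfalso.
  have SB := fintype.subset_trans BS (subD1set _ _).
  have : x \in B.
    have : conn F b0 x.
      by rewrite conn_sym; have := fintype.subsetP SB _ b0B; rewrite -ES inE.
    move=> /(conn_closed (Q := mem B)); apply=> // a b ab aB.
    apply: contraT => bB; have /exists_inPn/(_ b) := h a aB.
    by rewrite !inE bB (cl _ _ (fintype.subsetP SB _ aB) ab) ab => /(_ isT).
  by move=> /(fintype.subsetP BS); rewrite !inE eqxx.
apply/eqP; rewrite eqEsubset; apply/andP; split.
  apply/fintype.subsetP => y; rewrite inE.
  move=> /(conn_closed (Q := mem S)); apply=> // a b ab aS.
  by apply: contraT => bS; have := h1 a b aS; rewrite inE bS ab => /(_ isT).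
apply: contraT => nsub; have B0 : S :\: comp F x != set0 by rewrite setD_eq0.
have BS : S :\: comp F x \subset S :\ x.
  by apply/fintype.subsetP => y; rewrite !inE => /andP[h ->]; rewrite andbT;
     apply: contraNneq h => ->; apply: conn0.
have [b [c [bB cS cB bc]]] := h2 _ BS B0.
move: bB cS cB; rewrite US !inE => /andP[/negP xb bS] -> /=.
rewrite andbT negbK => xc; case: xb; apply: conn_trans xc _.
by move: bc; rewrite adj_sym => /adjP[e eF E]; apply: edge_conn E.
Qed.

Lemma in_comps F S x : x \in S -> (S \in comps F) = (comp F x == S).
Proof.
move=> xS; apply/imsetP/eqP => [[y _ E]|<-]; last by exists x.
by move: xS; rewrite {}E inE => xy; apply/eqP; rewrite eq_comp conn_sym.
Qed.

Definition kappa_size F k := #|[set C in comps F | #|C| == k]|.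

Lemma kappa_sizeE F k : kappa_size F k = (\sum_(S : {set 'I_n} | #|S| == k) (S \in comps F))%N.
Proof.
rewrite /kappa_size -sum1_card [RHS]big_mkcond [LHS]big_mkcond /=.
by apply: eq_bigr => S _; rewrite inE; case: (S \in comps F); case: (#|S| == k).
Qed.

End Exploration.

(** * Counting rooted forests *)

Section Trees.
Variable R : realFieldType.

(* The number of forests on m + j vertices consisting of j trees rooted at
   given vertices; for m = j = 0 the formula gives 0. *)
Definition rooted_forests (m j : nat) : R := j%:R * (m + j)%:R ^+ m / (m + j)%:R.

Lemma rooted_forests_ge0 m j : 0 <= rooted_forests m j.
Proof. by rewrite /rooted_forests !mulr_ge0 ?invr_ge0 ?exprn_ge0. Qed.

Lemma sum_subsets (T : finType) (A : {set T}) (g : nat -> R) :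
  \sum_(I : {set T} | I \subset A) g #|I| = \sum_(i < #|A|.+1) 'C(#|A|, i)%:R * g i.
Proof.
rewrite (partition_big (fun I : {set T} => inord #|I| : 'I_(#|A|.+1)) xpredT) //=.
apply: eq_bigr => i _; rewrite -cards_draws.
transitivity (\sum_(I : {set T} | (I \subset A) && (#|I| == i)) g i).
  apply: eq_big => [I|I /andP[IA /eqP <-]].
    apply: andb_id2l => IA; rewrite -val_eqE /= inordK //.
    by rewrite ltnS subset_leq_card.
  by rewrite inordK // ltnS subset_leq_card.
rewrite sumr_const mulr_natl; congr (_ *+ _); apply: eq_card => I.
by rewrite !inE unfold_in /=.
Qed.

(** Removing one root turns its [i] neighbours into roots. The number of remaining vertices is the
    same for every [i], so the sum reduces to the binomial formula [S1] and its first moment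
    [S2]. *)
Lemma rooted_forests_rec m j : (0 < m)%N -> (0 < j)%N ->
  \sum_(i < m.+1) 'C(m, i)%:R * rooted_forests (m - i) (j.-1 + i) = rooted_forests m j.
Proof.
case: m => // m; case: j => // j _ _ /=.
set N : R := (m + j).+1%:R.
have N0 : N != 0 by rewrite pnatr_eq0.
have S1 : \sum_(i < m.+2) 'C(m.+1, i)%:R * N ^+ (m.+1 - i) = (N + 1) ^+ m.+1.
  by rewrite exprDn; apply: eq_bigr => i _; rewrite expr1n mulr1 mulr_natl.
have S2 : \sum_(i < m.+2) 'C(m.+1, i)%:R * i%:R * N ^+ (m.+1 - i) = m.+1%:R * (N + 1) ^+ m.
  rewrite big_ord_recl mulr0 mul0r add0r exprDn mulr_sumr; apply: eq_bigr => i _.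
  rewrite /= /bump /= add1n subSS expr1n mulr1 -natrM mulnC -mul_bin_diag natrM.
  by rewrite -mulrA [in RHS]mulr_natl -[X in _ = X *+ _]mulr_natl mulr_natl mulr_natl mulrnAC.
have -> : rooted_forests m.+1 j.+1 =
    N^-1 * (j%:R * (N + 1) ^+ m.+1 + m.+1%:R * (N + 1) ^+ m).
  rewrite /rooted_forests.
  have -> : (m.+1 + j.+1)%:R = N + 1 :> R by rewrite /N natr1 addSn addnS.
  have N1 : N + 1 != 0 by rewrite /N natr1 pnatr_eq0.
  have -> : m.+1%:R = N - j%:R :> R by rewrite /N -addSn natrD addrK.
  rewrite exprS -natr1; field; apply/andP; split => //.
rewrite -S1 -S2 mulr_sumr -big_split mulr_sumr /=; apply: eq_bigr => i _.
rewrite /rooted_forests.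
have -> : (m.+1 - i + (j + i))%N = (m + j).+1.
  by rewrite addnCA subnK 1?addnC // -ltnS ltn_ord.
by rewrite natrD -/N; ring.
Qed.

End Trees.

(** * Expected component counts of the random graph *)

Section RandomGraph.
Variables (R : realFieldType) (n : nat) (T : finType) (t0 : T) (op : pred T).
Implicit Types (v : {ffun edge n -> T}) (F : {set edge n}) (e : edge n)
  (D : {set edge n}) (x y z a b c : 'I_n) (S A B J I : {set 'I_n}).

Definition open_edges v := [set e : edge n | op (v e)].

Definition open_prob : R := mean (fun t => (op t)%:R).

Local Notation p := open_prob.
Local Notation q := (1 - open_prob).

Lemma prod_bool (K : finType) (A : {set K}) (b : pred K) :
  \prod_(i in A) (b i)%:R = [forall i in A, b i]%:R :> R.
Proof.
case: (boolP [forall i in A, b i]) => [/forall_inP h|].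
  by rewrite big1 // => i /h ->.
by move=> /forall_inPn[i iA /negPf bi]; rewrite (bigD1 i) //= bi mul0r.
Qed.

Let card_T : #|T|%:R != 0 :> R.
Proof. by rewrite pnatr_eq0 -lt0n; apply/card_gt0P; exists t0. Qed.

Lemma closed_prob : mean (fun t => (~~ op t)%:R) = q.
Proof.
rewrite /open_prob /mean -[X in X - _](divff card_T) -mulrBl; congr (_ / _).
rewrite -[X in X%:R - _]sum1_card natr_sum -sumrB; apply: eq_bigr => t _.
by case: (op t); rewrite /= ?subrr ?subr0.
Qed.

Lemma open_prob_ge0 : 0 <= p.
Proof. by rewrite /open_prob /mean mulr_ge0 ?invr_ge0 ?sumr_ge0. Qed.

Lemma closed_prob_ge0 : 0 <= q.
Proof. by rewrite -closed_prob /mean mulr_ge0 ?invr_ge0 ?sumr_ge0. Qed.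

Let q_le1 : q <= 1. Proof. by rewrite gerBl open_prob_ge0. Qed.

Lemma depends_open D (V : Type) (G : {set edge n} -> V) :
  (forall F F', (forall e, e \in D -> (e \in F) = (e \in F')) -> G F = G F') ->
  depends_on D (fun v => G (open_edges v)).
Proof. by move=> h v v' vv'; apply: h => e eD; rewrite !inE vv'. Qed.

Lemma avg_all_open D : avg (fun v => (D \subset open_edges v)%:R) = p ^+ #|D|.
Proof.
rewrite -prodr_const -(avg_prod t0); apply: eq_avg => v.
rewrite (prod_bool D (fun i => op (v i))); congr (_%:R); congr (nat_of_bool _).
apply/fintype.subsetP/forall_inP => h e /h; by rewrite inE.
Qed.

Lemma avg_all_closed D : avg (fun v => [disjoint D & open_edges v]%:R) = q ^+ #|D|.
Proof.
rewrite -closed_prob -prodr_const -(avg_prod t0); apply: eq_avg => v.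
rewrite (prod_bool D (fun i => ~~ op (v i))); congr (_%:R); congr (nat_of_bool _).
rewrite disjoint_subset.
apply/fintype.subsetP/forall_inP => h e /h; by rewrite !inE.
Qed.

Lemma depends_all_open D : depends_on D (fun v => (D \subset open_edges v)%:R : R).
Proof.
apply: (depends_open (G := fun F => (D \subset F)%:R)) => F F' h.
congr (_%:R); congr (nat_of_bool _).
by apply/fintype.subsetP/fintype.subsetP => h' e eD; have := h' e eD; rewrite (h e eD).
Qed.

Lemma depends_all_closed D : depends_on D (fun v => [disjoint D & open_edges v]%:R : R).
Proof.
apply: (depends_open (G := fun F => [disjoint D & F]%:R)) => F F' h.
congr (_%:R); congr (nat_of_bool _); rewrite !disjoint_subset.
apply/fintype.subsetP/fintype.subsetP => h' e eD; have := h' e eD; by rewrite !inE (h e eD).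
Qed.

Lemma depends_reaches A J :
  depends_on (inner (A :|: J)) (fun v => (reaches A J (open_edges v))%:R : R).
Proof.
apply: (depends_open (G := fun F => (reaches A J F)%:R)) => F F' h.
have adjE b c : b \in A :|: J -> c \in A :|: J -> adj F b c = adj F' b c.
  move=> bU cU; apply/adjP/adjP => -[e eF E]; exists e => //;
  by move: eF; rewrite h // inE E subUset !sub1set bU cU.
congr (_%:R); congr (nat_of_bool _).
apply/reachesP/reachesP => h' B BA B0;
  have [b [c [bB cU cB bc]]] := h' B BA B0; exists b, c; split=> //;
  [rewrite -adjE //|rewrite adjE //]; by rewrite inE (fintype.subsetP BA).
Qed.

Lemma nbrE F z A I : z \notin A -> I \subset A ->
  (nbr F z A == I) = (cut [set z] I \subset F) && no_edge [set z] (A :\: I) F.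
Proof.
move=> zA IA; apply/eqP/andP => [<-|[/fintype.subsetP h1 /no_edgeP h2]].
  split.
    apply/fintype.subsetP => e /cutP[a [b [/set1P ->]]]; rewrite inE => /andP[bA].
    by move=> /adjP[f fF Ef] E; have -> : e = f by apply: val_inj; rewrite E Ef.
  apply/no_edgeP => a b /set1P ->; rewrite !inE => /andP[+ bA].
  by rewrite bA.
apply/setP => a; rewrite inE; apply/andP/idP => [[aA za]|aI].
  apply: contraT => aI; have := h2 z a (set11 z).
  by rewrite inE aI aA za => /(_ isT).
split; first exact: (fintype.subsetP IA).
have za : z != a by apply: contraNneq zA => ->; apply: (fintype.subsetP IA).
have [e E] := edge_exists za; apply/adjP; exists e => //; apply: h1.
by apply/cutP; exists z, a; rewrite set11.
Qed.

Definition reach_prob A J : R := avg (fun v => (reaches A J (open_edges v))%:R).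

(** The event is split by the neighbourhood [I] of [z]. Three disjoint families of edges are
    involved: from [z] to [I], from [z] to the rest of [A], and edges avoiding [z]. *)
Lemma reach_prob_step A J z : z \in J -> [disjoint A & J] ->
  reach_prob A J = \sum_(I : {set 'I_n} | I \subset A)
    p ^+ #|I| * q ^+ (#|A| - #|I|) * reach_prob (A :\: I) (J :\ z :|: I).
Proof.
move=> zJ dis; have zA : z \notin A by rewrite (disjointFl dis zJ).
transitivity (avg (fun v => \sum_(I : {set 'I_n} | I \subset A)
   ((cut [set z] I \subset open_edges v)%:R *
    [disjoint cut [set z] (A :\: I) & open_edges v]%:R) *
   (reaches (A :\: I) (J :\ z :|: I) (open_edges v))%:R : R)).
  apply: eq_avg => v; rewrite (reaches_step _ zJ zA).
  have NA : nbr (open_edges v) z A \subset A.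
    by apply/fintype.subsetP => a; rewrite inE => /andP[].
  rewrite (bigD1 (nbr (open_edges v) z A)) //= big1 ?addr0.
    have := nbrE (open_edges v) zA NA; rewrite eqxx /no_edge => /esym/andP[-> ->].
    by rewrite !mul1r.
  move=> I /andP[IA In]; have := nbrE (open_edges v) zA IA.
  rewrite eq_sym (negPf In) /no_edge.
  by case: (_ \subset _) => /=; [move=> <-|]; rewrite ?mul0r ?mulr0 ?mul0r.
rewrite avg_sum; apply: eq_bigr => I IA.
have dz B : z \notin B -> [disjoint [set z] & B].
  by move=> zB; rewrite disjoints1.
have zI : z \notin I by apply: contra zA => /(fintype.subsetP IA).
have zAI : z \notin A :\: I by rewrite inE (negPf zA) andbF.
have subI B : B \subset A -> cut [set z] B \subset cut [set z] A.
  move=> BA; apply/fintype.subsetP => e /cutP[a [b [az bB E]]].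
  by apply/cutP; exists a, b; split=> //; apply: (fintype.subsetP BA).
have dcut : [disjoint cut [set z] I & cut [set z] (A :\: I)].
  rewrite disjoint_subset; apply/fintype.subsetP => e /cutP[a [b [/set1P -> bI E]]].
  rewrite inE; apply/cutP => -[a' [b' [/set1P -> bI']]]; rewrite E.
  move=> /set2_inj[[_ bb']|[zb' _]].
    by move: bI'; rewrite -bb' inE bI.
  by move: zAI; rewrite {1}zb' bI'.
rewrite (@avg_indep _ _ _ t0 (cut [set z] A) (inner (A :\: I :|: (J :\ z :|: I)))).
- rewrite (@avg_indep _ _ _ t0 (cut [set z] I) (cut [set z] (A :\: I))) //.
  + rewrite avg_all_open avg_all_closed !card_cut ?dz // cards1 !mul1n.
    by rewrite cardsDS.
  + exact: depends_all_open.
  + exact: depends_all_closed.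
- rewrite disjoint_subset; apply/fintype.subsetP => e /cutP[a [b [/set1P -> bA E]]].
  rewrite inE inE E subUset sub1set !inE eqxx (negPf zA) (negPf zI).
  by rewrite andbF.
- move=> v v' h; congr (_ * _).
    by apply: depends_all_open => e eD; apply: h; apply: (fintype.subsetP (subI I IA)).
  apply: depends_all_closed => e eD; apply: h.
  by apply: (fintype.subsetP (subI (A :\: I) (subsetDl A I))).
- exact: depends_reaches.
Qed.

Lemma reach_prob_le1 A J : 0 <= reach_prob A J <= 1.
Proof.
apply/andP; split; first by apply: avg_ge0.
rewrite -[leRHS](avg_cst (edge n) t0 _); apply: le_avg => v.
by case: reaches.
Qed.

(** The exploration follows [rooted_forests_rec], with a weight for open and closed edges. The upper
    bound discards the closed ones; the lower bound keeps them with a crude exponent, which suffices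
    because it does not involve [n]. *)
Lemma reach_prob_bounds A J : [disjoint A & J] -> (0 < #|A| + #|J|)%N ->
  rooted_forests R #|A| #|J| * p ^+ #|A| * q ^+ (#|A| * (#|A| + #|J|))
    <= reach_prob A J <= rooted_forests R #|A| #|J| * p ^+ #|A|.
Proof.
move: {2}(#|A| + #|J|)%N (erefl (#|A| + #|J|)%N) => k; elim: k A J => [|k IH] A J Ek dis.
  by rewrite Ek.
move=> _; case: (set_0Vmem A) => [A0|[a aA]].
  have J0 : #|J|%:R != 0 :> R by rewrite pnatr_eq0; move: Ek; rewrite A0 cards0 add0n => ->.
  have -> : reach_prob A J = 1.
    by rewrite /reach_prob A0 -[RHS](avg_cst (edge n) t0 _);
      apply: eq_avg => v; rewrite reaches_set0.
  by rewrite A0 cards0 mul0n /rooted_forests !expr0 !mulr1 add0n divff // lexx.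
have A0 : A != set0 by apply/set0Pn; exists a.
case: (set_0Vmem J) => [J0|[z zJ]].
  have -> : reach_prob A J = 0.
    by rewrite /reach_prob J0 -[RHS](avg_cst (edge n) t0 _);
      apply: eq_avg => v; rewrite reaches_to_set0.
  by rewrite J0 cards0 /rooted_forests !mul0r lexx.
have mA : (0 < #|A|)%N by rewrite card_gt0.
have mJ : (0 < #|J|)%N by apply/card_gt0P; exists z.
have hI I : I \subset A -> [/\ #|A :\: I| = (#|A| - #|I|)%N,
    #|J :\ z :|: I| = (#|J|.-1 + #|I|)%N, (#|I| <= #|A|)%N,
    [disjoint A :\: I & J :\ z :|: I] &
    (#|A| - #|I| + (#|J|.-1 + #|I|))%N = k].
  move=> IA; have cI := subset_leq_card IA; split=> //.
  - by rewrite cardsDS.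
  - rewrite cardsU [#|J|](cardsD1 z) zJ /=.
    suff -> : (J :\ z) :&: I = set0 by rewrite cards0 subn0.
    apply/eqP; rewrite setI_eq0 disjoint_sym; apply: disjointWl IA _.
    by apply: disjointWr dis; apply: subD1set.
  - rewrite disjoint_subset; apply/fintype.subsetP => b; rewrite !inE => /andP[bI bA].
    by rewrite (negPf bI) orbF (disjointFr dis bA) andbF.
  - by move: Ek mJ cI; clear; lia.
rewrite (reach_prob_step zJ dis) -(rooted_forests_rec R mA mJ).
rewrite -(sum_subsets _ (fun i => rooted_forests R (#|A| - i) (#|J|.-1 + i))).
rewrite !mulr_suml; apply/andP; split; apply: ler_sum => I IA.
  have [e1 e2 cI dI eK] := hI I IA.
  have k0 : (0 < #|A :\: I| + #|J :\ z :|: I|)%N.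
    by rewrite e1 e2 eK; move: mA mJ Ek; clear; lia.
  have [+ _] := andP (IH (A :\: I) (J :\ z :|: I) (etrans (congr2 addn e1 e2) eK) dI k0).
  rewrite e1 e2 => h.
  have pq0 : 0 <= p ^+ #|I| * q ^+ (#|A| - #|I|).
    by rewrite mulr_ge0 ?exprn_ge0 ?open_prob_ge0 ?closed_prob_ge0.
  apply: le_trans (ler_wpM2l pq0 h).
  have -> : p ^+ #|A| = p ^+ #|I| * p ^+ (#|A| - #|I|) by rewrite -exprD subnKC.
  set f := rooted_forests _ _ _.
  have -> : p ^+ #|I| * q ^+ (#|A| - #|I|) *
     (f * p ^+ (#|A| - #|I|) * q ^+ ((#|A| - #|I|) * (#|A| - #|I| + (#|J|.-1 + #|I|)))) =
     f * (p ^+ #|I| * p ^+ (#|A| - #|I|)) *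
     (q ^+ (#|A| - #|I|) * q ^+ ((#|A| - #|I|) * (#|A| - #|I| + (#|J|.-1 + #|I|)))) by ring.
  apply: ler_wpM2l.
    by rewrite !mulr_ge0 ?rooted_forests_ge0 ?exprn_ge0 ?open_prob_ge0.
  (* The exponents add up to [(#|A| - #|I|) * k.+1], where [k.+1] is the total number of
     vertices. *)
  rewrite -exprD; apply: ler_wiXn2l; rewrite ?closed_prob_ge0 ?q_le1 // eK.
  by rewrite -mulnS Ek leq_mul2r leq_subr orbT.
have [e1 e2 cI dI eK] := hI I IA.
have k0 : (0 < #|A :\: I| + #|J :\ z :|: I|)%N.
  by rewrite e1 e2 eK; move: mA mJ Ek; clear; lia.
have [_] := andP (IH (A :\: I) (J :\ z :|: I) (etrans (congr2 addn e1 e2) eK) dI k0).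
rewrite e1 e2 => h.
have p0 : 0 <= p ^+ #|I| by rewrite exprn_ge0 ?open_prob_ge0.
have r0 : 0 <= reach_prob (A :\: I) (J :\ z :|: I)
  by case/andP: (reach_prob_le1 (A :\: I) (J :\ z :|: I)).
have -> : p ^+ #|A| = p ^+ #|I| * p ^+ (#|A| - #|I|) by rewrite -exprD subnKC.
rewrite -[leLHS]mulrA [leRHS]mulrCA; apply: ler_wpM2l => //; apply: le_trans h.
by rewrite ler_piMl // exprn_ile1 ?closed_prob_ge0 ?q_le1.
Qed.

(** Cayley's k^(k-2), in the form that [rooted_forests] takes for k - 1 vertices and a single
    root. *)
Definition labelled_trees (k : nat) : R := k%:R ^+ k.-1 / k%:R.

Lemma avg_in_comps S x : x \in S ->
  avg (fun v => (S \in comps (open_edges v))%:R) =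
  q ^+ (#|S| * (n - #|S|)) * reach_prob (S :\ x) [set x].
Proof.
move=> xS.
have dS : [disjoint S & ~: S] by rewrite disjoints_subset setCK.
have -> : q ^+ (#|S| * (n - #|S|)) =
    avg (fun v => [disjoint cut S (~: S) & open_edges v]%:R).
  by rewrite avg_all_closed card_cut // [#|~: S|]cardsCs setCK card_ord.
rewrite -(@avg_indep _ _ _ t0 (cut S (~: S)) (inner S)).
- by apply: eq_avg => v; rewrite (in_comps _ xS) (eq_compE _ xS) -natrM mulnb.
- rewrite disjoint_subset; apply/fintype.subsetP => e /cutP[a [b [aS bS E]]].
  by rewrite !inE E subUset !sub1set aS; rewrite inE in bS; rewrite (negPf bS).
- exact: depends_all_closed.
- have := @depends_reaches (S :\ x) [set x].
  by rewrite setUC setD1K.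
Qed.

Lemma avg_kappa_size k : (0 < k <= n)%N ->
  'C(n, k)%:R * labelled_trees k * p ^+ k.-1 * q ^+ (k * n)
    <= avg (fun v => (kappa_size (open_edges v) k)%:R)
    <= 'C(n, k)%:R * labelled_trees k * p ^+ k.-1 * q ^+ (k * (n - k)).
Proof.
move=> /andP[k0 kn].
have -> : avg (fun v => (kappa_size (open_edges v) k)%:R) =
    \sum_(S : {set 'I_n} | #|S| == k) avg (fun v => (S \in comps (open_edges v))%:R) :> R.
  transitivity (avg (fun v => \sum_(S : {set 'I_n} | #|S| == k)
      (S \in comps (open_edges v))%:R : R)); last exact: avg_sum.
  apply: eq_avg => v; rewrite kappa_sizeE natr_sum.
  by apply: eq_bigr => S _; case: (_ \in _).
have -> : 'C(n, k)%:R = \sum_(S : {set 'I_n} | #|S| == k) 1 :> R.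
  rewrite sumr_const; congr (_%:R); rewrite -[in LHS](card_ord n) -card_draws.
  by apply: eq_card => S; rewrite !inE.
rewrite !mulr_suml; apply/andP; split; apply: ler_sum => S /eqP Sk.
  have /card_gt0P[x xS] : (0 < #|S|)%N by rewrite Sk.
  have cS : #|S :\ x| = k.-1 by rewrite -Sk (cardsD1 x S) xS.
  have dS : [disjoint S :\ x & [set x]].
    by rewrite disjoint_sym disjoints1 !inE eqxx.
  have := reach_prob_bounds dS; rewrite cards1 cS addn1 => /(_ isT)/andP[h _].
  rewrite (avg_in_comps xS) Sk.
  have q0 m : 0 <= q ^+ m by rewrite exprn_ge0 ?closed_prob_ge0.
  apply: le_trans (ler_wpM2l (q0 _) h).
  rewrite mul1r prednK // /rooted_forests addn1 prednK // mul1r -/(labelled_trees k).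
  rewrite [leRHS]mulrC -[leRHS]mulrA; apply: ler_wpM2l.
    by rewrite /labelled_trees !mulr_ge0 ?exprn_ge0 ?invr_ge0 ?open_prob_ge0.
  rewrite -exprD; apply: ler_wiXn2l; rewrite ?closed_prob_ge0 ?q_le1 //.
  (* The closed edges contribute [k * (n - k)] towards the outside and at most [k.-1 * k] in the
     exploration, together no more than [k * n]. *)
  by move: k0 kn; clear; nia.
have /card_gt0P[x xS] : (0 < #|S|)%N by rewrite Sk.
have cS : #|S :\ x| = k.-1 by rewrite -Sk (cardsD1 x S) xS.
have dS : [disjoint S :\ x & [set x]].
  by rewrite disjoint_sym disjoints1 !inE eqxx.
have := reach_prob_bounds dS; rewrite cards1 cS addn1 => /(_ isT)/andP[_ h].
rewrite (avg_in_comps xS) Sk mul1r mulrC ler_wpM2r ?exprn_ge0 ?closed_prob_ge0 //.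
by apply: (le_trans h); rewrite /rooted_forests addn1 prednK // mul1r.
Qed.

End RandomGraph.

(** * Minimal trees and Kruskal's formula *)

Section MinimalTree.
Variable n : nat.
Implicit Types (F H T : {set edge n}) (e f g : edge n) (x y z a b c d : 'I_n)
  (S : {set 'I_n}).

Definition edges_below (v : edge n -> nat) (j : nat) := [set e : edge n | (v e < j)%N].

(** Edges of [F] outside [H] are deleted while [a] and [b] stay connected. As [F :&: H] does not
    connect them, some deletion separates them, and the deleted edge bridges the two sides. *)
Lemma crossing_edge F H a b : conn F a b -> ~~ conn (F :&: H) a b ->
  exists g c d, [/\ g \in F, g \notin H, val g = [set c; d],
    conn (F :\ g) a c & conn (F :\ g) d b].
Proof.
move k: #|F :\: H| => m; elim: m F k => [|m IH] F k ab nab.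
  case/negP: nab; move/eqP: k; rewrite cards_eq0 setD_eq0 => /setIidPl ->.
  exact: ab.
have /card_gt0P[g] : (0 < #|F :\: H|)%N by rewrite k.
rewrite inE => /andP[gH gF].
case: (boolP (conn (F :\ g) a b)) => [ab'|nab'].
  have [||g' [c [d [g'F g'H E ac db]]]] := IH (F :\ g) _ ab'.
  - have -> : (F :\ g) :\: H = (F :\: H) :\ g by rewrite !setDDl setUC.
    by move: k; rewrite (cardsD1 g (F :\: H)) inE gH gF => -[].
  - by apply: contra nab; apply: conn_sub; apply: setSI; apply: subD1set.
  have sub : (F :\ g) :\ g' \subset F :\ g' by apply: setSD; apply: subD1set.
  exists g', c, d; split=> //; [|exact: conn_sub ac|exact: conn_sub db].
  by move: g'F; rewrite inE => /andP[].
have [c [d E]] := edge_ends g.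
move: ab; rewrite -{1}(setD1K gF) (connU1 _ _ _ E) (negPf nab') /=.
case/orP => /andP[h1 h2]; [exists g, c, d|exists g, d, c]; split=> //.
by rewrite E setUC.
Qed.

Lemma minimal_tree_conn (v : edge n -> nat) T j :
  tree setT T ->
  (forall T', tree setT T' -> (\sum_(e in T) v e <= \sum_(e in T') v e)%N) ->
  kappa (T :&: edges_below v j) = kappa (edges_below v j).
Proof.
move=> tT minT; set H := edges_below v j; apply: kappa_conn => x y.
apply/idP/idP; first by apply: conn_sub; apply: subsetIr.
move=> xy; apply: (conn_closed (Q := conn (T :&: H) x) _ xy) => [a b|]; last first.
  exact: conn0.
move=> /adjP[f fH Ef] xa; apply: conn_trans xa _; apply: contraT => nab.
have [_ cT _] := treeP _ _ tT.
have [g [c [d [gT gH Eg ac db]]]] := crossing_edge (cT a b (in_setT _) (in_setT _)) nab.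
have fT : f \notin T.
  by apply: contra nab => fT; apply: edge_conn Ef; rewrite inE fT.
have fT' : f \notin T :\ g by apply: contra fT; rewrite inE => /andP[].
have tT' : tree setT (f |: T :\ g).
  have gT' : g \notin T :\ g by rewrite !inE eqxx.
  have ca : conn (T :\ g) c a by rewrite conn_sym.
  have bd : conn (T :\ g) b d by rewrite conn_sym.
  by apply: (tree_swap gT' fT' Eg Ef (subsetT _) ca bd); rewrite setD1K.
have := minT _ tT'; rewrite big_setU1 //= (big_setD1 g gT) /= leq_add2r leqNgt.
move: fH gH; rewrite !inE -leqNgt => h1 h2.
by rewrite (leq_trans h1 h2).
Qed.

(** Kruskal's formula as a layer-cake sum over integer thresholds. It starts at 1 because a label
    [v e] is the number of [j] with [1 <= j <= v e]. *)
Definition mst_length (v : edge n -> nat) (N : nat) :=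
  (\sum_(1 <= j < N) (kappa (edges_below v j)).-1)%N.

Lemma length_layers (v : edge n -> nat) N T : (forall e, (v e < N)%N) ->
  (\sum_(e in T) v e = \sum_(1 <= j < N) #|T :\: edges_below v j|)%N.
Proof.
move=> vN; transitivity (\sum_(e in T) \sum_(1 <= j < N) (j <= v e))%N.
  apply: eq_bigr => e _; have := vN e; case: N {vN} => // N; rewrite ltnS => vN.
  rewrite (big_cat_nat (n := (v e).+1)) //=.
  have -> : (\sum_((v e).+1 <= j < N.+1) (j <= v e) = 0)%N.
    rewrite big_nat_cond big1 // => j /andP[/andP[h _] _].
    by apply/eqP; rewrite eqb0 -ltnNge.
  rewrite addn0 (eq_big_nat _ _ (F2 := fun=> 1%N)); last first.
    by move=> j /andP[_]; rewrite ltnS => ->.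
  by rewrite sum_nat_const_nat subSS subn0 muln1.
rewrite exchange_big /=; apply: eq_bigr => j _.
rewrite -sum1_card big_mkcond [RHS]big_mkcond /=; apply: eq_bigr => e _.
by rewrite !inE -leqNgt andbC; case: (e \in T); case: leqP.
Qed.

Lemma tree_above (v : edge n -> nat) T j : (0 < n)%N -> tree setT T ->
  #|T :\: edges_below v j| = (kappa (T :&: edges_below v j)).-1.
Proof.
move=> n0 tT; have [_ _ fT] := treeP _ _ tT.
have cT : #|T| = n.-1.
  rewrite (tree_card _ tT) ?cardsT ?card_ord //.
  by apply/set0Pn; exists (Ordinal n0); rewrite inE.
have := forest_card (forest_sub (subsetIl T (edges_below v j)) fT).
by rewrite cardsD cT; move: n0; clear; lia.
Qed.

Lemma mst_length_le (v : edge n -> nat) N T : (0 < n)%N -> (forall e, (v e < N)%N) ->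
  tree setT T -> (mst_length v N <= \sum_(e in T) v e)%N.
Proof.
move=> n0 vN tT; rewrite (length_layers _ vN); apply: leq_sum => j _.
by rewrite tree_above // -!subn1 leq_sub2r // kappa_anti // subsetIr.
Qed.

Lemma mst_length_eq (v : edge n -> nat) N : (0 < n)%N -> (forall e, (v e < N)%N) ->
  exists2 T, tree setT T & (\sum_(e in T) v e)%N = mst_length v N.
Proof.
move=> n0 vN; have [T0 tT0 _] := exists_tree (in_setT (Ordinal n0)).
case: (arg_minnP (P := tree setT) (fun T : {set edge n} => \sum_(e in T) v e)%N tT0) => T tT minT.
exists T => //; rewrite (length_layers _ vN); apply: eq_bigr => j _.
by rewrite tree_above // minimal_tree_conn.
Qed.

(** A tree is a choice of [n.-1] among at most [n ^ 2] edges. This is cruder than Cayley's formula,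
    but only the order n ln n of the logarithm matters. *)
Lemma card_trees : (0 < n)%N ->
  (#|[set T : {set edge n} | tree setT T]| <= n ^ (2 * n))%N.
Proof.
move=> n0.
have cE : (#|{: edge n}| <= n ^ 2)%N.
  rewrite card_sig; apply: leq_trans (_ : #|[set A : {set 'I_n} | #|A| == 2%N]| <= _)%N.
    by apply: eq_leq; apply: eq_card => A; rewrite !inE.
  rewrite card_draws card_ord bin2 mulnC -divn2.
  by apply: leq_trans (leq_div _ _) _; rewrite expnS expn1 leq_mul // leq_pred.
apply: leq_trans (_ : #|[set T : {set edge n} | #|T| == n.-1]| <= _)%N.
  apply: subset_leq_card; apply/fintype.subsetP => T; rewrite !inE => tT.
  rewrite (tree_card _ tT) ?cardsT ?card_ord //.
  by apply/set0Pn; exists (Ordinal n0); rewrite inE.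
rewrite card_draws expnM.
have bin_exp m k : ('C(m, k) <= m ^ k)%N.
  elim: k m => [|k IH] m; first by rewrite bin0.
  case: m => [|m]; first by rewrite bin0n.
  have h := mul_bin_diag m.+1 k.
  rewrite -(@leq_pmul2l k.+1) // -h expnS mulnCA leq_mul2l /=.
  apply: leq_trans (IH m) _; apply: leq_trans (leq_pmull _ _) => //.
  by case: k {IH h} => // k; rewrite leq_exp2r.
apply: leq_trans (bin_exp _ _) _.
apply: leq_trans (_ : (n ^ 2) ^ n.-1 <= _)%N.
  by case: n.-1 => // k; rewrite leq_exp2r.
by rewrite leq_pexp2l ?leq_pred // expn_gt0 n0.
Qed.

End MinimalTree.

(** * Bounding the number of components by the small ones *)

Section ComponentCounts.
Variables (R : realFieldType) (n : nat) (F : {set edge n}).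

Lemma comps_partition : partition (comps F) setT.
Proof.
rewrite /comps; apply/and3P; split.
- apply/eqP/setP => x; rewrite !inE; apply/bigcupP; exists (comp F x).
    exact: imset_f.
  by rewrite inE conn0.
- apply/trivIsetP => _ _ /imsetP[x _ ->] /imsetP[y _ ->]; rewrite eq_comp => nxy.
  rewrite disjoint_subset; apply/fintype.subsetP => z; rewrite !inE => xz.
  by apply: contra nxy => yz; apply: conn_trans xz _; rewrite conn_sym.
- apply/negP => /imsetP[x _] /setP/(_ x); rewrite !inE conn0.
  by [].
Qed.

Lemma sum_comps (g : nat -> R) :
  \sum_(C in comps F) g #|C| = \sum_(1 <= k < n.+1) g k * (kappa_size F k)%:R.
Proof.
have sz C : C \in comps F -> (0 < #|C| <= n)%N.
  move=> /imsetP[x _ ->]; have := max_card (comp F x); rewrite card_ord => ->; rewrite andbT.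
  by apply/card_gt0P; exists x; rewrite inE conn0.
rewrite big_add1 big_mkord.
rewrite (partition_big (fun C : {set 'I_n} => inord #|C|.-1 : 'I_n.+1) xpredT) //=.
(* [inord] requires a successor type, so the index takes one value too many, which would stand for
   components of size [n.+1]. *)
rewrite big_ord_recr /= [X in _ + X]big1 ?addr0; last first.
  move=> C /andP[/sz/andP[C0 Cn]]; rewrite -val_eqE /= inordK; last first.
    by rewrite ltnS (leq_trans (leq_pred _)).
  by move=> /eqP E; have Q := prednK C0; move: Cn; rewrite -Q E ltnn.
apply: eq_bigr => i _; rewrite /kappa_size -sum1_card natr_sum mulr_sumr.
apply: eq_big => [C|C /andP[/sz/andP[C0 Cn]]].
  rewrite inE; apply: andb_id2l => /sz/andP[C0 Cn].
  rewrite -val_eqE /= inordK; last by rewrite ltnS (leq_trans (leq_pred _)).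
  by rewrite -eqSS prednK.
rewrite -val_eqE /= inordK; last by rewrite ltnS (leq_trans (leq_pred _)).
by move=> /eqP <-; rewrite prednK // mulr1.
Qed.

Lemma sum_comps_card : \sum_(1 <= k < n.+1) k%:R * (kappa_size F k)%:R = n%:R :> R.
Proof.
rewrite -(sum_comps (fun k => k%:R)) -natr_sum; congr (_%:R).
by rewrite -(card_partition comps_partition) cardsT card_ord.
Qed.

Lemma sum_comps_kappa : \sum_(1 <= k < n.+1) (kappa_size F k)%:R = (kappa F)%:R :> R.
Proof.
transitivity (\sum_(1 <= k < n.+1) 1 * (kappa_size F k)%:R : R).
  by apply: eq_bigr => k _; rewrite mul1r.
by rewrite -(sum_comps (fun=> 1)) sumr_const.
Qed.

Lemma kappa_gt0 : (0 < n)%N -> (0 < kappa F)%N.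
Proof.
by move=> n0; apply/card_gt0P; exists (comp F (Ordinal n0)); apply: imset_f.
Qed.

(** The subtracted 1 is distributed over the vertices, k / n for a component of size [k]. All
    summands are then nonnegative, so truncating the sum gives a lower bound. *)
Lemma kappa_pred : (0 < n)%N ->
  (kappa F).-1%:R = \sum_(1 <= k < n.+1) (1 - k%:R / n%:R) * (kappa_size F k)%:R :> R.
Proof.
move=> n0; have nn0 : n%:R != 0 :> R by rewrite pnatr_eq0 -lt0n.
under eq_bigr do rewrite mulrBl mul1r mulrAC.
rewrite sumrB sum_comps_kappa -mulr_suml sum_comps_card divff //.
by rewrite -subn1 natrB // kappa_gt0.
Qed.

Lemma kappa_pred_ge K : (0 < n)%N -> (K <= n)%N ->
  \sum_(1 <= k < K.+1) (1 - k%:R / n%:R) * (kappa_size F k)%:R <= (kappa F).-1%:R :> R.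
Proof.
move=> n0 Kn; rewrite kappa_pred // [leRHS](big_cat_nat (n := K.+1)) //=.
rewrite lerDl big_nat_cond; apply: sumr_ge0 => k /andP[/andP[_ kn] _].
by apply: mulr_ge0 => //; rewrite subr_ge0 ler_pdivrMr ?ltr0n // mul1r ler_nat.
Qed.

(** Components with more than [K] vertices are disjoint, so there are at most n / K of them. *)
Lemma kappa_pred_le K : (0 < n)%N -> (0 < K <= n)%N ->
  (kappa F).-1%:R <= \sum_(1 <= k < K.+1) (kappa_size F k)%:R + n%:R / K%:R :> R.
Proof.
move=> n0 /andP[K0 Kn]; apply: le_trans (_ : (kappa F)%:R <= _).
  by rewrite ler_nat leq_pred.
rewrite -sum_comps_kappa [leLHS](big_cat_nat (n := K.+1)) //= lerD2l.
rewrite ler_pdivlMr ?ltr0n // -sum_comps_card.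
rewrite [leRHS](big_cat_nat (n := K.+1)) //= -[leLHS]add0r.
apply: lerD; first by apply: sumr_ge0 => k _; rewrite mulr_ge0.
rewrite mulr_suml; apply: ler_sum_nat => k /andP[Kk _]; rewrite mulrC ler_wpM2r //.
by rewrite ler_nat ltnW.
Qed.

(** At most one component contains more than half of the vertices, and the predecessor accounts for
    it. *)
Lemma kappa_pred_le_half : (0 < n)%N ->
  (kappa F).-1%:R <= \sum_(1 <= k < (n./2).+1) (kappa_size F k)%:R :> R.
Proof.
move=> n0; have hn : (n./2.+1 <= n.+1)%N
  by rewrite ltnS -{2}(odd_double_half n) -addnn addnA leq_addl.
have big_lt2 : (\sum_((n./2).+1 <= k < n.+1) kappa_size F k < 2)%N.
  have h : (\sum_(1 <= k < n.+1) k * kappa_size F k = n)%N.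
    apply/eqP; rewrite -(eqr_nat R) -[X in _ == X]sum_comps_card natr_sum.
    by apply/eqP/eq_bigr => k _; rewrite natrM.
  have : ((n./2).+1 * \sum_((n./2).+1 <= k < n.+1) kappa_size F k <= n)%N.
    apply: leq_trans (eq_leq h); rewrite [X in (_ <= X)%N](big_cat_nat (n := (n./2).+1)) //=.
    apply: leq_trans (leq_addl _ _).
    rewrite big_distrr /= big_nat [X in (_ <= X)%N]big_nat; apply: leq_sum => k /andP[hk _].
    by rewrite leq_mul2r hk orbT.
  by have := odd_double_half n; rewrite -muln2; case: (odd n) => /=; nia.
rewrite -natr_sum ler_nat -subn1 leq_subLR.
have -> : kappa F = (\sum_(1 <= k < n.+1) kappa_size F k)%N.
  by apply/eqP; rewrite -(eqr_nat R) -sum_comps_kappa natr_sum.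
rewrite (big_cat_nat (n := (n./2).+1)) //= addnC leq_add2r.
by rewrite -ltnS.
Qed.

End ComponentCounts.

(** * Vertex permutations acting on edges and trees *)

Section Symmetry.
Variable n : nat.
Implicit Types (F T : {set edge n}) (e f : edge n) (x y z : 'I_n)
  (S : {set 'I_n}) (s : {perm 'I_n}).

Lemma edge_act_subproof s e : #|s @: val e| == 2%N.
Proof. by rewrite card_imset ?(valP e) //; apply: perm_inj. Qed.

Definition edge_act s e : edge n := Sub (s @: val e) (edge_act_subproof s e).

Lemma val_edge_act s e : val (edge_act s e) = s @: val e.
Proof. by rewrite SubK. Qed.

Lemma edge_act_inj s : injective (edge_act s).
Proof.
move=> e f /(congr1 val); rewrite !val_edge_act => /imset_inj E.
by apply/val_inj/E/perm_inj.
Qed.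

Lemma conn_act s F x y : conn F x y -> conn (edge_act s @: F) (s x) (s y).
Proof.
move=> xy; apply: (conn_closed (Q := fun z => conn (edge_act s @: F) (s x) (s z)) _ xy).
  move=> a b /adjP[e eF E] h; apply: conn_trans h _.
  apply: (edge_conn (e := edge_act s e)); first exact: imset_f.
  by rewrite val_edge_act E imsetU1 imset_set1.
exact: conn0.
Qed.

Lemma edge_actK s : cancel (edge_act s) (edge_act s^-1).
Proof.
move=> e; apply: val_inj; rewrite !val_edge_act -imset_comp.
by rewrite (eq_imset _ (g := id)) ?imset_id // => x /=; rewrite permK.
Qed.

Lemma edge_act_imsetK s F : edge_act s^-1 @: (edge_act s @: F) = F.
Proof.
by rewrite -imset_comp (eq_imset _ (g := id)) ?imset_id // => e /=; rewrite edge_actK.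
Qed.

Lemma conn_actE s F x y : conn (edge_act s @: F) (s x) (s y) = conn F x y.
Proof.
apply/idP/idP; last exact: conn_act.
by move/(conn_act s^-1); rewrite edge_act_imsetK !permK.
Qed.

Lemma tree_act s S F : s @: S = S -> tree S F -> tree S (edge_act s @: F).
Proof.
move=> sS /treeP[h1 h2 /forestP h3]; apply/treeP; split.
- move=> _ /imsetP[e eF ->]; rewrite val_edge_act -sS; exact/imsetS/h1.
- move=> x y; rewrite -{1 2}sS => /imsetP[x' x'S ->] /imsetP[y' y'S ->].
  by rewrite conn_actE; apply: h2.
apply/forestP => _ x y /imsetP[e eF ->] E.
have -> : (edge_act s @: F) :\ edge_act s e = edge_act s @: (F :\ e).
  apply/setP => f; apply/setD1P/imsetP => [[fe /imsetP[g gF Ef]]|[g]].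
    exists g => //; rewrite !inE gF andbT; apply: contraNneq fe => <-.
    by rewrite Ef.
  rewrite !inE => /andP[ge gF] ->; split; last exact: imset_f.
  by rewrite (inj_eq (@edge_act_inj s)).
rewrite -[x](permKV s) -[y](permKV s) conn_actE; apply: h3 => //.
have : s^-1%g @: val (edge_act s e) = s^-1%g @: [set x; y] by rewrite E.
rewrite val_edge_act -imset_comp imsetU1 imset_set1.
by rewrite (eq_imset _ (g := id)) ?imset_id // => z /=; rewrite permK.
Qed.

Lemma tree_actE s S F : s @: S = S -> tree S (edge_act s @: F) = tree S F.
Proof.
move=> sS; apply/idP/idP; last exact: tree_act.
have sVS : s^-1%g @: S = S.
  rewrite -{1}sS -imset_comp (eq_imset _ (g := id)) ?imset_id // => z /=.
  by rewrite permK.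
by move/(tree_act sVS); rewrite edge_act_imsetK.
Qed.

Lemma tperm_imset S x y : x \in S -> y \in S -> tperm x y @: S = S.
Proof.
move=> xS yS; apply/eqP; rewrite eqEcard card_imset ?leqnn ?andbT; last exact: perm_inj.
by apply/fintype.subsetP => _ /imsetP[z zS ->]; case: tpermP => // ->.
Qed.

Lemma edge_transitive S e f : val e \subset S -> val f \subset S ->
  exists2 s : {perm 'I_n}, s @: S = S & edge_act s e = f.
Proof.
have [x [y E]] := edge_ends e; have [x' [y' E']] := edge_ends f.
rewrite {1}E {1}E' !subUset !sub1set => /andP[xS yS] /andP[x'S y'S].
pose z := tperm x x' y.
have zS : z \in S by rewrite -(tperm_imset xS x'S) imset_f.
exists (tperm x x' * tperm z y')%g.
  rewrite (eq_imset _ (g := tperm z y' \o tperm x x')); last by move=> t; rewrite permM.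
  by rewrite imset_comp !tperm_imset.
apply: val_inj; rewrite val_edge_act E E' imsetU1 imset_set1 !permM tpermL.
rewrite -/z tpermL tpermD //; last by rewrite eq_sym (edge_neq E').
rewrite /z -(inj_eq (@perm_inj _ (tperm x x'))) tpermK tpermR eq_sym.
exact: edge_neq E.
Qed.

End Symmetry.

(** * The probability that a weighted tree contains an edge *)

Section EdgeProbability.
Variables (R : realFieldType) (n : nat) (T : finType) (t0 : T) (w : T -> R).
Hypothesis w_gt0 : forall t, 0 < w t.
Hypothesis w_le1 : forall t, w t <= 1.
Implicit Types (v : {ffun edge n -> T}) (F : {set edge n}) (e f : edge n)
  (x y z a b c : 'I_n) (S : {set 'I_n}).

Local Notation wt v := (fun f => w (v f)).

Definition tree_weight v F := \prod_(f in F) w (v f).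
Definition total_weight S v := \sum_(F : {set edge n} | tree S F) tree_weight v F.
Definition edge_prob S e v :=
  (\sum_(F : {set edge n} | tree S F && (e \in F)) tree_weight v F) / total_weight S v.
(** What [edge_prob] would be if the weight of [e] itself were 1. *)
Definition share S e v :=
  tree_with (wt v) S e / (tree_with (wt v) S e + tree_without (wt v) S e).

Let wv_ge0 v f : 0 <= w (v f). Proof. exact/ltW. Qed.

Lemma tree_weight_gt0 v F : 0 < tree_weight v F.
Proof. by apply: prodr_gt0. Qed.

Lemma tree_with_gt0 S e v : val e \subset S -> 0 < tree_with (wt v) S e.
Proof.
move=> eS; have [x [y E]] := edge_ends e.
have xS : x \in S by apply: (fintype.subsetP eS); rewrite E set21.
have [F tF /(_ e)] := exists_tree xS; rewrite E set21 -E eS => /(_ isT isT) eF.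
rewrite /tree_with (bigD1 (F :\ e)) /=; last by rewrite setD1K // !inE eqxx.
apply: ltr_wpDr; first by apply: sumr_ge0 => G _; apply: ltW; apply: tree_weight_gt0.
exact: tree_weight_gt0.
Qed.

Lemma edge_weightE S e v :
  \sum_(F : {set edge n} | tree S F && (e \in F)) tree_weight v F =
  w (v e) * tree_with (wt v) S e.
Proof.
rewrite /tree_with mulr_sumr.
rewrite [LHS](reindex_onto (fun F => e |: F) (fun F => F :\ e)) /=; last first.
  by move=> F /andP[_ eF]; rewrite setD1K.
apply: eq_big => [F|F /andP[/andP[_ _] /eqP E]].
  rewrite setU11 andbT andbC; congr (_ && _).
  apply/eqP/idP => [<-|eF]; first by rewrite !inE eqxx.
  exact: setU1K.
have eF : e \notin F by rewrite -E !inE eqxx.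
by rewrite /tree_weight big_setU1.
Qed.

Lemma total_weightE S e v :
  total_weight S v = w (v e) * tree_with (wt v) S e + tree_without (wt v) S e.
Proof.
rewrite -edge_weightE /total_weight (bigID (fun F : {set edge n} => e \in F)) /=.
by congr (_ + _); apply: eq_bigl => F; rewrite andbC.
Qed.

Lemma edge_probE S e v :
  edge_prob S e v = w (v e) * tree_with (wt v) S e /
    (w (v e) * tree_with (wt v) S e + tree_without (wt v) S e).
Proof. by rewrite /edge_prob edge_weightE (total_weightE S e). Qed.

Lemma total_weight_gt0 S v : S != set0 -> 0 < total_weight S v.
Proof.
move=> /set0Pn[x xS]; have [F tF _] := exists_tree xS.
rewrite /total_weight (bigD1 F) //=; apply: ltr_wpDr; last exact: tree_weight_gt0.
by apply: sumr_ge0 => G _; apply: ltW; apply: tree_weight_gt0.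
Qed.

Lemma sum_edge_prob S v : S != set0 ->
  \sum_(e : edge n | val e \subset S) edge_prob S e v = #|S|.-1%:R.
Proof.
move=> S0; rewrite /edge_prob -mulr_suml.
rewrite (exchange_big_dep (fun F => tree S F)) /=; last by move=> e F _ /andP[].
apply: (mulIf (lt0r_neq0 (total_weight_gt0 v S0))).
rewrite mulfVK; last by rewrite gt_eqF ?total_weight_gt0.
rewrite /total_weight mulr_sumr; apply: eq_bigr => F tF.
rewrite sumr_const mulr_natl; congr (_ *+ _); rewrite -(tree_card S0 tF).
apply: eq_card => e; rewrite unfold_in tF /=.
have [h _ _] := treeP _ _ tF.
by apply/andP/idP => [[]//|eF]; split => //; apply: h.
Qed.

Lemma share_ge0 S e v : 0 <= share S e v.
Proof.
by rewrite /share divr_ge0 ?addr_ge0 ?tree_with_ge0 ?tree_without_ge0.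
Qed.

Lemma edge_prob_le1 S e v : edge_prob S e v <= 1.
Proof.
rewrite edge_probE; set a := w (v e) * _; set b := tree_without _ _ _.
have a0 : 0 <= a by rewrite mulr_ge0 ?tree_with_ge0.
have b0 : 0 <= b by rewrite tree_without_ge0.
have := addr_ge0 a0 b0; rewrite le_eqVlt => /predU1P[<-|ab].
  by rewrite invr0 mulr0.
by rewrite ler_pdivrMr // mul1r lerDl.
Qed.

Lemma edge_prob_ge S e v : val e \subset S -> w (v e) * share S e v <= edge_prob S e v.
Proof.
move=> eS; rewrite edge_probE /share mulrA.
have A0 := tree_with_gt0 v eS; have B0 := tree_without_ge0 (@wv_ge0 v) S e.
move: A0 B0; move: (tree_with _ _ _) (tree_without _ _ _) => A B A0 B0.
have w0 := w_gt0 (v e); have w1 := w_le1 (v e); move: (w (v e)) w0 w1 => W W0 W1.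
apply: ler_wpM2l; first by rewrite mulr_ge0 // ltW.
rewrite lef_pV2 ?posrE ?ltr_wpDr ?mulr_gt0 // lerD2r ler_piMl // ltW //.
Qed.

Lemma edge_prob_le S e v eps : eps < 1 -> share S e v <= eps -> val e \subset S ->
  edge_prob S e v <= w (v e) * share S e v / (1 - eps).
Proof.
move=> eps1 + eS; rewrite edge_probE /share.
have A0 := tree_with_gt0 v eS; have B0 := tree_without_ge0 (@wv_ge0 v) S e.
move: A0 B0; move: (tree_with _ _ _) (tree_without _ _ _) => A B A0 B0.
have w0 := w_gt0 (v e); have w1 := w_le1 (v e); move: (w (v e)) w0 w1 => W W0 W1.
have AB : 0 < A + B by rewrite ltr_wpDr.
rewrite ler_pdivrMr // => h.
have B1 : (1 - eps) * (A + B) <= B by lra.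
have e0 : 0 < 1 - eps by rewrite subr_gt0.
rewrite -!mulrA; apply: ler_wpM2l; first exact: ltW.
apply: ler_wpM2l; first exact: ltW.
rewrite -invfM lef_pV2 ?posrE ?ltr_wpDr ?mulr_gt0 //.
rewrite mulrC; apply: (le_trans B1); rewrite lerDr mulr_ge0 //; exact: ltW.
Qed.

(** [rayleigh] compares the ratios of the two weights, and the share increases with this ratio. *)
Lemma share_mono S S' e v : S \subset S' -> val e \subset S ->
  share S' e v <= share S e v.
Proof.
move=> SS' eS; have eS' := fintype.subset_trans eS SS'.
have A0 := tree_with_gt0 v eS; have A0' := tree_with_gt0 v eS'.
have B0 := tree_without_ge0 (@wv_ge0 v) S e; have B0' := tree_without_ge0 (@wv_ge0 v) S' e.
have := rayleigh (@wv_ge0 v) SS' eS A0 A0'; rewrite /share.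
move: A0 A0' B0 B0'.
move: (tree_with _ S e) (tree_without _ S e) (tree_with _ S' e) (tree_without _ S' e).
move=> A B A' B' A0 A0' B0 B0' h.
rewrite ler_pdivrMr ?ltr_wpDr // mulrAC ler_pdivlMr ?ltr_wpDr //; lra.
Qed.

Lemma share_depends S e : depends_on (inner S :\ e) (share S e).
Proof.
move=> v v' vv'.
have hw F : e \notin F -> (forall f, f \in F -> val f \subset S) ->
    \prod_(f in F) w (v f) = \prod_(f in F) w (v' f).
  move=> eF h; apply: eq_bigr => f fF; rewrite vv' // !inE (h f fF) andbT.
  by apply: contraNneq eF => <-.
rewrite /share; suff [-> ->] : tree_with (wt v) S e = tree_with (wt v') S e /\
    tree_without (wt v) S e = tree_without (wt v') S e by [].
split; apply: eq_bigr => F /andP[eF tF]; apply: hw => // f fF;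
  have [h _ _] := treeP _ _ tF; apply: h => //.
exact: setU1r.
Qed.

Lemma edge_prob_act (s : {perm 'I_n}) S e v : s @: S = S ->
  edge_prob S (edge_act s e) v = edge_prob S e [ffun f => v (edge_act s f)].
Proof.
move=> sS; have injs : injective (fun F : {set edge n} => edge_act s @: F).
  exact/imset_inj/edge_act_inj.
have E F : tree_weight v (edge_act s @: F) = tree_weight [ffun f => v (edge_act s f)] F.
  rewrite /tree_weight big_imset /=; last by move=> ? ? _ _; apply: edge_act_inj.
  by apply: eq_bigr => f _; rewrite ffunE.
rewrite /edge_prob /total_weight (reindex_inj injs) [X in _ / X](reindex_inj injs) /=.
congr (_ / _); apply: eq_big => F; rewrite ?tree_actE // ?E //.
by rewrite mem_imset //; apply: edge_act_inj.
Qed.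

(** Permutations of [S] make all its edges equivalent, and every tree uses [#|S|.-1] of the
    ['C(#|S|, 2)] edges. *)
Lemma avg_edge_prob S e : val e \subset S -> avg (edge_prob S e) = 2 / #|S|%:R.
Proof.
move=> eS; have [x [y Exy]] := edge_ends e.
have xS : x \in S by apply: (fintype.subsetP eS); rewrite Exy set21.
have S0 : S != set0 by apply/set0Pn; exists x.
have same f : val f \subset S -> avg (edge_prob S f) = avg (edge_prob S e).
  move=> fS; have [s sS <-] := edge_transitive eS fS.
  rewrite -[RHS](avg_reindex (s := edge_act s)); last exact: edge_act_inj.
  by apply: eq_avg => v; rewrite edge_prob_act.
have : avg (fun v => \sum_(f : edge n | val f \subset S) edge_prob S f v) = #|S|.-1%:R.
  by rewrite -[RHS](avg_cst (edge n) t0); apply: eq_avg => v; rewrite sum_edge_prob.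
rewrite avg_sum (eq_bigr (fun=> avg (edge_prob S e)) same) sumr_const.
have -> : #|[pred f : edge n | val f \subset S]| = 'C(#|S|, 2).
  rewrite -cards_draws -(card_imset _ val_inj) /=; apply: eq_card => A.
  rewrite !inE; apply/imsetP/andP => [[f fS ->]|[AS A2]].
    by rewrite inE in fS; rewrite fS (valP f).
  by exists (Sub A A2); rewrite ?inE SubK.
have Spos : (1 < #|S|)%N.
  by rewrite -(eqP (valP e)) subset_leq_card.
rewrite -[avg _ *+ _]mulr_natl => h.
have S1 : #|S|.-1%:R != 0 :> R by rewrite pnatr_eq0; case: #|S| Spos => [|[]].
have S2 : #|S|%:R != 0 :> R by rewrite pnatr_eq0; case: #|S| Spos.
have h2 : 2 * 'C(#|S|, 2)%:R = #|S|%:R * #|S|.-1%:R :> R.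
  by rewrite -!natrM -mul_bin_diag bin1.
apply: (mulfI S1); apply: (mulfI S2); rewrite mulrA -h2 -mulrA h.
by field.
Qed.

End EdgeProbability.

(** * Concentration of the share and the mean length *)

Section Concentration.
Variables (R : realFieldType) (n : nat) (T : finType) (t0 : T) (w : T -> R).
Hypothesis w_gt0 : forall t, 0 < w t.
Hypothesis w_le1 : forall t, w t <= 1.
Implicit Types (v : {ffun edge n -> T}) (e f : edge n) (x y z : 'I_n)
  (S : {set 'I_n}).

Lemma avg_coord e (phi : T -> R) : avg (fun v : {ffun edge n -> T} => phi (v e)) = mean phi.
Proof.
have := avg_prod t0 [set e] (fun=> phi); rewrite big_set1 => <-.
by apply: eq_avg => v; rewrite big_set1.
Qed.

Lemma avg_coord_share S e (phi : T -> R) :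
  avg (fun v => phi (v e) * share w S e v) = mean phi * avg (share w S e).
Proof.
rewrite (@avg_indep _ _ _ t0 [set e] (inner S :\ e) (fun v => phi (v e))).
- by rewrite avg_coord.
- by rewrite disjoints1 !inE eqxx.
- by move=> v v' h; rewrite h // set11.
- exact: share_depends.
Qed.

Lemma mean_gt0 : 0 < mean w.
Proof.
rewrite /mean mulr_gt0 // ?invr_gt0 ?ltr0n; last by apply/card_gt0P; exists t0.
by rewrite (bigD1 t0) //=; apply: ltr_wpDr => //; apply: sumr_ge0 => t _; apply: ltW.
Qed.

Lemma avg_share_le S e : val e \subset S -> mean w * avg (share w S e) <= 2 / #|S|%:R.
Proof.
move=> eS; rewrite -avg_coord_share -(avg_edge_prob t0 w_gt0 eS).
by apply: le_avg => v; apply: edge_prob_ge.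
Qed.

(** Markov's inequality for the share. *)
Lemma prob_share_gt S e (eps : R) : 0 < eps -> val e \subset S ->
  avg (fun v => (eps < share w S e v)%R%:R) <= 2 / (#|S|%:R * mean w * eps).
Proof.
move=> e0 eS; apply: le_trans (_ : avg (fun v => eps^-1 * share w S e v) <= _).
  apply: le_avg => v; case: ltP => /= h; last first.
    by rewrite mulr_ge0 ?invr_ge0 ?share_ge0 // ltW.
  by rewrite mulrC ler_pdivlMr // mul1r ltW.
have mu0 := mean_gt0; have h := avg_share_le eS.
have S0 : 0 < #|S|%:R :> R.
  by rewrite ltr0n (leq_trans _ (subset_leq_card eS)) // (eqP (valP e)).
rewrite avgZ mulrC ler_pdivrMr //.
have -> : 2 / (#|S|%:R * mean w * eps) * eps = 2 / #|S|%:R / mean w.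
  by field; rewrite !gt_eqF.
by rewrite ler_pdivlMr // mulrC.
Qed.

(** The n - 2 other vertices are listed and cut into consecutive blocks of length [m]; each block
    with the ends of [e] is one group. *)
Lemma disjoint_groups e k m : (k * m + 2 <= n)%N -> exists G : 'I_k -> {set 'I_n},
  [/\ forall i, val e \subset G i, forall i j, i != j -> G i :&: G j \subset val e &
      forall i, (m <= #|G i|)%N].
Proof.
move=> kmn; have [x [y E]] := edge_ends e.
pose s := enum (~: val e); have us : uniq s by apply: enum_uniq.
have ss : size s = (n - 2)%N.
  by rewrite -cardE [#|~: _|]cardsCs setCK card_ord (eqP (valP e)).
pose B (i : 'I_k) := [set z | (z \in s) && (index z s %/ m == i)%N].
exists (fun i => val e :|: B i); split.
- by move=> i; apply: subsetUl.
- move=> i j ij; rewrite -setUIr subUset subxx /=.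
  apply/fintype.subsetP => z; rewrite !inE => /andP[/andP[_ /eqP h1] /andP[_ /eqP h2]].
  by case/eqP: ij; apply: val_inj; rewrite /= -h1 -h2.
move=> i; apply: leq_trans (subset_leq_card (subsetUr _ _)).
case: m kmn @B => [//|m] kmn B.
have lt j : (j < m.+1)%N -> (i * m.+1 + j < size s)%N.
  rewrite ss => jm; have := ltn_ord i; move: kmn jm; clear; nia.
pose h (j : 'I_m.+1) := nth x s (i * m.+1 + j).
rewrite -[m.+1]card_ord -(card_imset (f := h)); last first.
  move=> j j' /eqP; rewrite /h nth_uniq ?lt // eqn_add2l => /eqP; exact: val_inj.
apply: subset_leq_card; apply/fintype.subsetP => _ /imsetP[j _ ->].
rewrite inE mem_nth ?lt //= index_uniq ?lt //.
by rewrite divnMDl // divn_small // addn0.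
Qed.

(* K_n contains k subgraphs through e that otherwise share no vertex. By
   monotonicity a large share of e in K_n forces a large share in all of
   them, and these k events are independent. *)
Lemma prob_share_small e k m (eps : R) : 0 < eps -> (0 < m)%N -> (k * m + 2 <= n)%N ->
  avg (fun v => (eps < share w setT e v)%R%:R) <= (2 / (m%:R * mean w * eps)) ^+ k.
Proof.
move=> e0 m0 kmn; have [G [eG GG cG]] := disjoint_groups e kmn.
apply: le_trans (_ : avg (fun v => \prod_i (eps < share w (G i) e v)%R%:R) <= _).
  apply: le_avg => v; case: ltP => /= h; last by apply: prodr_ge0.
  rewrite big1 // => i _; have /= := share_mono w_gt0 v (subsetT (G i)) (eG i).
  by move=> /(lt_le_trans h) ->.
rewrite (@avg_indep_prod _ _ _ t0 _ (fun i => inner (G i) :\ e)).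
- rewrite -[X in _ ^+ X]card_ord -prodr_const; apply: ler_prod => i _; apply/andP; split.
    by apply: avg_ge0.
  apply: (le_trans (prob_share_gt e0 (eG i))).
  have m0' : 0 < m%:R :> R by rewrite ltr0n.
  have G0 : 0 < #|G i|%:R :> R by rewrite ltr0n (leq_trans m0).
  have mu0 := mean_gt0; move: (mean w) mu0 => mu mu0.
  apply: ler_wpM2l => //; rewrite lef_pV2 ?posrE ?mulr_gt0 //.
  apply: ler_wpM2r; first exact: ltW.
  by apply: ler_wpM2r; [exact: ltW|rewrite ler_nat].
(* Two groups share only the ends of [e], so [e] is the only edge in both, and the share does not
   depend on its label. *)
- move=> i j ij; rewrite disjoint_subset; apply/fintype.subsetP => f.
  rewrite !inE => /andP[fe fi]; rewrite fe /=; apply: contra fe => fj.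
  have : val f \subset val e by apply: fintype.subset_trans (GG i j ij); rewrite subsetI fi.
  move=> fe; rewrite -val_eqE eqEcard fe /=.
  by rewrite (eqP (valP f)) (eqP (valP e)).
- move=> i v v' h; congr (_%:R); congr (nat_of_bool (_ < _)).
  exact: share_depends.
Qed.

Lemma card_edges : 2 * #|{: edge n}|%:R = n%:R * n.-1%:R :> R.
Proof.
have -> : #|{: edge n}| = 'C(n, 2).
  rewrite card_sig -[n in RHS]card_ord -card_draws.
  by apply: eq_card => A; rewrite !inE.
by rewrite -!natrM -mul_bin_diag bin1.
Qed.

(** If rho is the mean share of an edge, phi of its label times its probability has mean close to
    rho times the mean of phi w. For phi = 1 this mean is exactly 2 / n, which pins down rho; phi =
    u then yields the ratio nu / mu. Summing over n (n - 1) / 2 edges turns 2 / n into n - 1. *)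
Lemma expected_length_bounds (u : T -> R) (eps delta : R) :
  (forall t, 0 <= u t <= 1) -> (0 < n)%N -> 0 < eps < 1 -> 0 <= delta ->
  (forall e, avg (fun v => (eps < share w setT e v)%R%:R) <= delta) ->
  (1 - eps) * (mean (fun t => u t * w t) / mean w * n.-1%:R) - n%:R ^+ 2 * delta
    <= avg (fun v => \sum_e u (v e) * edge_prob w setT e v) <=
    mean (fun t => u t * w t) / mean w * n.-1%:R / (1 - eps) + n%:R ^+ 2 * delta.
Proof.
move=> u01 n0 /andP[e0 e1] d0 hd.
have mu0 := mean_gt0; set mu := mean w in mu0 *.
set nu := mean _; set a := nu / mu.
have nn0 : 0 < n%:R :> R by rewrite ltr0n.
have f0 : 0 < 1 - eps by rewrite subr_gt0.
have eT e : val e \subset setT by apply: subsetT.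
have upper e (phi : T -> R) : (forall t, 0 <= phi t <= 1) ->
    avg (fun v => phi (v e) * edge_prob w setT e v) <=
    mean (fun t => phi t * w t) * avg (share w setT e) / (1 - eps) + delta.
  move=> phi01; rewrite -(avg_coord_share setT e (fun t => phi t * w t)) mulrC -avgZ.
  apply: le_trans (lerD (lexx _) (hd e)); rewrite -avgD; apply: le_avg => v.
  have /andP[p0 p1] := phi01 (v e).
  have s0 := share_ge0 w_gt0 setT e v.
  (* On the exceptional event the indicator, of mean at most [delta], dominates the trivial bound
     1. *)
  case: ltP => /= h.
    apply: (le_trans (_ : _ <= 0 + 1)); last first.
      rewrite lerD2r; apply: mulr_ge0; first by rewrite invr_ge0 ltW.
      by apply: mulr_ge0 => //; apply: mulr_ge0 => //; apply: ltW.
    rewrite add0r; apply: mulr_ile1 => //; last exact: edge_prob_le1.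
    apply: le_trans (edge_prob_ge w_gt0 w_le1 v (eT e)).
    by rewrite mulr_ge0 // ltW.
  rewrite addr0; have := edge_prob_le w_gt0 w_le1 e1 h (eT e).
  move=> /(ler_wpM2l p0)/le_trans; apply.
  by rewrite le_eqVlt; apply/orP; left; apply/eqP; ring.
have lower e (phi : T -> R) : (forall t, 0 <= phi t <= 1) ->
    mean (fun t => phi t * w t) * avg (share w setT e) <=
    avg (fun v => phi (v e) * edge_prob w setT e v).
  move=> phi01; rewrite -(avg_coord_share setT e (fun t => phi t * w t)); apply: le_avg => v.
  have /andP[p0 p1] := phi01 (v e).
  by rewrite -mulrA; apply: ler_wpM2l => //; apply: edge_prob_ge.
have ep e : avg (fun v => 1 * edge_prob w setT e v) = 2 / n%:R.
  transitivity (avg (edge_prob w setT e)); first by apply: eq_avg => v; rewrite mul1r.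
  by rewrite avg_edge_prob // cardsT card_ord.
have mean1 : mean (fun t => 1 * w t) = mu.
  by rewrite /mu /mean; congr (_ / _); apply: eq_bigr => t _; rewrite mul1r.
have nu0 : 0 <= nu.
  rewrite /nu /mean mulr_ge0 ?invr_ge0 // sumr_ge0 // => t _.
  by have /andP[h _] := u01 t; rewrite mulr_ge0 // ltW.
have numu : nu <= mu.
  rewrite /nu /mu /mean ler_wpM2r ?invr_ge0 //; apply: ler_sum => t _.
  by have /andP[_ h] := u01 t; rewrite ler_piMl // ltW.
have one01 (t : T) : 0 <= (1 : R) <= 1 by rewrite ler01 lexx.
have edge_bounds e : (1 - eps) * (a * (2 / n%:R)) - delta <=
    avg (fun v => u (v e) * edge_prob w setT e v) <= a * (2 / n%:R) / (1 - eps) + delta.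
  have h1 := upper e (fun=> 1) one01; have h2 := lower e (fun=> 1) one01.
  have h3 := upper e u u01; have h4 := lower e u u01.
  rewrite /= ep mean1 in h1 h2; rewrite -/nu in h3 h4.
  set rho := avg (share w setT e) in h1 h2 h3 h4.
  set L := avg (fun v => u (v e) * _) in h3 h4 *.
  set c := 2 / n%:R in h1 h2 *; clearbody rho L c; clear upper lower ep.
  have f0' := ltW f0; have nm0 : 0 <= nu / mu by apply: divr_ge0 => //; apply: ltW.
  rewrite /a; apply/andP; split.
    apply: le_trans h4; rewrite lerBlDr.
    have : (1 - eps) * (nu / mu) * c <= (1 - eps) * (nu / mu) * (mu * rho / (1 - eps) + delta).
      by apply: ler_wpM2l h1; apply: mulr_ge0.
    rewrite mulrDr => h; rewrite mulrA; apply: (le_trans h); apply: lerD.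
      rewrite le_eqVlt; apply/orP; left; apply/eqP; field.
      by rewrite !gt_eqF.
    apply: ler_piMl => //; apply: mulr_ile1 => //; first by rewrite gerBl ltW.
    by rewrite ler_pdivrMr // mul1r.
  apply: (le_trans h3); rewrite lerD2r; apply: ler_wpM2r; first by rewrite invr_ge0.
  rewrite -mulrA; apply: ler_wpM2l => //.
  by rewrite mulrC ler_pdivlMr // mulrC.
have N2 : #|{: edge n}|%:R <= n%:R ^+ 2 :> R.
  have h : 2 * #|{: edge n}|%:R <= n%:R * n%:R :> R.
    by rewrite card_edges ler_wpM2l // ler_nat leq_pred.
  by rewrite expr2; apply: le_trans h; rewrite ler_peMl // ler1n.
have Ea c : \sum_(e : edge n) (c * (2 / n%:R)) = c * n.-1%:R :> R.
  rewrite sumr_const -[_ *+ _]mulr_natr -mulrA; congr (_ * _).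
  by rewrite mulrAC card_edges mulrAC divff ?mul1r // gt_eqF.
have Ed : \sum_(e : edge n) delta <= n%:R ^+ 2 * delta.
  by rewrite sumr_const -[_ *+ _]mulr_natl; apply: ler_wpM2r.
rewrite avg_sum; apply/andP; split.
  apply: le_trans (_ : \sum_(e : edge n) ((1 - eps) * (a * (2 / n%:R)) - delta) <= _).
    rewrite sumrB lerB //; under eq_bigr do rewrite mulrA.
    by rewrite Ea mulrA.
  by apply: ler_sum => e _; have /andP[] := edge_bounds e.
apply: le_trans (_ : \sum_(e : edge n) (a * (2 / n%:R) / (1 - eps) + delta) <= _).
  by apply: ler_sum => e _; have /andP[] := edge_bounds e.
rewrite big_split lerD //=; under eq_bigr do rewrite mulrAC.
by rewrite Ea mulrAC.
Qed.

End Concentration.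

(** * Gibbs mean against a reference tree *)

Section Gibbs.
Variables (R : realType) (n : nat) (beta : R) (u : edge n -> R).

Definition gibbs_mean : R :=
  \sum_(T : spanning_tree n) wst_weight beta u T * tree_length u T.

Let Z := \sum_(T : spanning_tree n) expR (- beta * tree_length u T).

Lemma gibbs_denom_gt0 : (0 < n)%N -> 0 < Z.
Proof.
move=> n0; have [F tF _] := exists_tree (in_setT (Ordinal n0)).
have sF : `[< is_spanning_tree F >] by rewrite spanning_treeE.
rewrite /Z (bigD1 (exist _ F sF)) //=; apply: ltr_wpDr; last exact: expR_gt0.
by apply: sumr_ge0 => T _; apply: expR_ge0.
Qed.

Lemma wst_weight_ge0 T : 0 <= wst_weight beta u T.
Proof.
by rewrite /wst_weight divr_ge0 ?expR_ge0 // sumr_ge0 // => ? _; apply: expR_ge0.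
Qed.

Lemma sum_wst_weight : (0 < n)%N -> \sum_(T : spanning_tree n) wst_weight beta u T = 1.
Proof.
move=> n0; rewrite /wst_weight -mulr_suml divff //.
by rewrite gt_eqF // gibbs_denom_gt0.
Qed.

Lemma gibbs_mean_ge c : (0 < n)%N -> (forall T, c <= tree_length u T) -> c <= gibbs_mean.
Proof.
move=> n0 h; rewrite -[leLHS]mul1r -(sum_wst_weight n0) mulr_suml.
by apply: ler_sum => T _; apply: ler_wpM2l; rewrite ?wst_weight_ge0.
Qed.

Lemma gibbs_mean_le_max c : (0 < n)%N -> (forall T, tree_length u T <= c) -> gibbs_mean <= c.
Proof.
move=> n0 h; rewrite -[leRHS]mul1r -(sum_wst_weight n0) mulr_suml.
by apply: ler_sum => T _; apply: ler_wpM2l; rewrite ?wst_weight_ge0.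
Qed.

(** Let a + y be [beta] times the excess length of a tree over [c]. Comparison with [T0] alone
    bounds its probability by exp (- a - y), so for y > 0 it contributes at most y exp (- a - y) <=
    exp (- a) to the mean of y; the hypothesis on [a] bounds the sum over all trees by 1. *)
Lemma gibbs_mean_le c a T0 : (0 < n)%N -> 0 < beta -> tree_length u T0 = c ->
  #|{: spanning_tree n}|%:R * expR (- a) <= 1 ->
  gibbs_mean <= c + (a + 1) / beta.
Proof.
move=> n0 b0 T0c card_a; rewrite -lerBlDl ler_pdivlMr // -lerBlDl.
have Z0 := gibbs_denom_gt0 n0.
have -> : (gibbs_mean - c) * beta - a =
    \sum_(T : spanning_tree n) wst_weight beta u T * (beta * (tree_length u T - c) - a).
  rewrite (eq_bigr (fun T => beta * (wst_weight beta u T * tree_length u T) -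
     (beta * c + a) * wst_weight beta u T)); last by move=> T _; ring.
  by rewrite sumrB -!mulr_sumr sum_wst_weight // /gibbs_mean; ring.
apply: le_trans (_ : \sum_(T : spanning_tree n) expR (- a) <= _); last first.
  by rewrite sumr_const -[_ *+ _]mulr_natl.
apply: ler_sum => T _; set y := beta * _ - a.
have wy : wst_weight beta u T <= expR (- (y + a)).
  rewrite /wst_weight ler_pdivrMr //.
  apply: le_trans (_ : expR (- (y + a)) * expR (- beta * tree_length u T0) <= _).
    rewrite -expRD T0c ler_expR /y; lra.
  apply: ler_wpM2l; first exact: expR_ge0.
  rewrite [leRHS](bigD1 T0) //= lerDl.
  by apply: sumr_ge0 => ? _; apply: expR_ge0.
case: (leP y 0) => [y0|y0].
  apply: le_trans (expR_ge0 _); rewrite mulr_ge0_le0 //; exact: wst_weight_ge0.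
apply: le_trans (ler_wpM2r (ltW y0) wy) _.
rewrite opprD expRD mulrAC ler_piMl ?expR_ge0 //.
rewrite expRN mulrC ler_pdivrMr ?expR_gt0 // mul1r.
by apply: le_trans (expR_ge1Dx y); rewrite lerDr.
Qed.

End Gibbs.

(** * Labels on a finite grid *)

Section Grid.
Variables (R : realType) (n : nat).
Hypothesis n_gt0 : (0 < n)%N.

Definition label m (t : 'I_m.+1) : R := t%:R / m.+1%:R.

Lemma label01 m (t : 'I_m.+1) : 0 <= label t <= 1.
Proof.
rewrite /label divr_ge0 //= ler_pdivrMr ?ltr0n // mul1r ler_nat.
exact/ltnW.
Qed.

Definition grid_length beta m : R :=
  avg (fun v : {ffun edge n -> 'I_m.+1} => gibbs_mean beta (fun e => label (v e))).

Definition grid_mst m : R :=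
  avg (fun v : {ffun edge n -> 'I_m.+1} =>
    (mst_length (fun e => v e) m.+1)%:R / m.+1%:R).

Lemma tree_length_label m (v : {ffun edge n -> 'I_m.+1}) (T : spanning_tree n) :
  tree_length (fun e => label (v e)) T = (\sum_(e in val T) v e)%N%:R / m.+1%:R.
Proof. by rewrite /tree_length /label -mulr_suml natr_sum. Qed.

Lemma grid_mst_le beta m : grid_mst m <= grid_length beta m.
Proof.
apply: le_avg => v; apply: gibbs_mean_ge => // T.
rewrite tree_length_label ler_wpM2r ?invr_ge0 // ler_nat.
by apply: mst_length_le; rewrite // -spanning_treeE (valP T).
Qed.

Lemma le_grid_mst beta m : 0 < beta ->
  grid_length beta m <= grid_mst m + (2 * n%:R * ln n%:R + 1) / beta.
Proof.
move=> b0; rewrite -[_ / beta](avg_cst (edge n) (ord0 : 'I_m.+1)) -avgD; apply: le_avg => v.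
have [T tT ET] := mst_length_eq n_gt0 (fun e => ltn_ord (v e)).
have sT : `[< is_spanning_tree T >] by rewrite spanning_treeE.
apply: (@gibbs_mean_le _ _ _ _ _ _ (exist _ T sT)) => //.
  by rewrite tree_length_label /= ET.
have nn0 : 0 < n%:R :> R by rewrite ltr0n.
have -> : expR (- (2 * n%:R * ln n%:R)) = (n%:R ^+ (2 * n))^-1 :> R.
  by rewrite expRN -natrM expRM_natl lnK.
rewrite ler_pdivrMr ?exprn_gt0 // mul1r -natrX ler_nat.
apply: leq_trans (card_trees n_gt0); rewrite card_sig.
by apply: eq_leq; apply: eq_card => F; rewrite !inE spanning_treeE.
Qed.

(** Riemann sum of the Beta integral of p^a (1 - p)^b over [0, 1]. *)
Definition beta_sum (a b m : nat) : R :=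
  (\sum_(1 <= j < m.+1) (j%:R / m.+1%:R) ^+ a * (1 - j%:R / m.+1%:R) ^+ b) / m.+1%:R.

Lemma open_prob_below m j : (j <= m.+1)%N ->
  open_prob R (fun t : 'I_m.+1 => (t < j)%N) = j%:R / m.+1%:R.
Proof.
move=> jm; rewrite /open_prob /mean card_ord; congr (_ / _).
rewrite -natr_sum; congr (_%:R).
rewrite -[RHS](subn0 j) -[RHS](muln1) -sum_nat_const_nat big_mkord.
rewrite [RHS](big_ord_widen _ (fun=> 1%N) jm) [RHS]big_mkcond /=.
by apply: eq_bigr => i _; case: (_ < _)%N.
Qed.

Lemma grid_mst_sum m : grid_mst m =
  (\sum_(1 <= j < m.+1) avg (fun v : {ffun edge n -> 'I_m.+1} =>
     (kappa (open_edges (fun t : 'I_m.+1 => (t < j)%N) v)).-1%:R)) / m.+1%:R.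
Proof.
rewrite -avg_sum mulrC -avgZ; apply: eq_avg => v.
by rewrite mulrC /mst_length natr_sum.
Qed.

Definition tree_comps (k b m : nat) : R :=
  'C(n, k)%:R * labelled_trees R k * beta_sum k.-1 b m.

Lemma grid_mst_ge m K : (K <= n)%N ->
  \sum_(1 <= k < K.+1) (1 - k%:R / n%:R) * tree_comps k (k * n) m <= grid_mst m.
Proof.
move=> Kn; rewrite grid_mst_sum ler_pdivlMr ?ltr0n // mulr_suml.
apply: le_trans (_ : \sum_(1 <= k < K.+1) \sum_(1 <= j < m.+1) (1 - k%:R / n%:R) *
   ('C(n, k)%:R * labelled_trees R k * ((j%:R / m.+1%:R) ^+ k.-1 *
     (1 - j%:R / m.+1%:R) ^+ (k * n))) <= _).
  rewrite le_eqVlt; apply/orP; left; apply/eqP; apply: eq_bigr => k _.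
  rewrite -!mulr_sumr /tree_comps /beta_sum -!mulrA; congr (_ * (_ * (_ * _))).
  by rewrite mulVf ?mulr1 // pnatr_eq0.
rewrite exchange_big /=; apply: ler_sum_nat => j /andP[_ jm].
apply: le_trans (_ : avg (fun v : {ffun edge n -> 'I_m.+1} => \sum_(1 <= k < K.+1)
  (1 - k%:R / n%:R) * (kappa_size (open_edges (fun t : 'I_m.+1 => (t < j)%N) v) k)%:R) <= _).
  rewrite avg_sum; apply: ler_sum_nat => k /andP[k0 kK]; rewrite avgZ.
  have kn : (k <= n)%N by rewrite (leq_trans _ Kn).
  apply: ler_wpM2l; first by rewrite subr_ge0 ler_pdivrMr ?ltr0n // mul1r ler_nat.
  have /(avg_kappa_size R (ord0 : 'I_m.+1) (fun t => (t < j)%N)) : (0 < k <= n)%N by rewrite k0.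
  rewrite open_prob_below ?(ltnW jm) // => /andP[h _]; rewrite mulrA.
  exact: h.
by apply: le_avg => v; apply: kappa_pred_ge.
Qed.

End Grid.

(** * Small components at high edge density *)

Section DensePhase.
Variable R : realType.

Lemma expR_le_half (y : R) : 1 <= y -> expR (- y) <= 2^-1.
Proof.
move=> y1; rewrite expRN lef_pV2 ?posrE ?expR_gt0 //.
by apply: le_trans (expR_ge1Dx y); rewrite -[2]/(1 + 1) lerD2l.
Qed.

Lemma onem_expr_le (p : R) k : 0 <= p <= 1 -> (1 - p) ^+ k <= expR (- (p * k%:R)).
Proof.
move=> /andP[p0 p1]; rewrite -mulNr expRM_natr lerXn2r ?nnegrE ?expR_ge0 ?subr_ge0 //.
exact: expR_ge1Dx.
Qed.

(** Rests on k^k / k! <= e^k, a single term of the exponential series. *)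
Lemma binomial_trees_le n k : (0 < k)%N ->
  'C(n, k)%:R * labelled_trees R k <= n%:R ^+ k * expR k%:R.
Proof.
case: k => // k _; rewrite /labelled_trees /=.
have f0 : (0 : R) < (k.+1)`!%:R by rewrite ltr0n fact_gt0.
have k0 : (0 : R) < k.+1%:R by rewrite ltr0n.
have h1 : 'C(n, k.+1)%:R * (k.+1)`!%:R <= n%:R ^+ k.+1 :> R.
  rewrite -natrM bin_ffact -natrX ler_nat.
  rewrite ffact_prod -[X in (_ <= _ ^ X)%N]card_ord -prod_nat_const.
  by apply: leq_prod => i _; apply: leq_subr.
have h2 : k.+1%:R ^+ k.+1 / (k.+1)`!%:R <= expR (k.+1%:R : R).
  by apply: le_trans (expR_ge1Dxn k (ltW k0)); rewrite lerDr.
have h3 : k.+1%:R ^+ k / k.+1%:R <= k.+1%:R ^+ k.+1 :> R.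
  rewrite exprSr ler_pdivrMr // -mulrA ler_peMr ?exprn_ge0 //.
  by rewrite -natrM ler1n.
apply: le_trans (_ : n%:R ^+ k.+1 / (k.+1)`!%:R * k.+1%:R ^+ k.+1 <= _).
  apply: ler_pM; [by []|by rewrite mulr_ge0 ?invr_ge0 ?exprn_ge0| |exact: h3].
  by rewrite ler_pdivlMr.
by rewrite mulrAC -mulrA ler_wpM2l ?exprn_ge0 // .
Qed.

(** With [lam = n p] and [k <= n / 2] the term is at most n e^(1 - lam/2) (lam e^(1 - lam/2))^(k -
    1). The threshold 64 is large enough, with room to spare, for the base of the power to be at
    most 1/2 and the factor before it at most n e^(- lam/4) / 2. *)
Lemma dense_term_le n k (p : R) : (0 < k <= n./2)%N -> 0 <= p <= 1 -> 64 <= n%:R * p ->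
  'C(n, k)%:R * labelled_trees R k * p ^+ k.-1 * (1 - p) ^+ (k * (n - k)) <=
  n%:R * expR (- (n%:R * p / 4)) * 2^-1 ^+ k.
Proof.
move=> /andP[k0 kn] p01 lam64; have /andP[p0 p1] := p01.
set lam := n%:R * p in lam64 *.
have n0 : 0 <= n%:R :> R by [].
have h2 : (1 - p) ^+ (k * (n - k)) <= expR (- (lam / 2)) ^+ k.
  apply: le_trans (onem_expr_le _ p01) _.
  rewrite -expRM_natr ler_expR mulNr lerN2 /lam.
  have kn2 : (k <= n)%N by move: kn; have := odd_double_half n; rewrite -addnn; lia.
  have : n%:R / 2 * k%:R <= (k * (n - k))%N%:R :> R.
    rewrite natrM natrB //; have hk : 2 * k%:R <= n%:R :> R.
      by rewrite -natrM ler_nat; move: kn; have := odd_double_half n; rewrite -addnn; lia.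
    have k00 : 0 <= k%:R :> R by [].
    have : 0 <= (n%:R - 2 * k%:R) * k%:R :> R by rewrite mulr_ge0 // subr_ge0.
    by clear; lra.
  move=> /(ler_wpM2l p0); rewrite natrM; clear; lra.
apply: le_trans (_ : n%:R ^+ k * expR k%:R * p ^+ k.-1 * expR (- (lam / 2)) ^+ k <= _).
  apply: ler_pM => //.
  - by rewrite !mulr_ge0 ?exprn_ge0 // /labelled_trees divr_ge0 ?exprn_ge0.
  - by rewrite exprn_ge0 // subr_ge0.
  - by apply: ler_wpM2r; [rewrite exprn_ge0|exact: binomial_trees_le].
have -> : expR k%:R = expR 1 ^+ k :> R by rewrite -expRM_natr mul1r.
have key : lam * expR 1 * expR (- (lam / 2)) <= 2^-1.
  (* [y] is chosen so that 1 - lam / 2 = - y - lam / 4: the first part absorbs [lam], the second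
     supplies the 1/2. *)
  set y := lam / 4 - 1; have y15 : 15 <= y by rewrite /y; lra.
  have ly : lam <= expR y.
    apply: le_trans (expR_ge1Dxn 1 _); last by lra.
    have : 0 <= (y - 15) * y by apply: mulr_ge0; lra.
    rewrite expr2 (_ : 2`!%:R = 2 :> R) // /y; lra.
  rewrite -mulrA -expRD.
  have -> : 1 - lam / 2 = - y - lam / 4 by rewrite /y; field.
  rewrite expRD mulrA -[leRHS]mul1r; apply: ler_pM; rewrite ?expR_ge0 //.
  - by rewrite mulr_ge0 ?expR_ge0 //; lra.
  - by rewrite expRN ler_pdivrMr ?expR_gt0 // mul1r.
  - by apply: expR_le_half; lra.
have key1 : expR 1 * expR (- (lam / 2)) <= expR (- (lam / 4)) / 2.
  rewrite -expRD; have -> : 1 - lam / 2 = - (lam / 4) - (lam / 4 - 1) by field.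
  rewrite expRD ler_wpM2l ?expR_ge0 // expR_le_half //; lra.
case: k k0 {kn h2} => // k _; rewrite /=.
have -> : n%:R ^+ k.+1 * expR 1 ^+ k.+1 * p ^+ k * expR (- (lam / 2)) ^+ k.+1 =
  n%:R * (expR 1 * expR (- (lam / 2))) * (lam * expR 1 * expR (- (lam / 2))) ^+ k.
  rewrite /lam !exprMn !exprS; ring.
have -> : n%:R * expR (- (lam / 4)) * 2^-1 ^+ k.+1 =
  n%:R * (expR (- (lam / 4)) / 2) * 2^-1 ^+ k by rewrite exprS; ring.
apply: ler_pM => //.
- by rewrite exprn_ge0 // !mulr_ge0 ?expR_ge0 //; lra.
- exact: ler_wpM2l.
- apply: lerXn2r; rewrite ?nnegrE ?invr_ge0 //.
  by rewrite !mulr_ge0 ?expR_ge0 //; lra.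
Qed.

Lemma sum_half_le K : \sum_(1 <= k < K) (2^-1 : R) ^+ k <= 1.
Proof.
case: K => [|K]; first by rewrite big_geq.
suff -> : \sum_(1 <= k < K.+1) (2^-1 : R) ^+ k = 1 - 2^-1 ^+ K.
  by rewrite gerBl exprn_ge0 // invr_ge0.
elim: K => [|K IH]; first by rewrite big_geq // expr0 subrr.
rewrite big_nat_recr //= IH exprS; lra.
Qed.

Lemma dense_sum_le n (p : R) : 0 <= p <= 1 -> 64 <= n%:R * p ->
  \sum_(1 <= k < (n./2).+1) 'C(n, k)%:R * labelled_trees R k * p ^+ k.-1 *
     (1 - p) ^+ (k * (n - k)) <= n%:R * expR (- (n%:R * p / 4)).
Proof.
move=> p01 lam64.
apply: le_trans (_ : \sum_(1 <= k < (n./2).+1)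
   n%:R * expR (- (n%:R * p / 4)) * 2^-1 ^+ k <= _).
  by apply: ler_sum_nat => k /andP[k0 kn]; apply: dense_term_le; rewrite ?k0.
rewrite -mulr_sumr ler_piMr ?mulr_ge0 ?expR_ge0 //; exact: sum_half_le.
Qed.

(** A geometric sum standing for the integral of exp (- x t); the denominator is bounded by
    [expR x - 1 >= x]. *)
Lemma sum_expRN_le (x : R) M : 0 < x -> x * \sum_(1 <= j < M.+1) expR (- (x * j%:R)) <= 1.
Proof.
move=> x0; set s := \sum_(_ <= _ < _) _.
have s0 : 0 <= s by apply: sumr_ge0 => j _; apply: expR_ge0.
suff E : (expR x - 1) * s = 1 - expR (- (x * M%:R)).
  apply: le_trans (_ : (expR x - 1) * s <= _).
    by apply: ler_wpM2r => //; rewrite lerBrDl expR_ge1Dx.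
  by rewrite E gerBl expR_ge0.
rewrite /s; clear s s0; elim: M => [|M IH].
  by rewrite big_geq // mulr0 mulr0 oppr0 expR0 subrr.
rewrite big_nat_recr //= mulrDr IH.
have -> : expR (- (x * M%:R)) = expR x * expR (- (x * M.+1%:R)).
  by rewrite -expRD -natr1; congr expR; ring.
ring.
Qed.

Lemma count_below_le (c : R) M : 0 <= c ->
  \sum_(1 <= j < M.+1) (j%:R < c)%R%:R <= c.
Proof.
move=> c0; elim: M => [|M IH]; first by rewrite big_geq.
rewrite big_nat_recr //=; case: (ltP (M.+1%:R) c) => /= h; last by rewrite addr0.
apply: le_trans (ltW h); rewrite -[leRHS]natr1 lerD2r.
apply: le_trans (_ : \sum_(1 <= j < M.+1) 1 <= _).
  by apply: ler_sum => j _; case: (_ < _).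
by rewrite sumr_const_nat subSS subn0.
Qed.

End DensePhase.

(** * Upper bound for the minimal length *)

Section GridUpper.
Variables (R : realType) (n : nat).
Hypothesis n_gt0 : (0 < n)%N.

(** The sum over densities p is cut at A / n. Below, components beyond size [K] number at most n /
    K, over a range of length A / n. Above, [dense_sum_le] applies; half of its exponent gives exp
    (- A / 8), and the other half leaves the integral of n exp (- n p / 8), at most 8. *)
Lemma grid_mst_upper m K (A : R) : (0 < K <= n)%N -> 64 <= A ->
  grid_mst R n m <= \sum_(1 <= k < K.+1) tree_comps R n k (k * (n - k)) m
                    + A / K%:R + 8 * expR (- (A / 8)).
Proof.
move=> /andP[K0 Kn] A64; rewrite grid_mst_sum ler_pdivrMr ?ltr0n //.
have N0 : (0 : R) < m.+1%:R by rewrite ltr0n.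
have nn0 : (0 : R) < n%:R by rewrite ltr0n.
have KK0 : (0 : R) < K%:R by rewrite ltr0n.
have A0 : 0 <= A by lra.
set N : R := m.+1%:R in N0 *.
pose term k (p : R) := 'C(n, k)%:R * labelled_trees R k * p ^+ k.-1 * (1 - p) ^+ (k * (n - k)).
have pj j : (j < m.+1)%N -> 0 <= j%:R / N <= 1.
  move=> jm; rewrite divr_ge0 //= ler_pdivrMr // mul1r ler_nat.
  exact: ltnW.
have term_ge0 k j : (j < m.+1)%N -> 0 <= term k (j%:R / N).
  move=> /pj/andP[h1 h2]; rewrite /term.
  apply: mulr_ge0; last by rewrite exprn_ge0 ?subr_ge0.
  by apply: mulr_ge0; [rewrite mulr_ge0 ?divr_ge0 ?exprn_ge0|rewrite exprn_ge0].
have avg_term k j : (0 < k <= n)%N -> (j < m.+1)%N ->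
    avg (fun v : {ffun edge n -> 'I_m.+1} =>
      (kappa_size (open_edges (fun t : 'I_m.+1 => (t < j)%N) v) k)%:R) <= term k (j%:R / N).
  move=> /(avg_kappa_size R (ord0 : 'I_m.+1) (fun t => (t < j)%N)) h jm; move: h.
  by rewrite open_prob_below ?(ltnW jm) // => /andP[_ h]; apply: h.
apply: le_trans (_ : \sum_(1 <= j < m.+1) (\sum_(1 <= k < K.+1) term k (j%:R / N) +
   ((j%:R < A * N / n%:R)%R%:R * (n%:R / K%:R) +
   n%:R * (expR (- (A / 8)) * expR (- (n%:R / (8 * N) * j%:R))))) <= _).
  apply: ler_sum_nat => j /andP[j0 jm].
  have e_ge0 : 0 <= n%:R * (expR (- (A / 8)) * expR (- (n%:R / (8 * N) * j%:R))).
    by rewrite !mulr_ge0 ?expR_ge0.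
  case: ltP => h /=.
    rewrite mul1r addrA; apply: (le_trans (_ : _ <=
      \sum_(1 <= k < K.+1) term k (j%:R / N) + n%:R / K%:R)); last first.
      by rewrite lerDl.
    apply: le_trans (_ : avg (fun v : {ffun edge n -> 'I_m.+1} => \sum_(1 <= k < K.+1)
      (kappa_size (open_edges (fun t : 'I_m.+1 => (t < j)%N) v) k)%:R + n%:R / K%:R) <= _).
      by apply: le_avg => v; apply: kappa_pred_le => //; rewrite K0.
    rewrite avgD (avg_cst _ (ord0 : 'I_m.+1)) lerD2r avg_sum.
    apply: ler_sum_nat => k /andP[k0 kK]; apply: avg_term => //.
    by rewrite k0 (leq_trans _ Kn).
  have h1 : A <= n%:R * (j%:R / N).
    by rewrite mulrA ler_pdivlMr // [n%:R * _]mulrC -ler_pdivrMr.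
  rewrite mul0r add0r.
  apply: le_trans (_ : 0 + n%:R * expR (- (n%:R * (j%:R / N) / 4)) <= _); last first.
    apply: lerD.
      by rewrite big_nat_cond; apply: sumr_ge0 => k _; apply: term_ge0.
    rewrite ler_wpM2l // -expRD ler_expR.
    have -> : n%:R / (8 * N) * j%:R = n%:R * (j%:R / N) / 8 by field; rewrite gt_eqF.
    by move: h1; move: (n%:R * (j%:R / N)) => l h1; lra.
  rewrite add0r; apply: le_trans (dense_sum_le (pj j jm) _); last first.
    exact: (le_trans A64).
  apply: le_trans (_ : avg (fun v : {ffun edge n -> 'I_m.+1} => \sum_(1 <= k < (n./2).+1)
    (kappa_size (open_edges (fun t : 'I_m.+1 => (t < j)%N) v) k)%:R) <= _).
    by apply: le_avg => v; apply: kappa_pred_le_half.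
  rewrite avg_sum; apply: ler_sum_nat => k /andP[k0 kn]; apply: avg_term => //.
  rewrite k0; move: kn; have := odd_double_half n; rewrite -addnn; clear; lia.
rewrite !big_split /= exchange_big /= [leRHS]mulrDl.
rewrite [X in _ <= X + _]mulrDl -[leRHS]addrA; apply: lerD.
  rewrite mulr_suml le_eqVlt; apply/orP; left; apply/eqP; apply: eq_bigr => k _.
  rewrite /tree_comps /beta_sum -!mulrA mulVf ?mulr1 ?gt_eqF // !mulr_sumr.
  by apply: eq_bigr => j _; rewrite /term -!mulrA.
apply: lerD.
  rewrite -mulr_suml; apply: le_trans (ler_wpM2r _ (count_below_le _ _)) _.
  - by rewrite divr_ge0.
  - by rewrite divr_ge0 // mulr_ge0 // ltW.
  by rewrite le_eqVlt; apply/orP; left; apply/eqP; field; rewrite !gt_eqF.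
rewrite -!mulr_sumr.
have x0 : 0 < n%:R / (8 * N) by rewrite divr_gt0 // mulr_gt0.
have := sum_expRN_le m x0; set s := \sum_(_ <= _ < _) _ => h.
have -> : n%:R * (expR (- (A / 8)) * s) =
  8 * expR (- (A / 8)) * N * (n%:R / (8 * N) * s) by field; rewrite gt_eqF.
by rewrite ler_piMr // !mulr_ge0 ?expR_ge0 // ltW.
Qed.

End GridUpper.

(** * Stability of the Gibbs law in the labels *)

Section Perturbation.
Variables (R : realType) (n : nat) (beta h : R) (u u' : edge n -> R).
Hypotheses (n_gt0 : (0 < n)%N) (beta_ge0 : 0 <= beta) (h_ge0 : 0 <= h).
Hypothesis near : forall e, u e <= u' e <= u e + h.

Lemma tree_length_perturb (T : spanning_tree n) :
  tree_length u T <= tree_length u' T <= tree_length u T + n%:R * h.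
Proof.
rewrite /tree_length; apply/andP; split.
  by apply: ler_sum => e _; have /andP[] := near e.
apply: le_trans (_ : \sum_(e in val T) (u e + h) <= _).
  by apply: ler_sum => e _; have /andP[] := near e.
rewrite big_split /= lerD2l sumr_const -[_ *+ _]mulr_natl ler_wpM2r // ler_nat.
have tT : tree setT (val T) by rewrite -spanning_treeE (valP T).
rewrite (tree_card _ tT) ?cardsT ?card_ord ?leq_pred //.
by apply/set0Pn; exists (Ordinal n_gt0); rewrite inE.
Qed.

Let c := expR (beta * (n%:R * h)).

Let weight_perturb T : c^-1 * expR (- beta * tree_length u T) <=
  expR (- beta * tree_length u' T) <= expR (- beta * tree_length u T).
Proof.
have /andP[h1 h2] := tree_length_perturb T.
have := ler_wpM2l beta_ge0 h1; have := ler_wpM2l beta_ge0 h2.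
rewrite /c -expRN -expRD !ler_expR mulrDr => h3 h4.
by apply/andP; split; lra.
Qed.

(** Numerator and normaliser both decrease, by a factor of at least [c^-1] each, so the quotient
    moves by at most [c] in either direction rather than by its square. *)
Lemma wst_weight_perturb (T : spanning_tree n) :
  c^-1 * wst_weight beta u T <= wst_weight beta u' T <= c * wst_weight beta u T.
Proof.
have c0 : 0 < c by apply: expR_gt0.
have Z0 := gibbs_denom_gt0 beta u n_gt0; have Z0' := gibbs_denom_gt0 beta u' n_gt0.
rewrite /wst_weight.
set Z := \sum_T' expR (- beta * tree_length u T') in Z0 *.
set Z' := \sum_T' expR (- beta * tree_length u' T') in Z0' *.
have Z'Z : Z' <= Z by apply: ler_sum => S _; have /andP[] := weight_perturb S.
have ZZ' : c^-1 * Z <= Z'.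
  by rewrite mulr_sumr; apply: ler_sum => S _; have /andP[] := weight_perturb S.
have /andP[h1 h2] := weight_perturb T.
apply/andP; split.
  rewrite mulrA; apply: ler_pM => //.
  - by rewrite mulr_ge0 ?expR_ge0 // invr_ge0 ltW.
  - by rewrite invr_ge0 ltW.
  - by rewrite lef_pV2.
rewrite mulrCA; apply: ler_pM => //; rewrite ?expR_ge0 ?invr_ge0 ?(ltW Z0') //.
by rewrite -[c]invrK -invfM lef_pV2 ?posrE ?mulr_gt0 ?invr_gt0.
Qed.

End Perturbation.

Local Open Scope classical_set_scope.

(** * Cutting the label space into boxes *)

Section Discretization.
Context (d : measure_display) (Om : measurableType d) (R : realType).
Variables (P : probability Om R) (n : nat) (beta : R).
Variables (U : edge n -> {RV P >-> R}) (W : Om -> spanning_tree n).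
Hypotheses (n_gt0 : (0 < n)%N) (beta_ge0 : 0 <= beta) (hW : is_wst beta U W).

(** Half-open cells are disjoint and cover [0, 1[. *)
Definition cell m (t : 'I_m.+1) : set R := `[label R t, label R t + m.+1%:R^-1[%classic.

Lemma cell_disjoint m (t t' : 'I_m.+1) x : cell t x -> cell t' x -> t = t'.
Proof.
have N0 : (0 : R) < m.+1%:R by rewrite ltr0n.
have lt_cell (s s' : 'I_m.+1) : label R s < label R s' + m.+1%:R^-1 -> (s <= s')%N.
  rewrite /label -[X in _ + X]mul1r -mulrDl ltr_pM2r ?invr_gt0 // natr1 ltr_nat.
  by rewrite ltnS.
rewrite /cell /= !in_itv /= => /andP[h1 h2] /andP[h3 h4].
apply/val_inj/eqP; rewrite eqn_leq; apply/andP; split; apply: lt_cell.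
  exact: le_lt_trans h1 h4.
exact: le_lt_trans h3 h2.
Qed.

Lemma prob_cell m (t : 'I_m.+1) e : P (U e @^-1` cell t) = (m.+1%:R^-1)%:E.
Proof.
have -> : P (U e @^-1` cell t) = distribution P (U e) (cell t) by [].
have mc : measurable (cell t) by apply: measurable_itv.
have N0 : (0 : R) < m.+1%:R by rewrite ltr0n.
rewrite (wst_labels_uniform hW) // /uniform_prob.
rewrite (eq_integral (fun=> 1%:E)); last first.
  move=> x; rewrite classical_sets.inE /cell /= in_itv /= => /andP[h1 h2].
  have /andP[l0 _] := label01 R t.
  have l1 : label R t + m.+1%:R^-1 <= 1.
    by rewrite /label -[X in _ + X]mul1r -mulrDl ler_pdivrMr // mul1r natr1 ler_nat.
  rewrite /uniform_pdf (le_trans l0 h1) (ltW (lt_le_trans h2 l1)) /=.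
  by rewrite subr0 invr1.
rewrite integral_cst // mul1e /cell /= lebesgue_measure_itv /= lte_fin ltrDl invr_gt0 N0.
by rewrite -EFinB addrAC subrr add0r.
Qed.

Definition box m (v : {ffun edge n -> 'I_m.+1}) : set Om :=
  \bigcap_(e in [set` [set: edge n]%SET]) (U e @^-1` cell (v e)).

Lemma boxP m (v : {ffun edge n -> 'I_m.+1}) x :
  box v x -> forall e, label R (v e) <= U e x <= label R (v e) + m.+1%:R^-1.
Proof.
move=> /(_ _)/= h e; have := h e; rewrite !inE => /(_ isT).
by rewrite /cell /= in_itv /= => /andP[-> /ltW ->].
Qed.

Lemma box_disjoint m (v v' : {ffun edge n -> 'I_m.+1}) x : box v x -> box v' x -> v = v'.
Proof.
move=> h h'; apply/ffunP => e; apply: (@cell_disjoint m _ _ (U e x)).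
  by apply: (h e); rewrite /= inE.
by apply: (h' e); rewrite /= inE.
Qed.

(** A box is an event of the labels alone, so the conditional law can be integrated over it. *)
Lemma box_sigma m (v : {ffun edge n -> 'I_m.+1}) : generated_sigma U (box v).
Proof.
apply: (@fin_bigcap_measurable _ (g_sigma_algebraType
  [set A | exists e, exists2 B : set R, measurable B & A = U e @^-1` B])).
  exact: finite_finset.
move=> e _; apply: sub_sigma_algebra; exists e; exists (cell (v e)) => //.
exact: measurable_itv.
Qed.

Lemma generated_sigma_measurable A : generated_sigma U A -> measurable A.
Proof.
apply: smallest_sub; first exact: sigma_algebra_measurable.
move=> _ [e [B mB ->]]; rewrite -[X in measurable X]classical_sets.setTI.
exact: measurable_funP.
Qed.

Lemma measurable_box m (v : {ffun edge n -> 'I_m.+1}) : measurable (box v).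
Proof. by apply: generated_sigma_measurable; apply: box_sigma. Qed.

Lemma prob_box m (v : {ffun edge n -> 'I_m.+1}) :
  P (box v) = ((#|{ffun edge n -> 'I_m.+1}|%:R)^-1)%:E.
Proof.
have /(_ [set: edge n]%SET (fun e => cell (v e))) indep := wst_labels_independent hW.
rewrite /box indep.
  rewrite (eq_bigr (fun=> (m.+1%:R^-1)%:E)); last by move=> e _; apply: prob_cell.
  rewrite prodEFin prodr_const cardsT card_ffun card_ord natrX exprVn.
  by [].
by move=> e; apply: measurable_itv.
Qed.

Definition piece m (v : {ffun edge n -> 'I_m.+1}) T := box v `&` W @^-1` [set T].

Lemma measurable_piece m (v : {ffun edge n -> 'I_m.+1}) T : measurable (piece v T).
Proof. by apply: measurableI; [exact: measurable_box|exact: (wst_measurable hW)]. Qed.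

Lemma prob_piece m (v : {ffun edge n -> 'I_m.+1}) T :
  (((expR (beta * (n%:R * m.+1%:R^-1)))^-1 *
     (wst_weight beta (fun e => label R (v e)) T / #|{ffun edge n -> 'I_m.+1}|%:R))%:E
   <= P (piece v T) <=
   (expR (beta * (n%:R * m.+1%:R^-1)) *
     (wst_weight beta (fun e => label R (v e)) T / #|{ffun edge n -> 'I_m.+1}|%:R))%:E)%E.
Proof.
set c := expR _; set q := _ / _; pose G (w : Om) : R := wst_weight beta (U^~ w) T.
have [mq condq] : is_conditional_probability P (W @^-1` [set T]) (generated_sigma U) G.
  exact: wst_conditional_law hW T.
have mG : measurable_fun [set: Om] G.
  move=> _ B mB; rewrite classical_sets.setTI; apply: generated_sigma_measurable.
  exact: mq.
have mb := measurable_box v.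
have -> : P (piece v T) = (\int[P]_(w in box v) (G w)%:E)%E.
  by rewrite -condq; [rewrite /piece classical_sets.setIC|exact: box_sigma].
have h0 : 0 <= m.+1%:R^-1 :> R by rewrite invr_ge0.
have bound w : box v w -> c^-1 * wst_weight beta (fun e => label R (v e)) T <= G w <=
    c * wst_weight beta (fun e => label R (v e)) T.
  by move=> /boxP near; apply: wst_weight_perturb.
have c0 : 0 <= c by apply: expR_ge0.
have mGb : measurable_fun (box v) (fun w => (G w)%:E).
  by apply/measurable_EFinP; apply: measurable_funTS.
apply/andP; split.
  rewrite /q mulrA EFinM -(prob_box v) -integral_cst //.
  apply: ge0_le_integral => //.
  - by move=> w _; rewrite lee_fin mulr_ge0 ?invr_ge0 ?wst_weight_ge0.
  - by move=> w /bound/andP[h1 _]; rewrite lee_fin.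
rewrite /q mulrA EFinM -(prob_box v) -integral_cst //.
apply: ge0_le_integral => //.
- by move=> w _; rewrite lee_fin wst_weight_ge0.
- by move=> w /bound/andP[_ h1]; rewrite lee_fin.
Qed.

End Discretization.

(** * The expected length as a limit of grid averages *)

Section ExpectedLength.
Context (d : measure_display) (Om : measurableType d) (R : realType).
Variables (P : probability Om R) (n : nat) (beta : R).
Variables (U : edge n -> {RV P >-> R}) (W : Om -> spanning_tree n).
Hypotheses (n_gt0 : (0 < n)%N) (beta_ge0 : 0 <= beta) (hW : is_wst beta U W).

Let len (w : Om) : R := tree_length (U^~ w) (W w).

Lemma measurable_tree_length : measurable_fun [set: Om] len.
Proof.
have -> : len = (fun w => \sum_(T : spanning_tree n)
    \1_(W @^-1` [set T]) w * tree_length (U^~ w) T).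
  apply/funext => w; rewrite (bigD1 (W w)) //= big1 ?addr0.
    by rewrite indicE mem_set ?mul1r.
  move=> T TW; rewrite indicE memNset ?mul0r //= => WT.
  by rewrite WT eqxx in TW.
apply: measurable_sum => T; apply: measurable_funM.
  exact/measurable_indic/(wst_measurable hW).
have -> : (fun w => tree_length (U^~ w) T) = (fun w => \sum_(e <- enum (val T)) U e w).
  by apply/funext => w; rewrite /tree_length big_enum.
by apply: measurable_sum => e; apply: measurable_funP.
Qed.

Definition boxes m : set Om :=
  \big[classical_sets.setU/classical_sets.set0]_(v <- index_enum {ffun edge n -> 'I_m.+1}) box U v.

Lemma boxesP m w : boxes m w <-> exists v : {ffun edge n -> 'I_m.+1}, box U v w.
Proof.
rewrite /boxes -classical_sets.bigcup_seq; split => [[v _ vw]|[v vw]]; first by exists v.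
by exists v => //=; rewrite mem_index_enum.
Qed.

Lemma measurable_boxes m : measurable (boxes m).
Proof. by apply: bigsetU_measurable => v _; apply: measurable_box. Qed.

Lemma trivIset_boxes m (s : seq {ffun edge n -> 'I_m.+1}) :
  classical_sets.trivIset [set` s]%classic (box U (m := m)).
Proof. by move=> v v' _ _ [w [h h']]; apply: box_disjoint h h'. Qed.

Lemma integral_boxes m (f : Om -> \bar R) : measurable_fun (boxes m) f ->
  (forall w, boxes m w -> 0 <= f w)%E ->
  (\int[P]_(w in boxes m) f w =
   \sum_(v : {ffun edge n -> 'I_m.+1}) \int[P]_(w in box U v) f w)%E.
Proof.
move=> mf f0; rewrite /boxes ge0_integral_bigsetU //.
- by move=> v; apply: measurable_box.
- exact: index_enum_uniq.
- exact: trivIset_boxes.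
Qed.

(** Found by adding up the boxes: labels outside [0, 1[, where a length could be negative, are
    thereby seen to have probability zero. *)
Lemma prob_boxes m : P (boxes m) = 1%E.
Proof.
rewrite -[LHS]mul1e -integral_cst; last exact: measurable_boxes.
rewrite integral_boxes //.
rewrite (eq_bigr (fun v => ((#|{ffun edge n -> 'I_m.+1}|%:R)^-1)%:E)); last first.
  move=> v _; rewrite integral_cst; last exact: measurable_box.
  by rewrite mul1e; exact: (prob_box hW v).
rewrite sumEFin sumr_const -[_ *+ _]mulr_natl divff //.
by rewrite pnatr_eq0 -lt0n; apply/card_gt0P; exists [ffun=> ord0].
Qed.

Lemma len_ge0 m w : boxes m w -> 0 <= len w.
Proof.
move=> /boxesP[v /boxP h]; apply: sumr_ge0 => e _.
have /andP[h1 _] := h e; apply: le_trans h1.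
by have /andP[] := label01 R (v e).
Qed.

Lemma expected_length_boxes m :
  expected_length U W = (\sum_(v : {ffun edge n -> 'I_m.+1})
    \sum_(T : spanning_tree n) \int[P]_(w in piece U W v T) (len w)%:E)%E.
Proof.
have mlen : measurable_fun [set: Om] (EFin \o len).
  exact/measurable_EFinP/measurable_tree_length.
have mB := measurable_boxes m.
rewrite /expected_length unlock.
(* The complement of the boxes is null, and on the boxes the integrand is nonnegative, which the
   splitting below requires. *)
transitivity (\int[P]_(w in boxes m) (len w)%:E)%E.
  rewrite [RHS]integral_mkcond; apply: ae_eq_integral => //.
    by apply/(measurable_restrictT _ mB).1; apply: measurable_funTS.
  exists (~` boxes m); split; first exact: measurableC.
    by have := probability_setC P mB; rewrite prob_boxes subee.
  move=> w /=; apply: contra_not => wB _.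
  by rewrite patchE mem_set //.
rewrite integral_boxes; last 2 first.
- exact: measurable_funTS.
- by move=> w /len_ge0; rewrite lee_fin.
apply: eq_bigr => v _.
have boxE : box U v =
    \big[classical_sets.setU/classical_sets.set0]_(T <- index_enum (spanning_tree n)) piece U W v T.
  rewrite -classical_sets.bigcup_seq; apply/seteqP; split=> [w wv|w [T _ []]//].
  by exists (W w) => //=; rewrite mem_index_enum.
rewrite boxE ge0_integral_bigsetU //.
- by move=> T; apply: (measurable_piece hW).
- exact: index_enum_uniq.
- by move=> T T' _ _ [w [[_ /= <-] [_ /= <-]]].
- exact: measurable_funTS.
move=> w; rewrite -boxE => wv; rewrite lee_fin (len_ge0 (m := m)) //.
by apply/boxesP; exists v.
Qed.

Lemma integral_piece_bounds m (v : {ffun edge n -> 'I_m.+1}) T :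
  let a := tree_length (fun e => label R (v e)) T in
  ((a%:E * P (piece U W v T) <= \int[P]_(w in piece U W v T) (len w)%:E)%E /\
   (\int[P]_(w in piece U W v T) (len w)%:E <=
     (a + n%:R * m.+1%:R^-1)%:E * P (piece U W v T))%E).
Proof.
move=> a; have mp := measurable_piece hW v T.
have h0 : 0 <= m.+1%:R^-1 :> R by rewrite invr_ge0.
have mlen : measurable_fun (piece U W v T) (EFin \o len).
  exact/measurable_funTS/measurable_EFinP/measurable_tree_length.
have a0 : 0 <= a.
  by apply: sumr_ge0 => e _; have /andP[] := label01 R (v e).
have bound w : piece U W v T w -> a <= len w <= a + n%:R * m.+1%:R^-1.
  move=> [/boxP near /= WT]; rewrite /len WT.
  exact: tree_length_perturb.
rewrite -!integral_cst //; split; apply: ge0_le_integral => //.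
- by move=> w /bound/andP[h1 _]; rewrite lee_fin.
- by move=> w /bound/andP[h1 _]; rewrite lee_fin; apply: le_trans h1.
- by move=> w /bound/andP[_ h1]; rewrite lee_fin.
Qed.

Lemma expected_length_grid m :
  let c := expR (beta * (n%:R * m.+1%:R^-1)) in
  ((c^-1 * grid_length n beta m)%:E <= expected_length U W)%E /\
  (expected_length U W <= (c * (grid_length n beta m + n%:R * m.+1%:R^-1))%:E)%E.
Proof.
move=> c; rewrite (expected_length_boxes m).
have c0 : 0 < c by apply: expR_gt0.
have h0 : 0 <= m.+1%:R^-1 :> R by rewrite invr_ge0.
have a0 (v : {ffun edge n -> 'I_m.+1}) (T : spanning_tree n) :
    0 <= tree_length (fun e => label R (v e)) T.
  by apply: sumr_ge0 => e _; have /andP[] := label01 R (v e).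
pose G x := \sum_(v : {ffun edge n -> 'I_m.+1}) \sum_(T : spanning_tree n)
  (tree_length (fun e => label R (v e)) T + x) *
  (wst_weight beta (fun e => label R (v e)) T / #|{ffun edge n -> 'I_m.+1}|%:R).
have GE x : G x = grid_length n beta m + x.
  rewrite -[x in RHS](avg_cst (edge n) (ord0 : 'I_m.+1)) -avgD /avg mulr_suml.
  apply: eq_bigr => v _; rewrite -[x in RHS]mulr1.
  rewrite -(sum_wst_weight beta (fun e => label R (v e)) n_gt0).
  rewrite mulr_sumr -big_split mulr_suml /=; apply: eq_bigr => T _; ring.
split.
  apply: (@le_trans _ _ (c^-1 * G 0)%:E); first by rewrite GE addr0.
  rewrite mulr_sumr -sumEFin; apply: lee_sum => v _.
  rewrite mulr_sumr -sumEFin; apply: lee_sum => T _.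
  have [h _] := integral_piece_bounds v T; apply: le_trans h.
  rewrite addr0 mulrCA EFinM; apply: lee_wpmul2l; first by rewrite lee_fin.
  by have /andP[] := prob_piece n_gt0 beta_ge0 hW v T.
rewrite -GE mulr_sumr -sumEFin; apply: lee_sum => v _.
rewrite mulr_sumr -sumEFin; apply: lee_sum => T _.
have [_ h] := integral_piece_bounds v T; apply: (le_trans h).
rewrite [in leRHS]mulrCA EFinM; apply: lee_wpmul2l.
  by rewrite lee_fin addr_ge0 // mulr_ge0.
by have /andP[] := prob_piece n_gt0 beta_ge0 hW v T.
Qed.

Lemma expected_length_lim : exists2 l : R, expected_length U W = l%:E &
  grid_length n beta m @[m --> \oo] --> l.
Proof.
(* The grid with a single cell per label already shows that the expectation is finite. *)
have [h1 h2] := expected_length_grid 0.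
have fin : expected_length U W \is a fin_num.
  rewrite fin_numE -ltNye -ltey (lt_le_trans _ h1) ?ltNyr //=.
  by rewrite (le_lt_trans h2) ?ltry.
exists (fine (expected_length U W)); first by rewrite fineK.
set l := fine _.
have bounds m : let c := expR (beta * (n%:R * m.+1%:R^-1)) in
    c^-1 * l - n%:R * m.+1%:R^-1 <= grid_length n beta m <= c * l.
  move=> c; have [] := expected_length_grid m; rewrite -(fineK fin) -/l -/c !lee_fin.
  have c0 : 0 < c by apply: expR_gt0.
  rewrite ler_pdivrMl // => h3 h4.
  by rewrite lerBlDr ler_pdivrMl // h4.
have cvgN : (m.+1%:R^-1 : R) @[m --> \oo] --> (0 : R) by exact: cvg_harmonic.
have cvgc : expR (beta * (n%:R * m.+1%:R^-1)) @[m --> \oo] --> (1 : R).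
  rewrite -[X in _ --> X]expR0; apply: continuous_cvg; first exact: continuous_expR.
  rewrite -[X in _ --> X](mulr0 beta) -(mulr0 n%:R).
  by apply: cvgMr; apply: cvgMr.
apply: (@squeeze_cvgr _ _ _ _
  (fun m => (expR (beta * (n%:R * m.+1%:R^-1)))^-1 * l - n%:R * m.+1%:R^-1)
  (fun m => expR (beta * (n%:R * m.+1%:R^-1)) * l)).
- by apply: nearW => m; apply: bounds.
- rewrite -[X in _ --> X]subr0; apply: cvgB.
    rewrite -[X in _ --> X]mul1r -[X in X * _]invr1; apply: cvgMl.
    by apply: cvgV.
  by rewrite -(mulr0 n%:R); apply: cvgMr.
by rewrite -[X in _ --> X]mul1r; apply: cvgMl.
Qed.

End ExpectedLength.

(** * Limits of Beta sums and of exponentially tilted means *)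

Section GridLimits.
Variable R : realType.

Let cvg_inv_succ : (m.+1%:R^-1 : R) @[m --> \oo] --> (0 : R).
Proof. exact: cvg_harmonic. Qed.

(** The powers j^(a+1) telescope, and each increment lies between (a+1) j^a and (a+1) (j+1)^a. *)
Lemma power_sum_bounds (a N : nat) :
  a.+1%:R * \sum_(0 <= j < N) j%:R ^+ a <= N%:R ^+ a.+1 :> R /\
  N%:R ^+ a.+1 <= a.+1%:R * \sum_(0 <= j < N) j.+1%:R ^+ a :> R.
Proof.
have step j : a.+1%:R * j%:R ^+ a <= j.+1%:R ^+ a.+1 - j%:R ^+ a.+1 :> R /\
    j.+1%:R ^+ a.+1 - j%:R ^+ a.+1 <= a.+1%:R * j.+1%:R ^+ a :> R.
  rewrite subrXX -[j.+1%:R]natr1 [j%:R + 1 - _]addrAC subrr add0r mul1r.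
  have jj : (j%:R : R) <= j%:R + 1 by rewrite lerDl.
  have cst (c : R) : a.+1%:R * c = \sum_(i < a.+1) c.
    by rewrite sumr_const card_ord mulr_natl.
  rewrite !cst; split; apply: ler_sum => i _.
    rewrite -[in leLHS](subnK (n := a) (m := i)); last by rewrite -ltnS.
    by rewrite exprD ler_wpM2r ?exprn_ge0 // lerXn2r ?nnegrE ?addr_ge0.
  rewrite -[in leRHS](subnK (n := a) (m := i)); last by rewrite -ltnS.
  rewrite [in leRHS]exprD ler_wpM2l ?exprn_ge0 ?addr_ge0 //.
  by rewrite lerXn2r ?nnegrE ?addr_ge0.
have tel : N%:R ^+ a.+1 = \sum_(0 <= j < N) (j.+1%:R ^+ a.+1 - j%:R ^+ a.+1) :> R.
  by rewrite telescope_sumr // expr0n subr0.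
by rewrite tel !mulr_sumr; split; apply: ler_sum => j _; have [] := step j.
Qed.

(** Induction on [b] through (1 - p)^(b+1) = (1 - p)^b - p (1 - p)^b, starting from power sums. *)
Lemma cvg_beta_sum a b :
  beta_sum R a b m @[m --> \oo] --> (a`!%:R * b`!%:R / (a + b).+1`!%:R : R).
Proof.
elim: b a => [|b IH] a.
  have -> : a`!%:R * 0`!%:R / (a + 0).+1`!%:R = a.+1%:R^-1 :> R.
    have f0 : a`!%:R != 0 :> R by rewrite pnatr_eq0 -lt0n fact_gt0.
    have f1 : a.+1%:R != 0 :> R by rewrite pnatr_eq0.
    by rewrite addn0 fact0 mulr1 factS natrM invfM mulrCA divff ?mulr1.
  apply: (@squeeze_cvgr _ _ _ _ (fun m => a.+1%:R^-1 - m.+1%:R^-1) (fun=> a.+1%:R^-1)).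
  - apply: nearW => m; set N : R := m.+1%:R.
    have N0 : 0 < N by rewrite ltr0n.
    have a0 : (0 : R) < a.+1%:R by rewrite ltr0n.
    set s : R := \sum_(1 <= j < m.+1) j%:R ^+ a.
    have bs : beta_sum R a 0 m = s / N ^+ a.+1.
      rewrite /beta_sum -/N exprSr invfM mulrA; congr (_ / _).
      rewrite mulr_suml; apply: eq_bigr => j _.
      by rewrite expr0 mulr1 exprMn exprVn.
    have s0 : s <= \sum_(0 <= j < m.+1) j%:R ^+ a by rewrite big_ltn // lerDr exprn_ge0.
    have s1 : \sum_(0 <= j < m.+1) j.+1%:R ^+ a = s + N ^+ a.
      by rewrite big_nat_recr //= -(big_add1 _ _ 0 m.+1 xpredT (fun j => j%:R ^+ a)).
    have [p1 p2] := power_sum_bounds a m.+1.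
    rewrite bs; apply/andP; split.
      rewrite ler_pdivlMr ?exprn_gt0 // mulrBl.
      rewrite s1 -/N in p2.
      have -> : N^-1 * N ^+ a.+1 = N ^+ a by rewrite exprS mulrA mulVf ?mul1r ?gt_eqF.
      by rewrite lerBlDr ler_pdivrMl.
    rewrite ler_pdivrMr ?exprn_gt0 // ler_pdivlMl //.
    by apply: le_trans p1; rewrite ler_wpM2l.
  - by rewrite -[X in _ --> X]subr0; apply: cvgB; [exact: cvg_cst|exact: cvg_inv_succ].
  - exact: cvg_cst.
have -> : a`!%:R * b.+1`!%:R / (a + b.+1).+1`!%:R =
    a`!%:R * b`!%:R / (a + b).+1`!%:R - a.+1`!%:R * b`!%:R / (a.+1 + b).+1`!%:R :> R.
  rewrite addnS addSn (factS (a + b).+1) (factS b) (factS a).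
  have f0 : (a + b).+1`!%:R != 0 :> R by rewrite pnatr_eq0 -lt0n fact_gt0.
  have f1 : (a + b).+2%:R != 0 :> R by rewrite pnatr_eq0.
  rewrite (natrM _ (a + b).+2) (natrM _ b.+1) (natrM _ a.+1).
  have -> : (b.+1%:R : R) = (a + b).+2%:R - a.+1%:R.
    by rewrite -natrB; [congr (_%:R); lia|lia].
  move: ((a + b).+1`!%:R : R) ((a + b).+2%:R : R) (a.+1%:R : R) f0 f1 => x y z x0 y0.
  by field; rewrite x0 y0.
have E m : beta_sum R a b.+1 m = beta_sum R a b m - beta_sum R a.+1 b m.
  rewrite /beta_sum -mulrBl -sumrB; congr (_ / _); apply: eq_bigr => j _.
  rewrite !exprS; ring.
rewrite (eq_cvg _ _ E); apply: cvgB; exact: IH.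
Qed.

Definition weight (beta : R) m (t : 'I_m.+1) : R := expR (- beta * label R t).

(** The mean of the density proportional to exp (- beta x) on [0, 1]. *)
Definition tilted_mean (beta : R) : R :=
  if beta == 0 then 2^-1
  else (1 - beta * expR (- beta) - expR (- beta)) / (beta * (1 - expR (- beta))).

Section Tilted.
Variable beta : R.
Hypothesis beta_gt0 : 0 < beta.

(** The grid weights are a geometric progression of ratio [rho m], so both means have closed forms,
    in which only [rho m] and [dl m] vary with [m]; they tend to 1 and to [beta]. *)
Let rho m := expR (- (beta / m.+1%:R)).
Let dl m := m.+1%:R * (1 - rho m).

Let rho_lt1 m : rho m < 1.
Proof. by rewrite /rho expR_lt1 oppr_lt0 divr_gt0. Qed.

Let weightE m (t : 'I_m.+1) : weight beta t = rho m ^+ t.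
Proof. by rewrite /weight /rho /label -expRM_natr; congr expR; ring. Qed.

Let rhoN m : rho m ^+ m.+1 = expR (- beta).
Proof. by rewrite /rho -expRM_natr mulNr divfK // pnatr_eq0. Qed.

Let dl_gt0 m : 0 < dl m.
Proof. by rewrite /dl mulr_gt0 ?subr_gt0 ?rho_lt1. Qed.

Let dl_le m : dl m <= beta.
Proof.
rewrite /dl mulrC -ler_pdivlMr ?ltr0n // lerBlDl -lerBlDr.
exact: expR_ge1Dx.
Qed.

Let dl_ge m : beta / (1 + beta / m.+1%:R) <= dl m.
Proof.
have N0 : (0 : R) < m.+1%:R by rewrite ltr0n.
have x0 : 0 < beta / m.+1%:R by rewrite divr_gt0.
have x1 : 0 < 1 + beta / m.+1%:R by rewrite addr_gt0.
have h : rho m <= (1 + beta / m.+1%:R)^-1.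
  by rewrite /rho expRN lef_pV2 ?posrE ?expR_gt0 // expR_ge1Dx.
apply: le_trans (_ : m.+1%:R * (1 - (1 + beta / m.+1%:R)^-1) <= _).
  rewrite le_eqVlt; apply/orP; left; apply/eqP; field.
  by rewrite !gt_eqF // addr_gt0.
by rewrite /dl ler_pM2l // lerB.
Qed.

Let cvg_dl : dl m @[m --> \oo] --> beta.
Proof.
apply: (@squeeze_cvgr _ _ _ _ (fun m => beta / (1 + beta / m.+1%:R)) (fun=> beta)).
- by apply: nearW => m; rewrite dl_ge dl_le.
- have h : 1 + beta / m.+1%:R @[m --> \oo] --> (1 : R).
    rewrite -[X in _ --> X]addr0; apply: cvgD; first exact: cvg_cst.
    by rewrite -(mulr0 beta); apply: cvgMr.
  rewrite -[X in _ --> X]mulr1 -[X in _ * X]invr1; apply: cvgMr.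
  by apply: cvgV.
exact: cvg_cst.
Qed.

Let cvg_rho : rho m @[m --> \oo] --> (1 : R).
Proof.
rewrite /rho -[X in _ --> X]expR0; apply: continuous_cvg; first exact: continuous_expR.
rewrite -[X in _ --> X]oppr0; apply: cvgN.
by rewrite -(mulr0 beta); apply: cvgMr.
Qed.

Let geometric_sum (r : R) N : (1 - r) * \sum_(t < N) r ^+ t = 1 - r ^+ N.
Proof.
elim: N => [|N IH]; first by rewrite big_ord0 mulr0 expr0 subrr.
by rewrite big_ord_recr /= mulrDr IH exprS; ring.
Qed.

Let weighted_geometric_sum (r : R) N :
  (1 - r) ^+ 2 * \sum_(t < N) t%:R * r ^+ t = r * (1 - r ^+ N) - N%:R * r ^+ N * (1 - r).
Proof.
elim: N => [|N IH]; first by rewrite big_ord0 expr0; ring.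
by rewrite big_ord_recr /= mulrDr IH [r ^+ N.+1]exprS -[N.+1%:R]natr1; ring.
Qed.

Lemma mean_weightE m : mean (weight beta (m := m)) = (1 - expR (- beta)) / dl m.
Proof.
rewrite /mean card_ord (eq_bigr (fun t : 'I_m.+1 => rho m ^+ t)); last
  by move=> t _; rewrite weightE.
have h := geometric_sum (rho m) m.+1; rewrite rhoN in h; rewrite -h /dl.
have r0 : 1 - rho m != 0 by rewrite subr_eq0 gt_eqF.
have N0 : m.+1%:R != 0 :> R by rewrite pnatr_eq0.
by move: (m.+1%:R : R) N0 => N N0; field; rewrite N0 r0.
Qed.

Lemma mean_label_weightE m : mean (fun t => label R t * weight beta (m := m) t) =
  (rho m * (1 - expR (- beta)) - expR (- beta) * dl m) / dl m ^+ 2.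
Proof.
rewrite /mean card_ord (eq_bigr (fun t : 'I_m.+1 => m.+1%:R^-1 * (t%:R * rho m ^+ t))); last first.
  by move=> t _; rewrite weightE /label; ring.
rewrite -mulr_sumr; set s := \sum_(_ < _) _.
have h : (1 - rho m) ^+ 2 * s = _ := weighted_geometric_sum (rho m) m.+1.
rewrite rhoN in h.
have -> : rho m * (1 - expR (- beta)) - expR (- beta) * dl m = (1 - rho m) ^+ 2 * s.
  by rewrite h /dl; ring.
have r0 : 1 - rho m != 0 by rewrite subr_eq0 gt_eqF.
have N0 : m.+1%:R != 0 :> R by rewrite pnatr_eq0.
by rewrite /dl; move: (m.+1%:R : R) N0 => N N0; field; rewrite N0 r0.
Qed.

Let E_lt1 : 0 < 1 - expR (- beta).
Proof. by rewrite subr_gt0 expR_lt1 oppr_lt0. Qed.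

Lemma cvg_tilted_gt0 :
  mean (fun t => label R t * weight beta (m := m) t) / mean (weight beta (m := m))
    @[m --> \oo] --> tilted_mean beta.
Proof.
rewrite /tilted_mean gt_eqF //.
have E m : mean (fun t => label R t * weight beta (m := m) t) / mean (weight beta (m := m)) =
    (rho m * (1 - expR (- beta)) - expR (- beta) * dl m) / (dl m * (1 - expR (- beta))).
  rewrite mean_weightE mean_label_weightE; field.
  by rewrite !gt_eqF ?dl_gt0 ?E_lt1.
rewrite (eq_cvg _ _ E); apply: cvgM.
  have -> : 1 - beta * expR (- beta) - expR (- beta) =
    1 * (1 - expR (- beta)) - expR (- beta) * beta by ring.
  by apply: cvgB; [apply: cvgMl cvg_rho|apply: cvgMr cvg_dl].
apply: cvgV; last by apply: cvgMl cvg_dl.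
by rewrite mulf_neq0 // gt_eqF.
Qed.

Lemma mean_weight_ge_gt0 m : (1 + beta)^-1 <= mean (weight beta (m := m)).
Proof.
rewrite mean_weightE; apply: le_trans (_ : (1 - expR (- beta)) / beta <= _); last first.
  by apply: ler_wpM2l; [exact: ltW|rewrite lef_pV2 ?posrE ?dl_gt0 // dl_le].
have b1 : 0 < 1 + beta by rewrite addr_gt0.
rewrite ler_pdivlMr // mulrC.
have h : expR (- beta) <= (1 + beta)^-1.
  by rewrite expRN lef_pV2 ?posrE ?expR_gt0 // expR_ge1Dx.
have -> : beta / (1 + beta) = 1 - (1 + beta)^-1 by field; rewrite gt_eqF.
by rewrite lerB.
Qed.

(** After clearing denominators this is exactly (1 + beta / 2)^2 <= exp beta, whence the constant
    4. *)
Lemma tilted_mean_ge_gt0 : (4 + beta)^-1 <= tilted_mean beta.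
Proof.
rewrite /tilted_mean gt_eqF //; set E := expR (- beta).
have Ei : E^-1 = expR beta by rewrite /E expRN invrK.
have E0 : 0 < E by apply: expR_gt0.
have h : 1 + beta + beta ^+ 2 / 4 <= E^-1.
  rewrite Ei; have -> : beta = 2 * (beta / 2) by field.
  rewrite expRM_natl; apply: le_trans (_ : (1 + beta / 2) ^+ 2 <= _).
    by rewrite le_eqVlt; apply/orP; left; apply/eqP; field.
  have b0 : 0 <= 1 + beta / 2 by rewrite addr_ge0 // divr_ge0 // ltW.
  by rewrite lerXn2r ?nnegrE ?expR_ge0 // expR_ge1Dx.
have b2 : 0 < 4 + beta by rewrite addr_gt0.
rewrite ler_pdivlMr ?mulr_gt0 // mulrC ler_pdivrMr //.
have h' : E * (1 + beta + beta ^+ 2 / 4) <= 1.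
  by rewrite -ler_pdivlMl // mulr1.
by move: h'; rewrite expr2; lra.
Qed.

End Tilted.

Lemma weight0 m (t : 'I_m.+1) : weight 0 t = 1.
Proof. by rewrite /weight oppr0 mul0r expR0. Qed.

Lemma mean_weight0 m : mean (weight 0 (m := m)) = 1.
Proof.
rewrite /mean (eq_bigr (fun=> 1)); last by move=> t _; rewrite weight0.
by rewrite sumr_const divff // card_ord pnatr_eq0.
Qed.

Lemma cvg_tilted beta : 0 <= beta ->
  mean (fun t => label R t * weight beta (m := m) t) / mean (weight beta (m := m))
    @[m --> \oo] --> tilted_mean beta.
Proof.
rewrite le_eqVlt => /predU1P[<-|]; last exact: cvg_tilted_gt0.
rewrite /tilted_mean eqxx.
have E m : mean (fun t => label R t * weight 0 (m := m) t) / mean (weight 0 (m := m)) =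
    2^-1 - 2^-1 * m.+1%:R^-1.
  rewrite mean_weight0 divr1 /mean card_ord.
  rewrite (eq_bigr (fun t : 'I_m.+1 => m.+1%:R^-1 * t%:R)); last first.
    by move=> t _; rewrite weight0 mulr1 /label mulrC.
  rewrite -mulr_sumr -natr_sum.
  have h : 2 * (\sum_(t < m.+1) t)%N%:R = m.+1%:R * m%:R :> R.
    by rewrite -!natrM; congr (_%:R); elim: m => [|m IH];
      rewrite ?big_ord1 // big_ord_recr /= mulnDr IH; lia.
  have N0 : m.+1%:R != 0 :> R by rewrite pnatr_eq0.
  have -> : (\sum_(t < m.+1) t)%N%:R = m.+1%:R * m%:R / 2 :> R.
    by rewrite -h [2 * _]mulrC mulfK.
  have -> : m%:R = m.+1%:R - 1 :> R by rewrite -natr1 addrK.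
  by move: (m.+1%:R : R) N0 => N N0; field.
have h : 2^-1 - 2^-1 * m.+1%:R^-1 @[m --> \oo] --> (2^-1 - 2^-1 * 0 : R).
  by apply: cvgB; [exact: cvg_cst|apply: cvgMr].
by rewrite (eq_cvg _ _ E); rewrite mulr0 subr0 in h.
Qed.

Lemma mean_weight_ge beta m : 0 <= beta -> (1 + beta)^-1 <= mean (weight beta (m := m)).
Proof.
rewrite le_eqVlt => /predU1P[<-|]; last by move=> b0; apply: mean_weight_ge_gt0.
by rewrite mean_weight0 addr0 invr1.
Qed.

Lemma tilted_mean_ge beta : 0 <= beta -> (4 + beta)^-1 <= tilted_mean beta.
Proof.
rewrite le_eqVlt => /predU1P[<-|]; last by move=> b0; apply: tilted_mean_ge_gt0.
by rewrite addr0 /tilted_mean eqxx lef_pV2 ?posrE // ler_nat.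
Qed.

Lemma low_beta_lengthE n beta : low_beta_length n beta = n%:R * tilted_mean beta.
Proof.
rewrite /low_beta_length /tilted_mean; case: ifP => // _.
by rewrite invfM mulrACA -mulrA; congr (_ * _); ring.
Qed.

End GridLimits.

(** * Bounds for fixed n after the mesh limit *)

Section LimitBounds.
Variables (R : realType) (n : nat) (beta l : R).
Hypotheses (n_gt0 : (0 < n)%N) (beta_ge0 : 0 <= beta).
Hypothesis grid_l : grid_length n beta m @[m --> \oo] --> l.

Lemma cvg_sum_seq (K : Type) (s : seq K) (f : K -> nat -> R) (c : K -> R) :
  (forall k, f k m @[m --> \oo] --> c k) ->
  \sum_(k <- s) f k m @[m --> \oo] --> \sum_(k <- s) c k.
Proof.
move=> fc; elim: s => [|k s IH].
  rewrite big_nil; under eq_fun do rewrite big_nil; exact: cvg_cst.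
rewrite big_cons; under eq_fun do rewrite big_cons.
exact: cvgD.
Qed.

(* The limit of the expected number of tree components of size k, integrated
   over the edge density; b is the exponent of the closed edges. *)
Definition comp_mass (N k b : nat) : R :=
  'C(N, k)%:R * labelled_trees R k * (k.-1`!%:R * b`!%:R / (k.-1 + b).+1`!%:R).

Lemma cvg_tree_comps k b : tree_comps R n k b m @[m --> \oo] --> comp_mass n k b.
Proof. by apply: cvgMr; apply: cvg_beta_sum. Qed.

Lemma limit_ge K : (K <= n)%N ->
  \sum_(1 <= k < K.+1) (1 - k%:R / n%:R) * comp_mass n k (k * n) <= l.
Proof.
move=> Kn; apply: (ler_cvg_to (f := fun m => \sum_(1 <= k < K.+1)
    (1 - k%:R / n%:R) * tree_comps R n k (k * n) m) _ grid_l).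
  by apply: cvg_sum_seq => k; apply: cvgMr; apply: cvg_tree_comps.
apply: nearW => m; apply: le_trans (grid_mst_le n_gt0 beta m).
exact: grid_mst_ge.
Qed.

Lemma limit_le K (A : R) : 0 < beta -> (0 < K <= n)%N -> 64 <= A ->
  l <= \sum_(1 <= k < K.+1) comp_mass n k (k * (n - k)) + A / K%:R +
    8 * expR (- (A / 8)) + (2 * n%:R * ln n%:R + 1) / beta.
Proof.
move=> b0 Kn A64; apply: (ler_cvg_to grid_l (g := fun m => \sum_(1 <= k < K.+1)
    tree_comps R n k (k * (n - k)) m + A / K%:R +
    8 * expR (- (A / 8)) + (2 * n%:R * ln n%:R + 1) / beta)).
  apply: cvgD; last exact: cvg_cst.
  apply: cvgD; last exact: cvg_cst.
  apply: cvgD; last exact: cvg_cst.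
  by apply: cvg_sum_seq => k; apply: cvg_tree_comps.
apply: nearW => m; apply: (le_trans (le_grid_mst n_gt0 m b0)).
by rewrite lerD2r; apply: grid_mst_upper.
Qed.

Lemma tree_length_le_n (u : edge n -> R) (T : spanning_tree n) :
  (forall e, 0 <= u e <= 1) -> tree_length u T <= n%:R.
Proof.
(* Labels in [0, 1] are a perturbation of the zero labels by at most 1. *)
move=> u01; have /andP[_] := @tree_length_perturb R n 1 (fun=> 0) u n_gt0 ler01
  (fun e => ltac:(by rewrite add0r)) T.
have -> : tree_length (fun=> 0) T = 0 :> R by rewrite /tree_length big1.
by rewrite add0r mulr1.
Qed.

Lemma limit_le_n : l <= n%:R.
Proof.
apply: (cvgr_to_le grid_l); apply: nearW => m.
rewrite -(avg_cst (edge n) (ord0 : 'I_m.+1) n%:R); apply: le_avg => v.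
apply: gibbs_mean_le_max => // T; apply: tree_length_le_n => e; exact: label01.
Qed.

Lemma limit_ge0 : 0 <= l.
Proof.
apply: (cvgr_to_ge grid_l); apply: nearW => m; apply: (avg_ge0 (ord0 : 'I_m.+1)) => v.
apply: gibbs_mean_ge => // T; apply: sumr_ge0 => e _.
by have /andP[] := label01 R (v e).
Qed.

Lemma grid_lengthE m : grid_length n beta m =
  avg (fun v : {ffun edge n -> 'I_m.+1} => \sum_e label R (v e) *
    edge_prob (weight beta (m := m)) setT e v).
Proof.
apply: eq_avg => v; rewrite /gibbs_mean.
have E (T : spanning_tree n) : expR (- beta * tree_length (fun e => label R (v e)) T) =
    tree_weight (weight beta (m := m)) v (val T).
  by rewrite /tree_length mulr_sumr expR_sum.
transitivity (\sum_(F | tree setT F)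
    tree_weight (weight beta (m := m)) v F / total_weight (weight beta (m := m)) setT v *
    \sum_(e in F) label R (v e)).
  rewrite -(big_spanning_tree (fun F => tree_weight (weight beta (m := m)) v F /
    total_weight (weight beta (m := m)) setT v * \sum_(e in F) label R (v e))).
  apply: eq_bigr => T _; rewrite /wst_weight E; congr (_ / _ * _).
  by rewrite /total_weight -big_spanning_tree; apply: eq_bigr => S _; rewrite E.
under eq_bigr do rewrite mulr_sumr.
rewrite (exchange_big_dep xpredT) //=; apply: eq_bigr => e _.
rewrite /edge_prob mulr_suml mulr_sumr; apply: eq_bigr => F _; exact: mulrC.
Qed.

(** The mean weight varies with the mesh; its uniform lower bound (1 + beta)^-1 makes [delta]
    independent of [m], so the limit can be taken. *)
Lemma limit_bounds (eps : R) k g : 0 < eps < 1 -> (0 < g)%N -> (k * g + 2 <= n)%N ->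
  let delta := (2 * (1 + beta) / (g%:R * eps)) ^+ k in
  (1 - eps) * (tilted_mean beta * n.-1%:R) - n%:R ^+ 2 * delta <= l /\
  l <= tilted_mean beta * n.-1%:R / (1 - eps) + n%:R ^+ 2 * delta.
Proof.
move=> e01 g0 kgn delta; have /andP[e0 e1] := e01.
have g0' : 0 < g%:R :> R by rewrite ltr0n.
have b1 : 0 < 1 + beta by rewrite ltr_pwDl.
pose a m := mean (fun t => label R t * weight beta (m := m) t) / mean (weight beta (m := m)).
have a_lim : a m @[m --> \oo] --> tilted_mean beta by apply: cvg_tilted.
have d0 : 0 <= delta by rewrite exprn_ge0 // divr_ge0 ?mulr_ge0 // ltW.
have bounds m : (1 - eps) * (a m * n.-1%:R) - n%:R ^+ 2 * delta <= grid_length n beta m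
    <= a m * n.-1%:R / (1 - eps) + n%:R ^+ 2 * delta.
  rewrite grid_lengthE.
  have w0 t : 0 < weight beta (m := m) t by apply: expR_gt0.
  have w1 t : weight beta (m := m) t <= 1.
    rewrite /weight expR_le1 mulNr oppr_le0 mulr_ge0 //.
    by have /andP[] := label01 R t.
  apply: (expected_length_bounds (ord0 : 'I_m.+1) w0 w1 (@label01 R m) n_gt0 e01 d0) => e.
  apply: (le_trans (prob_share_small (ord0 : 'I_m.+1) w0 w1 e e0 g0 kgn)).
  have mu0 := mean_gt0 (ord0 : 'I_m.+1) w0; have mu1 := mean_weight_ge m beta_ge0.
  move: {w0 w1} (mean (weight beta (m := m))) mu0 mu1 => mu mu0 mu1.
  apply: lerXn2r; rewrite ?nnegrE ?divr_ge0 ?mulr_ge0 ?(ltW mu0) ?(ltW b1) ?(ltW e0) //.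
  have ge0 : 0 < g%:R * eps by apply: mulr_gt0.
  have -> : 2 / (g%:R * mu * eps) = 2 * mu^-1 / (g%:R * eps).
    by field; rewrite !gt_eqF.
  by rewrite ler_pM2r ?invr_gt0 // ler_pM2l // -[leRHS]invrK lef_pV2 ?posrE ?invr_gt0.
split.
  apply: (ler_cvg_to _ grid_l (f := fun m => (1 - eps) * (a m * n.-1%:R) - n%:R ^+ 2 * delta)).
    by apply: cvgB; [apply: cvgMr; apply: cvgMl|exact: cvg_cst].
  by apply: nearW => m; have /andP[] := bounds m.
apply: (ler_cvg_to grid_l (g := fun m => a m * n.-1%:R / (1 - eps) + n%:R ^+ 2 * delta)).
  by apply: cvgD; [apply: cvgMl; apply: cvgMl|exact: cvg_cst].
by apply: nearW => m; have /andP[] := bounds m.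
Qed.

End LimitBounds.

(** * Component masses and convergence to zeta(3) *)

Section ZetaThree.
Variable R : realType.

Lemma cvg_cst_div (a : R) : a / n%:R @[n --> \oo] --> (0 : R).
Proof.
rewrite -(mulr0 a); apply: cvgMr.
apply/(gtr0_cvgV0 (f := fun n => n%:R)); last exact: cvgr_idn.
by near=> n; rewrite ltr0n; near: n; exact: nbhs_infty_gt.
Unshelve. all: by end_near. Qed.

Lemma cvg_divnn : n%:R / n%:R @[n --> \oo] --> (1 : R).
Proof.
apply: cvg_near_cst; near=> n; rewrite divff // pnatr_eq0 -lt0n.
by near: n; exact: nbhs_infty_gt.
Unshelve. all: by end_near. Qed.

Lemma cvg_shift_div (f : nat -> nat) (k j : nat) (c : R) :
  (f n)%:R / n%:R @[n --> \oo] --> c -> (f n + k - j)%:R / n%:R @[n --> \oo] --> c.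
Proof.
move=> fc.
have lo : (f n)%:R / n%:R - j%:R / n%:R @[n --> \oo] --> c.
  by rewrite -[c]subr0; apply: cvgB => //; apply: cvg_cst_div.
have hi : (f n)%:R / n%:R + k%:R / n%:R @[n --> \oo] --> c.
  by rewrite -[c]addr0; apply: cvgD => //; apply: cvg_cst_div.
apply: squeeze_cvgr lo hi; apply: nearW => n.
rewrite -mulrBl -mulrDl !ler_wpM2r ?invr_ge0 // -?natrD ?ler_nat ?leq_subr //.
by rewrite lerBlDr -natrD ler_nat; lia.
Qed.

Lemma cvg_ffact_div (f : nat -> nat) k j (c : R) :
  (f n)%:R / n%:R @[n --> \oo] --> c ->
  ((f n + k) ^_ j)%:R / n%:R ^+ j @[n --> \oo] --> c ^+ j.
Proof.
move=> fc; elim: j => [|j IH].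
  under eq_fun do rewrite divr1; exact: cvg_cst.
have -> : (fun n => ((f n + k) ^_ j.+1)%:R / n%:R ^+ j.+1 : R) =
  (fun n => (((f n + k) ^_ j)%:R / n%:R ^+ j) * ((f n + k - j)%:R / n%:R)).
  by apply/funext => n; rewrite ffactnSr natrM exprSr invfM mulrACA.
by rewrite exprSr; apply: cvgM => //; apply: cvg_shift_div.
Qed.

(** All growing factorials now sit in a quotient of falling factorials of fixed length [k], which
    are products of [k] factors of order [n]. *)
Lemma comp_massE n k b : (0 < k)%N ->
  comp_mass R n k b = labelled_trees R k / k%:R * ((n ^_ k)%:R / ((b + k) ^_ k)%:R).
Proof.
case: k => // k _; rewrite /comp_mass -addSn succnK (addnC k.+1).
have F (m : nat) : m`!%:R != 0 :> R by rewrite pnatr_eq0 -lt0n fact_gt0.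
have ->  : (b + k.+1)`!%:R = ((b + k.+1) ^_ k.+1)%:R * b`!%:R :> R.
  by rewrite -(ffact_fact (leq_addl b k.+1)) addnK natrM.
have -> : (n ^_ k.+1)%:R = 'C(n, k.+1)%:R * (k.+1%:R * k`!%:R) :> R.
  by rewrite -natrM -factS -natrM bin_ffact.
have : ((b + k.+1) ^_ k.+1)%:R != 0 :> R by rewrite pnatr_eq0 -lt0n ffact_gt0 leq_addl.
have : k.+1%:R != 0 :> R by rewrite pnatr_eq0.
move: (k.+1%:R) (k`!%:R) (b`!%:R) (F b) ((b + _) ^_ _)%:R (labelled_trees _ _) ('C(_,_)%:R).
by move=> a x y y0 z c w a0 z0; field; rewrite a0 y0 z0.
Qed.

(** The quotient of falling factorials tends to k^(-k), and k^(k-2) / k times this is k^(-3). Only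
    the limit of f n / n matters, so the exponents [k * n] and [k * (n - k)] are treated alike. *)
Lemma cvg_comp_mass (f : nat -> nat) k : (0 < k)%N ->
  (f n)%:R / n%:R @[n --> \oo] --> (k%:R : R) ->
  comp_mass R n k (f n) @[n --> \oo] --> (k%:R ^- 3 : R).
Proof.
move=> k0 fk.
have k0' : k%:R != 0 :> R by rewrite pnatr_eq0 -lt0n.
have a := @cvg_ffact_div id 0 k 1 cvg_divnn; have b := @cvg_ffact_div f k k _ fk.
have h : labelled_trees R k / k%:R * ((((n + 0) ^_ k)%:R / n%:R ^+ k) *
    (((f n + k) ^_ k)%:R / n%:R ^+ k)^-1) @[n --> \oo] -->
    labelled_trees R k / k%:R * (1 ^+ k * (k%:R ^+ k)^-1).
  by apply: cvgMr; apply: cvgM => //; apply: cvgV => //; rewrite expf_neq0.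
have E : labelled_trees R k / k%:R * (1 ^+ k * (k%:R ^+ k)^-1) = k%:R ^- 3.
  rewrite expr1n mul1r /labelled_trees; case: k k0 k0' {fk a b h} => // k _ k0'.
  rewrite exprS succnK; move: (k.+1%:R) k0' => a a0; field.
  by rewrite a0 expf_neq0.
rewrite E in h; apply: (cvg_trans _ h); apply: near_eq_cvg; near=> n.
rewrite comp_massE // addn0; congr (_ * _).
rewrite invf_div mulrA divfK // expf_neq0 // pnatr_eq0 -lt0n.
by near: n; exact: nbhs_infty_gt.
Unshelve. all: by end_near. Qed.

(** Comparison with the telescoping differences 1 / a - 1 / (a + 1). *)
Lemma cube_sum_le K : \sum_(1 <= k < K.+2) (k%:R ^- 3 : R) <= 2 - K.+1%:R^-1.
Proof.
elim: K => [|K IH]; first by rewrite big_nat1; lra.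
rewrite big_nat_recr //=; apply: le_trans (lerD IH (lexx _)) _.
have -> : K.+2%:R = K.+1%:R + 1 :> R by rewrite -[K.+2]addn1 natrD.
have : 0 < K.+1%:R :> R by rewrite ltr0n.
move: (K.+1%:R) => a a0.
rewrite -subr_ge0.
have -> : 2 - (a + 1)^-1 - (2 - a^-1 + (a + 1) ^- 3) =
  (a ^+ 2 + a + 1) / (a * (a + 1) ^+ 3) by field; rewrite !gt_eqF; lra.
by rewrite divr_ge0 ?addr_ge0 ?mulr_ge0 ?exprn_ge0 ?addr_ge0 // ltW.
Qed.

Lemma zeta3 : exists2 z : R, zeta (3%:R : R) = z%:E &
  \sum_(1 <= k < K) (k%:R ^- 3 : R) @[K --> \oo] --> z /\
  forall K, \sum_(1 <= k < K) (k%:R ^- 3 : R) <= z.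
Proof.
pose s K : R := \sum_(1 <= k < K) k%:R ^- 3.
have t0 k : 0 <= k%:R ^- 3 :> R by rewrite invr_ge0 exprn_ge0.
have mono : nondecreasing_seq s.
  apply/nondecreasing_seqP => -[|K]; rewrite /s; first by rewrite !big_geq.
  by rewrite [leRHS]big_nat_recr //= lerDl.
have cs : cvgn s.
  apply: nondecreasing_is_cvgn => //; exists 2 => _ [[|[|K]] _ <-]; rewrite /s.
  - by rewrite big_geq.
  - by rewrite big_geq.
  - by apply: le_trans (cube_sum_le K) _; rewrite gerBl invr_ge0.
exists (limn s); last by split => // K; apply: nondecreasing_cvgn_le.
rewrite /zeta -EFin_lim //; congr (limn _); apply/funext => K /=; rewrite sumEFin; congr EFin.
by apply: eq_bigr => k _; rewrite powRN powR_mulrn.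
Qed.

Lemma cvg_zeta3 (L err : R^nat) :
  (forall K, \forall n \near \oo,
     \sum_(1 <= k < K) (1 - k%:R / n%:R) * comp_mass R n k (k * n) <= L n) ->
  (forall K (A : R), (0 < K)%N -> 64 <= A -> \forall n \near \oo,
     L n <= \sum_(1 <= k < K.+1) comp_mass R n k (k * (n - k)) + A / K%:R +
       8 * expR (- (A / 8)) + err n) ->
  err n @[n --> \oo] --> (0 : R) ->
  (L n)%:E @[n --> \oo] --> zeta (3%:R : R).
Proof.
have [z -> [sz s_le]] := zeta3 => lo hi err0.
have cvg_sum_nat K (f : nat -> nat -> R) :
    (forall k, (0 < k)%N -> f k n @[n --> \oo] --> (k%:R ^- 3 : R)) ->
    \sum_(1 <= k < K) f k n @[n --> \oo] --> \sum_(1 <= k < K) (k%:R ^- 3 : R).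
  move=> fk; elim: K => [|[|K] IH].
  - by rewrite big_geq //; under eq_fun do rewrite big_geq //; exact: cvg_cst.
  - by rewrite big_geq //; under eq_fun do rewrite big_geq //; exact: cvg_cst.
  rewrite big_nat_recr //=; under eq_fun do rewrite big_nat_recr //=.
  by apply: cvgD => //; apply: fk.
apply/cvg_EFin; first by apply: nearW.
apply/cvgrPdist_le => e e0.
have e2 : 0 < e / 2 by rewrite divr_gt0.
have lower : \forall n \near \oo, z - e <= L n.
  have /cvgrPdist_lt/(_ _ e2) [K _ Ksz] := sz.
  have h : \sum_(1 <= k < K) (1 - k%:R / n%:R) * comp_mass R n k (k * n) @[n --> \oo] -->
      \sum_(1 <= k < K) (k%:R ^- 3 : R).
    apply: cvg_sum_nat => k k0; rewrite -[k%:R ^- 3]mul1r; apply: cvgM.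
      by rewrite -[X in _ --> X]subr0; apply: cvgB; [exact: cvg_cst|exact: cvg_cst_div].
    apply: cvg_comp_mass => //; rewrite -[X in _ --> X]mulr1.
    under eq_fun do rewrite natrM -mulrA; by apply: cvgMr; exact: cvg_divnn.
  have /cvgrPdist_lt/(_ _ e2) h2 := h.
  have := Ksz K (leqnn K); rewrite /= ltr_norml => /andP[_ kz].
  apply: filterS2 h2 (lo K) => n; rewrite ltr_norml => /andP[_ hn] ln; lra.
have upper : \forall n \near \oo, L n <= z + e.
  (* Half of [e] is kept for the convergence of the sum, a quarter each for A / K and the
     exponential term. The latter needs exp (A / 8) >= 32 / e, ensured by A / 8 >= 32 / e; [K] is
     then chosen after [A]. *)
  pose A : R := 64 + 256 / e; pose K := (Num.truncn (4 * A / e)).+1.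
  have A64 : 64 <= A by rewrite lerDl; apply: divr_ge0; [exact: ler0n|exact: ltW].
  have A0 : 0 < A by lra.
  have AK : A / K%:R <= e / 4.
    have : 4 * A / e < K%:R by apply: truncnS_gt.
    by rewrite ler_pdivrMr ?ltr0n // ltr_pdivrMr //; lra.
  have Ae : 8 * expR (- (A / 8)) <= e / 4.
    suff : expR (- (A / 8)) <= (32 / e)^-1 by rewrite invf_div; lra.
    rewrite expRN lef_pV2 ?posrE ?expR_gt0 ?divr_gt0 //.
    by apply: le_trans (expR_ge1Dx _); rewrite /A; lra.
  have h : \sum_(1 <= k < K.+1) comp_mass R n k (k * (n - k)) + A / K%:R +
       8 * expR (- (A / 8)) + err n @[n --> \oo] -->
      \sum_(1 <= k < K.+1) (k%:R ^- 3 : R) + A / K%:R + 8 * expR (- (A / 8)) + 0.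
    apply: cvgD => //; apply: cvgD; last exact: cvg_cst.
    apply: cvgD; last exact: cvg_cst.
    apply: cvg_sum_nat => k k0; apply: cvg_comp_mass => //.
    rewrite -[X in _ --> X]mulr1; under eq_fun do rewrite natrM -mulrA; apply: cvgMr.
    by have := @cvg_shift_div id 0 k 1 cvg_divnn; under eq_fun do rewrite addn0.
  have /cvgrPdist_lt/(_ _ e2) h2 := h.
  have kz := s_le K.+1.
  apply: filterS2 h2 (hi K A (ltn0Sn _) A64) => n; rewrite ltr_norml => /andP[hn _] ln; lra.
apply: filterS2 lower upper => n lo_n hi_n; rewrite /= ler_norml; lra.
Qed.

End ZetaThree.

(** * The intermediate regime *)

Section LinearBound.
Variable R : realType.

Lemma limn_esup_lty (u : (\bar R)^nat) : (limn_esup u < +oo)%E <->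
  exists C : R, \forall n \near \oo, (u n <= C%:E)%E.
Proof.
split=> [/ereal_inf_lt[_ [A FA <-]] supA|[C uC]].
  (* The maximum with 0 keeps the bound finite even if the supremum is -oo. *)
  exists (fine (maxe 0%E (ereal_sup (u @` A)))).
  apply: filterS FA => n An; rewrite fineK.
    by rewrite le_max; apply/orP; right; apply: ereal_sup_ubound; exists n.
  by rewrite ge0_fin_numE ?le_max ?lexx // gt_max supA ltry.
apply: le_lt_trans (ltry C).
apply: (@le_trans _ _ (ereal_sup (u @` [set n | (u n <= C%:E)%E]))).
  by apply: ereal_inf_lbound; exists [set n | (u n <= C%:E)%E].
by apply: ge_ereal_sup => _ [n un <-].
Qed.

Lemma limit_le_const (n : nat) (b l : R) : (0 < n)%N -> 0 < b ->
  grid_length n b m @[m --> \oo] --> l ->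
  l <= 73 + (2 * n%:R * ln n%:R + 1) / b.
Proof.
move=> n0 b0 grid_l.
(* With K = 1 and A = 64 the contributions are 1 from isolated vertices, 64 from A / K and at most 8
   from the exponential, in total 73. *)
have := limit_le n0 grid_l (K := 1) b0 _ (lexx _).
rewrite n0 big_nat1 => /(_ isT).
have -> : comp_mass R n 1 (1 * (n - 1)) = 1.
  rewrite comp_massE // /labelled_trees expr0 !divr1 mul1r !ffactn1 mul1n subnK // divff //.
  by rewrite pnatr_eq0 -lt0n.
have : expR (- (64 / 8)) <= 1 :> R by rewrite expR_le1 oppr_le0.
lra.
Qed.

(** If [b <= ln n], then b + ln n <= 2 ln n and [l <= n] suffices. Otherwise b + ln n <= 2 b: the
    constant 73 costs 146 b <= 146 C n ln n, and the other term at most 4 n ln n + 2. *)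
Lemma linear_bound (n : nat) (b l C : R) : 0 <= b -> 1 <= ln (n%:R : R) ->
  b / (n%:R * ln n%:R) <= C -> l <= n%:R ->
  (0 < b -> l <= 73 + (2 * n%:R * ln n%:R + 1) / b) ->
  l / (n%:R * ln n%:R / (b + ln n%:R)) <= 146 * C + 8.
Proof.
move=> b0 ln1 bC ln lb.
have n1 : 1 <= n%:R :> R.
  by case: n {bC lb ln} ln1 => [|n _]; [rewrite ln0 // ler10|rewrite ler1n].
move: (n%:R) (ln n%:R) n1 ln1 bC ln lb => x y x1 y1 bC lx lb.
have x0 : 0 < x by lra. have y0 : 0 < y by lra.
have xy0 : 0 < x * y by apply: mulr_gt0.
have C0 : 0 <= C by apply: le_trans bC; rewrite divr_ge0 // ltW.
have by0 : 0 < b + y by lra.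
rewrite ler_pdivrMr ?divr_gt0 // mulrA ler_pdivlMr //.
move: bC; rewrite ler_pdivrMr // => bC.
have [b_le|b_gt] := leP b y.
  have h1 : l * (b + y) <= x * (b + y) by apply: ler_wpM2r => //; apply: ltW.
  have h2 : x * (b + y) <= x * (2 * y) by apply: ler_wpM2l; lra.
  have : 0 <= C * (x * y) by apply: mulr_ge0 => //; apply: ltW.
  lra.
have b0' : 0 < b by lra.
have xy1 : 1 <= x * y by rewrite -[1]mulr1; apply: ler_pM.
have h1 : l * (b + y) <= (73 + (2 * x * y + 1) / b) * (b + y).
  by apply: ler_wpM2r; [exact: ltW|exact: lb].
have h2 : (2 * x * y + 1) / b * (b + y) <= (2 * x * y + 1) * 2.
  by rewrite -mulrA; apply: ler_wpM2l; [lra|rewrite ler_pdivrMl //; lra].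
lra.
Qed.

End LinearBound.

(** * Group sizes and the low-beta regime *)

Section LowBeta.
Variable R : realType.

Lemma nearln_ge (A : R) : \forall n \near \oo, A <= ln (n%:R : R).
Proof.
apply: filterS (nbhs_infty_ger (expR A)) => n /=.
by move=> nA; rewrite -[A]expRK ler_ln ?posrE ?expR_gt0 // (lt_le_trans _ nA) ?expR_gt0.
Qed.

Lemma cvg_ln_div : ln n%:R / n%:R @[n --> \oo] --> (0 : R).
Proof.
apply/cvgrPdist_le => e e0.
have e2 : 0 < e / 2 by rewrite divr_gt0.
have /cvgrPdist_le/(_ _ e2) := cvg_cst_div (ln (e / 2)).
apply: filterS3 (nearln_ge 0) (nbhs_infty_gt 0) => n /= ln0 n0.
have n0' : 0 < n%:R :> R by rewrite ltr0n.
rewrite !sub0r !normrN ler_norml => /andP[h _].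
rewrite ger0_norm ?divr_ge0 ?ler0n // ler_pdivrMr //.
move: h; rewrite ler_pdivlMr // => h.
(* Applying ln y <= y - 1 at y = e n / 2 leaves only the constant - ln (e / 2), absorbed by the
   other half of e n. *)
have : ln (e / 2 * n%:R) <= e / 2 * n%:R - 1.
  have := @le_ln1Dx R (e / 2 * n%:R - 1); rewrite subrKC; apply.
  by rewrite ltrBrDr addrC subrr mulr_gt0.
rewrite lnM ?posrE //; lra.
Qed.

(** [k] is the first integer above 3 ln n, hence at most 4 ln n, and [g] is the largest size that
    fits. As n >= 16 ln n >= 16, the factor 8 absorbs all roundings. *)
Lemma group_count n : (0 < n)%N -> 1 <= ln (n%:R : R) -> 16 * (ln n%:R / n%:R) <= 1 :> R ->
  exists k g, [/\ (0 < g)%N, (k * g + 2 <= n)%N,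
    3 * ln n%:R <= k%:R :> R & n%:R <= 8 * ln n%:R * g%:R :> R].
Proof.
move=> n0 ln1; rewrite mulrA ler_pdivrMr ?ltr0n // mul1r => ln16.
pose k := (Num.truncn (3 * ln n%:R : R)).+1; pose g := ((n - 2) %/ k)%N.
have ln3 : 0 <= 3 * ln n%:R :> R by lra.
have /andP[k_le lt_k] := truncn_itv ln3.
have n2 : (2 <= n)%N by rewrite -(ler_nat R); lra.
have n_le : n%:R <= 8 * ln n%:R * g%:R :> R.
  have : ((n - 2) < g.+1 * k)%N by apply: ltn_ceil.
  rewrite -(ltr_nat R) natrM natrB // -addn1 natrD => h.
  have k4 : k%:R <= 4 * ln n%:R :> R by rewrite /k -addn1 natrD; lra.
  have : (g%:R + 1) * k%:R <= (g%:R + 1) * (4 * ln n%:R) :> R.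
    by apply: ler_wpM2l => //; rewrite addr_ge0.
  lra.
exists k, g; split => //; last exact: ltW.
  rewrite lt0n; apply: contraTneq n_le => ->.
  by rewrite mulr0 -ltNge ltr0n.
by rewrite -[leqRHS](subnK n2) leq_add2r mulnC leq_trunc_div.
Qed.

(** The 3 makes the power at most n^-3, enough to beat the factor n^2 from the number of edges. *)
Lemma group_prob_le n k (base : R) : (0 < n)%N -> 0 <= base <= expR (-1) ->
  3 * ln n%:R <= k%:R :> R -> n%:R ^+ 2 * base ^+ k <= n%:R^-1.
Proof.
move=> n0 /andP[b0 b1] k3; have n0' : 0 < n%:R :> R by rewrite ltr0n.
have h : base ^+ k <= n%:R ^- 3.
  apply: (@le_trans _ _ (expR (- 1) ^+ k)); first by apply: lerXn2r => //; rewrite nnegrE expR_ge0.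
  rewrite -expRM_natl -[n%:R in leRHS]lnK ?posrE // -expRM_natl -expRN ler_expR.
  by rewrite mulrN1 lerN2.
apply: le_trans (ler_wpM2l _ h) _; first by rewrite exprn_ge0.
by rewrite [n%:R ^+ 3]exprS invfM mulrC divfK // expf_neq0 // gt_eqF.
Qed.

Lemma low_beta_ratio (n : nat) (b l f eps D : R) : 1 <= n%:R :> R ->
  0 <= b <= n%:R -> (4 + b)^-1 <= f -> 0 < eps < 1 / 2 -> D <= n%:R^-1 ->
  6 / n%:R <= eps ->
  (1 - eps) * (f * n.-1%:R) - D <= l -> l <= f * n.-1%:R / (1 - eps) + D ->
  `|1 - l / (n%:R * f)| <= 3 * eps.
Proof.
move=> n1 /andP[b0 bn] bf /andP[e0 e1] Dn n6 lo hi.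
have b4 : 0 < 4 + b by rewrite ltr_pwDl.
have f0 : 0 < f by apply: lt_le_trans bf; rewrite invr_gt0.
have n0 : (0 < n)%N by rewrite -(ltr_nat R) (lt_le_trans ltr01).
move: lo hi; rewrite -[n.-1]subn1 natrB //.
move: (n%:R) n1 bn Dn n6 => N n1 bn Dn n6; have N0 : 0 < N by lra.
(* Here 1 / n <= 5 / (4 + n) <= 5 / (4 + b) <= 5 f. Adding the [f] lost by having n - 1 edges
   instead of n, the additive error is at most 6 f, hence the requirement 6 / n <= eps. *)
have D5 : D <= 5 * f.
  apply: (le_trans Dn); rewrite -div1r ler_pdivrMr //.
  move: bf; rewrite -div1r ler_pdivrMr // => bf.
  have h : f * b <= f * N by apply: ler_wpM2l => //; exact: ltW.
  have : f * 1 <= f * N by apply: ler_wpM2l => //; exact: ltW.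
  lra.
have q0 : 0 < N * f by apply: mulr_gt0.
have f6 : 6 * f <= eps * (N * f).
  by rewrite mulrA; apply: ler_wpM2r; [exact: ltW|rewrite -ler_pdivrMr].
have Nf : f * (N - 1) = N * f - f by ring.
rewrite {}Nf => lo hi; move: (N * f) q0 f6 lo hi => q q0 f6 lo hi.
have ef : 0 <= eps * f by rewrite mulr_ge0 // ltW.
have hi' : (q - f) / (1 - eps) <= (1 + 2 * eps) * q.
  rewrite ler_pdivrMr; last lra.
  have : 0 <= eps * (1 - 2 * eps) * q by rewrite !mulr_ge0 //; lra.
  lra.
have eq0 : 0 <= eps * q by rewrite mulr_ge0 // ltW.
have l_lo : (1 - 3 * eps) * q <= l by lra.
have l_hi : l <= (1 + 3 * eps) * q by lra.
rewrite ler_norml; apply/andP; split.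
  by rewrite lerBrDr addrC -lerBrDr opprK ler_pdivrMr // addrC; lra.
by rewrite lerBlDr -lerBlDl ler_pdivlMr.
Qed.

Lemma cvg_low_beta (b L f : R^nat) : (forall n, 0 <= b n) ->
  (forall n, (4 + b n)^-1 <= f n) ->
  b n / (n%:R / ln n%:R) @[n --> \oo] --> (0 : R) ->
  (forall n (eps : R) k g, (0 < n)%N -> 0 < eps < 1 -> (0 < g)%N -> (k * g + 2 <= n)%N ->
     let delta := (2 * (1 + b n) / (g%:R * eps)) ^+ k in
     (1 - eps) * (f n * n.-1%:R) - n%:R ^+ 2 * delta <= L n /\
     L n <= f n * n.-1%:R / (1 - eps) + n%:R ^+ 2 * delta) ->
  L n / (n%:R * f n) @[n --> \oo] --> (1 : R).
Proof.
move=> b0 bf bn bounds; apply/cvgrPdist_le => e e0.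
(* The bound [low_beta_ratio] loses a factor 3 and requires eps < 1/2. *)
pose eps := Num.min e 1 / 3.
have [eps0 eps1 epse] : [/\ 0 < eps, eps < 1 / 2 & 3 * eps <= e].
  rewrite /eps; have : Num.min e 1 <= e by rewrite ge_min lexx.
  have : Num.min e 1 <= 1 by rewrite ge_min lexx orbT.
  have : 0 < Num.min e 1 by rewrite lt_min e0 ltr01.
  by move=> *; split; lra.
clearbody eps.
(* [c] will bound both ln n / n and b ln n / n. Then (1 + b) ln n <= 2 c n <= 16 c g ln n, so the
   base of [delta] is at most 32 c / eps <= exp (- 1). The minimum with 1 ensures b <= n. *)
pose c := Num.min 1 (expR (-1) * eps / 16) / 2.
have c0 : 0 < c by rewrite divr_gt0 // lt_min ltr01 divr_gt0 // mulr_gt0 // expR_gt0.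
have c1 : 2 * c <= 1 by rewrite /c mulrC divfK // ge_min lexx.
have c2 : 2 * c <= expR (-1) * eps / 16 by rewrite /c mulrC divfK // ge_min lexx orbT.
clearbody c.
have c16 : 0 < 16^-1 :> R by rewrite invr_gt0.
have /cvgrPdist_le/(_ _ c0) lnc := cvg_ln_div.
have /cvgrPdist_le/(_ _ c16) ln16 := cvg_ln_div.
have /cvgrPdist_le/(_ _ c0) bc := bn.
have /cvgrPdist_le/(_ _ eps0) n6 := cvg_cst_div (6 : R).
near=> n.
have n0 : (0 < n)%N by near: n; exact: nbhs_infty_gt.
have n0' : 0 < n%:R :> R by rewrite ltr0n.
have n1 : 1 <= n%:R :> R by rewrite ler1n.
have ln1 : 1 <= ln (n%:R : R) by near: n; exact: nearln_ge.
have hln : ln n%:R / n%:R <= c.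
  by apply: le_trans (ler_norm _) _; rewrite -normrN -sub0r; near: n; exact: lnc.
have hb : b n / (n%:R / ln n%:R) <= c.
  by apply: le_trans (ler_norm _) _; rewrite -normrN -sub0r; near: n; exact: bc.
have h16 : 16 * (ln n%:R / n%:R) <= 1 :> R.
  have : ln n%:R / n%:R <= 16^-1 :> R.
    by apply: le_trans (ler_norm _) _; rewrite -normrN -sub0r; near: n; exact: ln16.
  lra.
have h6 : 6 / n%:R <= eps.
  by apply: le_trans (ler_norm _) _; rewrite -normrN -sub0r; near: n; exact: n6.
have [k [g [g0 kgn k3 ng]]] := group_count n0 ln1 h16.
have e01 : 0 < eps < 1 by rewrite eps0; lra.
have [lo hi] := bounds n eps k g n0 e01 g0 kgn.
apply: le_trans epse; apply: low_beta_ratio lo hi => //.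
- rewrite b0 /=; move: hb; rewrite invf_div mulrA ler_pdivrMr // => hb.
  have : b n * 1 <= b n * ln n%:R by apply: ler_wpM2l.
  have : c * n%:R <= 1 * n%:R by apply: ler_wpM2r; lra.
  lra.
- by rewrite eps0.
apply: group_prob_le => //.
have g0' : 0 < g%:R :> R by rewrite ltr0n.
have b1 : 0 <= 1 + b n by rewrite addr_ge0.
rewrite divr_ge0 ?mulr_ge0 ?(ltW g0') ?(ltW eps0) //=.
rewrite ler_pdivrMr ?mulr_gt0 //.
move: hln hb; rewrite invf_div mulrA !ler_pdivrMr // => hln hb.
have h1 : (1 + b n) * n%:R <= (1 + b n) * (8 * ln n%:R * g%:R) by apply: ler_wpM2l.
have h2 : g%:R * (ln n%:R + b n * ln n%:R) <= g%:R * (2 * c * n%:R).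
  by apply: ler_wpM2l; [exact: ltW|lra].
have h3 : 1 + b n <= 8 * g%:R * (2 * c) by rewrite -(ler_pM2r n0'); lra.
have : g%:R * (2 * c) <= g%:R * (expR (-1) * eps / 16) by apply: ler_wpM2l => //; exact: ltW.
lra.
Unshelve. all: by end_near. Qed.

End LowBeta.

(** * The three regimes of the inverse temperature *)

Theorem theorem1p8 (R : realType) (beta : nat -> R)
    (beta_ge0 : forall n, 0 <= beta n)
    (d : nat -> measure_display) (Om : forall n, measurableType (d n))
    (P : forall n, probability (Om n) R)
    (U : forall n, edge n -> {RV (P n) >-> R})
    (W : forall n, Om n -> spanning_tree n)
    (hW : forall n, (0 < n)%N -> is_wst (beta n) (@U n) (@W n)) :
  (asymp_gg beta (fun n => n%:R * ln n%:R) ->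
     expected_length (@U n) (@W n) @[n --> \oo] --> zeta (3%:R : R))
  /\
  (asymp_O (fun n => (beta n)%:E) (fun n => n%:R * ln n%:R) ->
     asymp_O (fun n => expected_length (@U n) (@W n))
       (fun n => n%:R * ln n%:R / (beta n + ln n%:R)))
  /\
  (asymp_gg (fun n => n%:R / ln n%:R) beta ->
     exists2 o : nat -> R, o n @[n --> \oo] --> (0 : R) &
       \forall n \near \oo,
         expected_length (@U n) (@W n) =
         ((1 + o n) * low_beta_length n (beta n))%:E).
Proof.
(* From here on the probability spaces enter only through the real sequence [L] of grid limits. *)
have [L hL] : exists L : R^nat, forall n, (0 < n)%N ->
    expected_length (@U n) (@W n) = (L n)%:E /\
    grid_length n (beta n) m @[m --> \oo] --> L n.
  exists (fun n => fine (expected_length (@U n) (@W n))) => n n0.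
  by have [l -> gl] := expected_length_lim n0 (beta_ge0 n) (hW n n0).
have near_L : \forall n \near \oo, expected_length (@U n) (@W n) = (L n)%:E.
  by apply: filterS (nbhs_infty_gt 0) => n /hL[].
split; [|split].
- move=> [b_neq0 b_inf].
  have b_gt0 : \forall n \near \oo, 0 < beta n.
    by apply: filterS b_neq0 => n bn; rewrite lt_def bn beta_ge0.
  suff h : (L n)%:E @[n --> \oo] --> zeta (3%:R : R).
    by apply: (cvg_trans _ h); apply: near_eq_cvg; apply: filterS near_L => n ->.
  apply: (@cvg_zeta3 R L (fun n => (2 * n%:R * ln n%:R + 1) / beta n)).
  + move=> K; apply: filterS2 (nbhs_infty_gt 0) (nbhs_infty_ge K) => n n0 Kn.
    have [_ gl] := hL n n0.
    case: K Kn => [|K] Kn; last by apply: (limit_ge n0 gl); exact: ltnW.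
    by rewrite big_geq //; exact: limit_ge0 gl.
  + move=> K A K0 A64.
    apply: filterS2 b_gt0 (nbhs_infty_ge K) => n bn Kn.
    have n0 := leq_trans K0 Kn; have [_ gl] := hL n n0.
    by apply: limit_le => //; rewrite K0.
  have -> : 0 = 2 * 0 + 0 :> R by rewrite mulr0 addr0.
  (* The stray 1 / beta is dominated by n ln n / beta as soon as n ln n >= 1. *)
  have inv0 : (beta n)^-1 @[n --> \oo] --> (0 : R).
    apply: (@squeeze_cvgr _ _ _ _ (fun=> 0) (fun n => n%:R * ln n%:R / beta n)) => //;
      last exact: cvg_cst.
    apply: filterS3 (nearln_ge (1 : R)) b_gt0 (nbhs_infty_gt 0) => n ln1 bn n0.
    rewrite invr_ge0 beta_ge0 /= ler_peMl ?invr_ge0 ?beta_ge0 //.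
    by rewrite mulr_ege1 // ler1n.
  have -> : (fun n => (2 * n%:R * ln n%:R + 1) / beta n) =
      (fun n => 2 * (n%:R * ln n%:R / beta n) + (beta n)^-1).
    by apply/funext => n; rewrite mulrDl div1r !mulrA.
  by apply: cvgD => //; apply: cvgMr.
- move=> [nln_neq0 /limn_esup_lty[C bC]]; split.
    apply: filterS2 nln_neq0 (nearln_ge (1 : R)) => n nln ln1.
    by rewrite mulf_neq0 // invr_neq0 // gt_eqF // (ltr_wpDl (beta_ge0 n) (lt_le_trans ltr01 ln1)).
  apply/limn_esup_lty; exists (146 * C + 8).
  apply: filterS3 bC (nearln_ge (1 : R)) (nbhs_infty_gt 0) => n bC ln1 n0.
  have [-> gl] := hL n n0; rewrite -EFinM lee_fin.
  by apply: (linear_bound (beta_ge0 n) ln1 bC (limit_le_n n0 gl)) => bn; exact: limit_le_const gl.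
move=> [nln_neq0 bn].
pose f n := tilted_mean (beta n).
have f_ge n : (4 + beta n)^-1 <= f n by apply: tilted_mean_ge.
(* The relative error itself is the witness; for n > 0 the denominator is positive because f n >= 1
   / (4 + beta n). *)
exists (fun n => L n / (n%:R * f n) - 1).
  rewrite -[X in _ --> X](subrr 1); apply: cvgB; last exact: cvg_cst.
  apply: (@cvg_low_beta R beta L f) => // n eps k g n0 e01 g0 kgn.
  by have [_ gl] := hL n n0; apply: limit_bounds gl _ _ _ e01 g0 kgn.
apply: filterS (nbhs_infty_gt 0) => n n0; have [-> _] := hL n n0.
rewrite low_beta_lengthE addrC subrK divfK // mulf_neq0 //.
  by rewrite pnatr_eq0 -lt0n.
by rewrite gt_eqF // (lt_le_trans _ (f_ge n)) // invr_gt0 ltr_pwDl.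
Qed.
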